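(* Let $(M,\omega)$ be an $n$-dimensional compact Chern-Kähler-like Hermitian manifold. (1) If $\mathrm{Ric}_k(\omega)>0$ for some $k\in\{1,\ldots,n\}$, then there exists a positive constant $C=C(\omega)$ such that $\Gamma^p_q(M)=0$ for all $p,q\in\mathbb{Z}_{\geq 0}$ with $q>C\cdot p$, and consequently $\Gamma^0_q(M)=0$ for all $q\geq 1$. In particular the Hodge numbers satisfy $h^{q,0}(M)=0$ for $1\leq q\leq n$. (2) If $\mathrm{Ric}_k(\omega)<0$ for some $k\in\{1,\ldots,n\}$, then there exists a positive constant $C=C(\omega)$ such that $\Gamma^p_q(M)=0$ for all $p,q\in\mathbb{Z}_{\geq 0}$ with $p>C\cdot q$, and consequently $\Gamma^p_0(M)=0$ for all $p\geq 1$.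
   Context: $TM$ and $T^{\ast}M$ denote the holomorphic tangent and cotangent bundles of $M$, and $T_xM$ the $(1,0)$-type tangent space at $x$. For $p,q\in\mathbb{Z}_{\geq 0}$, $\Gamma^p_q(M):=H^0\big(M,(TM)^{\otimes p}\otimes(T^{\ast}M)^{\otimes q}\big)$ is the space of $(p,q)$-type holomorphic tensor fields, where $H^0$ denotes global holomorphic sections. $h^{q,0}(M)$ is the dimension of the space of holomorphic $q$-forms on $M$. Chern curvature: for a Hermitian manifold $(M,\omega)$ let $\nabla$ be the Chern connection of $(TM,\omega)$ and $R=\nabla^2$ its curvature, a $(1,1)$-form with values in endomorphisms of $TM$. For $X,Y,Z,W\in T_xM$, $R(X,\overline{Y},Z,\overline{W}):=\langle R_{X\overline{Y}}(Z),W\rangle$, where $R_{X\overline{Y}}$ is the endomorphism obtained by evaluating $R$ on $(X,\overline{Y})$ and $\langle\cdot,\cdot\rangle$ is the Hermitian metric $\omega$. Chern-Kähler-like: the Hermitian metric $\omega$ is called Chern-Kähler-like if $R(X,\overline{Y},Z,\overline{W})=R(Z,\overline{Y},X,\overline{W})$ for all $(1,0)$-type tangent vectors $X,Y,Z,W$. $k$-Ricci curvature: for $x\in M$, a $k$-dimensional complex subspace $\Sigma\subset T_xM$ with unitary basis $\{E_1,\ldots,E_k\}$, and $X\in\Sigma$, set $\mathrm{Ric}_k(x,\Sigma)(X,\overline{X}):=\sum_{i=1}^kR(X,\overline{X},E_i,\overline{E_i})$. One writes $\mathrm{Ric}_k(\omega)>0$ (resp. $<0$) if $\mathrm{Ric}_k(x,\Sigma)(X,\overline{X})>0$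 (resp. $<0$) for every $x\in M$, every $k$-dimensional subspace $\Sigma\subset T_xM$ and every nonzero $X\in\Sigma$. *)

(* Defs.v *)
(* Complex manifolds, Hermitian metrics, Chern curvature and holomorphic tensor
   fields, over MathComp-Analysis.  Everything on a manifold is expressed
   through its components in the charts of a given holomorphic atlas. *)
From HB Require Import structures.
From mathcomp Require Import all_boot all_order all_algebra all_fingroup.
From mathcomp Require Import complex.
From mathcomp Require Import all_classical all_reals all_analysis.

Set Implicit Arguments.
Unset Strict Implicit.
Unset Printing Implicit Defensive.

Import Order.TTheory GRing.Theory Num.Theory numFieldNormedType.Exports.
Local Open Scope classical_set_scope.
Local Open Scope ring_scope.
Local Open Scope complex_scope.

(* [^o] gives [R[i]] its usual topology. *)
Notation Cplx R := (R[i]^o).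
Notation Cspace R n := ('rV[R[i]^o]_n).

Section Calculus.
Context {R : realType} {n : nat}.
Implicit Types (f : Cspace R n -> Cplx R) (u v z : Cspace R n)
  (U : set (Cspace R n)) (i : 'I_n).

Definition re_line f v z (t : R) : R := complex.Re (f (z + t%:C *: v)).
Definition im_line f v z (t : R) : R := complex.Im (f (z + t%:C *: v)).

(* Derivative with respect to a real parameter, in the direction [v]. *)
Definition dir_derivable f v z : Prop :=
  derivable (re_line f v z) 0 1 /\ derivable (im_line f v z) 0 1.
Definition dir_deriv f v z : Cplx R :=
  derive1 (re_line f v z) 0 +i* derive1 (im_line f v z) 0.

(* Class C^m on an open set, in the sense of real calculus on
   C^n = R^(2n): the directions [v] include both [e_i] and ['i *: e_i]. *)
Fixpoint class_C (m : nat) U f : Prop :=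
  (forall z, U z -> {for z, continuous f}) /\
  if m is m'.+1 then
    forall v, (forall z, U z -> dir_derivable f v z) /\
              class_C m' U (dir_deriv f v)
  else True.

Definition smooth_on U f : Prop := forall m, class_C m U f.

Definition basis_vec i : Cspace R n := delta_mx 0 i.

(* d/dz_i = (d/dx_i - 'i d/dy_i) / 2  and  d/d\bar z_i = (d/dx_i + 'i d/dy_i) / 2 *)
Definition dz i f z : Cplx R :=
  2^-1 * (dir_deriv f (basis_vec i) z
          - 'i%C * dir_deriv f ('i%C *: basis_vec i) z).
Definition dzbar i f z : Cplx R :=
  2^-1 * (dir_deriv f (basis_vec i) z
          + 'i%C * dir_deriv f ('i%C *: basis_vec i) z).

Definition dz_mx p q i (F : Cspace R n -> 'M[Cplx R]_(p, q)) z :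
    'M[Cplx R]_(p, q) := \matrix_(k, l) dz i (fun w => F w k l) z.
Definition dzbar_mx p q i (F : Cspace R n -> 'M[Cplx R]_(p, q)) z :
    'M[Cplx R]_(p, q) := \matrix_(k, l) dzbar i (fun w => F w k l) z.

Definition holomorphic_on U f : Prop :=
  smooth_on U f /\ forall z, U z -> forall i, dzbar i f z = 0.

End Calculus.

Definition adjmx {R : realType} p q (A : 'M[Cplx R]_(p, q)) :
  'M[Cplx R]_(q, p) := map_mx Num.conj A^T.

(* <u, v>: linear in [u], antilinear in [v]. *)
Definition hform {R : realType} n (G : 'M[Cplx R]_n) (u v : Cspace R n) :
  Cplx R := (u *m G *m adjmx v) 0 0.

Record chart (R : realType) (n : nat) (M : topologicalType) := Chart {
  dom : set M;
  coord : M -> Cspace R n;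
  param : Cspace R n -> M;
  dom_open : open dom;
  coord_open : open (coord @` dom);
  coordK : forall x, dom x -> param (coord x) = x;
  coord_cont : forall x, dom x -> {for x, continuous coord};
  param_cont : forall z, (coord @` dom) z -> {for z, continuous param} }.

Record complex_manifold (R : realType) (n : nat) := ComplexManifold {
  carrier :> topologicalType;
  carrier_hausdorff : hausdorff_space carrier;
  carrier_second_countable : @second_countable carrier;
  chart_index : Type;
  atlas : chart_index -> chart R n carrier;
  atlas_cover : forall x, exists a, dom (atlas a) x;
  atlas_holomorphic : forall (a b : chart_index) (i : 'I_n),
    holomorphic_on (coord (atlas a) @` (dom (atlas a) `&` dom (atlas b)))
      (fun z => coord (atlas b) (param (atlas a) z) 0 i) }.

Section Manifold.
Context {R : realType} {n : nat} {M : complex_manifold R n}.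
Implicit Types (a b : chart_index M) (x : M).

Definition domain a : set M := dom (atlas a).
Definition local a (T : Type) (f : M -> T) : Cspace R n -> T :=
  f \o param (atlas a).

(* Entry (k, i) is dw^i / dz^k, for z and w the coordinates of [a] and [b]; the
   rows of components of a (1,0)-vector at [x] satisfy v_b = v_a *m jac a b x. *)
Definition jac a b x : 'M[Cplx R]_n :=
  \matrix_(k, i) dz k (fun z => coord (atlas b) (param (atlas a) z) 0 i)
                      (coord (atlas a) x).

Definition smooth_in_chart a (f : M -> Cplx R) : Prop :=
  smooth_on (coord (atlas a) @` domain a) (local a f).
Definition holomorphic_in_chart a (f : M -> Cplx R) : Prop :=
  holomorphic_on (coord (atlas a) @` domain a) (local a f).

End Manifold.

(* [gram a x k l] is the inner product <d/dz_k, d/dz_l> at [x] in the chart [a]. *)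
Record hermitian_metric (R : realType) (n : nat) (M : complex_manifold R n) :=
  HermitianMetric {
  gram : chart_index M -> M -> 'M[Cplx R]_n;
  gram_hermitian : forall a x, domain a x -> adjmx (gram a x) = gram a x;
  gram_pos : forall a x, domain a x ->
    forall v : Cspace R n, v != 0 -> 0 < hform (gram a x) v v;
  gram_smooth : forall a (k l : 'I_n),
    smooth_in_chart a (fun x => gram a x k l);
  gram_compat : forall a b x, domain a x -> domain b x ->
    gram a x = jac a b x *m gram b x *m adjmx (jac a b x) }.

Section ChernCurvature.
Context {R : realType} {n : nat}.

(* In a chart with Gram matrix function [H], the Chern connection has (0,1)-part
   dbar, so metric compatibility on the holomorphic frame e_j = d/dz_j reads
   d/dz_i <e_j, e_l> = <nabla_(e_i) e_j, e_l>.  With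
   nabla_(e_i) e_j = \sum_k christoffel H i z j k *: e_k  this says that
   christoffel H i z *m H z = dz_mx i H z, which determines the connection. *)
Definition christoffel (H : Cspace R n -> 'M[Cplx R]_n) (i : 'I_n)
    (z : Cspace R n) : 'M[Cplx R]_n := dz_mx i H z *m invmx (H z).

Lemma christoffelP (H : Cspace R n -> 'M[Cplx R]_n) (i : 'I_n)
    (z : Cspace R n) (G : 'M[Cplx R]_n) : H z \in unitmx ->
  (forall j l : 'I_n, dz i (fun w => H w j l) z
     = hform (H z) (row j G) (basis_vec l)) <-> G = christoffel H i z.
Proof.
move=> Hu.
have hE A j l : hform (H z) (row j A) (basis_vec l) = (A *m H z) j l.
  rewrite /hform; have -> : adjmx (basis_vec l) = delta_mx l 0 :> 'cV[Cplx R]_n.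
    by apply/matrixP => k m; rewrite !mxE andbC; case: (_ && _);
      rewrite ?conjC1 ?conjC0.
  by rewrite -colE -row_mul !mxE.
split=> [E|-> j l].
  rewrite /christoffel; have -> : dz_mx i H z = G *m H z.
    by apply/matrixP => j l; rewrite mxE E hE.
  by rewrite mulmxK.
by rewrite hE /christoffel mulmxKV // mxE.
Qed.

Implicit Types (H : Cspace R n -> 'M[Cplx R]_n) (X Y Z W z : Cspace R n)
  (s : Cspace R n -> Cspace R n).

(* (1,0)- and (0,1)-parts of the Chern connection on a local section
   s = \sum_j s_j e_j, along the constant fields X = \sum_i X_i d/dz_i and
   \bar Y = \sum_i conj(Y_i) d/d\bar z_i. *)
Definition nabla10 H X s z : Cspace R n :=
  \sum_(i < n) X 0 i *: (dz_mx i s z + s z *m christoffel H i z).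
Definition nabla01 Y s z : Cspace R n :=
  \sum_(i < n) (Y 0 i)^* *: dzbar_mx i s z.

(* The constant fields X and \bar Y commute, so R_(X,\bar Y) = nabla^2(X, \bar Y)
   is the commutator of covariant derivatives; being tensorial, it is evaluated
   on the constant extension of Z. *)
Definition curvature_endo H X Y Z z : Cspace R n :=
  nabla10 H X (nabla01 Y (fun=> Z)) z - nabla01 Y (nabla10 H X (fun=> Z)) z.

Context {M : complex_manifold R n}.
Variable h : hermitian_metric M.

(* R(X, \bar Y, Z, \bar W) at [x], for vectors of T_x M given by their
   components in the chart [a]. *)
Definition chern_curvature (a : chart_index M) (x : M) X Y Z W : Cplx R :=
  hform (gram h a x)
    (curvature_endo (local a (gram h a)) X Y Z (coord (atlas a) x)) W.

Definition chern_kahler_like : Prop :=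
  forall (a : chart_index M) (x : M), domain a x -> forall X Y Z W : Cspace R n,
    chern_curvature a x X Y Z W = chern_curvature a x Z Y X W.

Definition unitary_basis (a : chart_index M) (x : M) (k : nat)
    (Sigma : {vspace Cspace R n}) (E : k.-tuple (Cspace R n)) : Prop :=
  basis_of Sigma E /\
  forall i j : 'I_k, hform (gram h a x) (tnth E i) (tnth E j) = (i == j)%:R.

Definition ric (a : chart_index M) (x : M) (k : nat) (E : k.-tuple (Cspace R n)) X :
    Cplx R :=
  \sum_(i < k) chern_curvature a x X X (tnth E i) (tnth E i).

(* Ric_k does not depend on the unitary basis of Sigma.  Order on [R[i]]:
   0 < c means that c is real and positive. *)
Definition ric_pos (k : nat) : Prop :=
  forall (a : chart_index M) (x : M), domain a x ->
  forall Sigma : {vspace Cspace R n}, \dim Sigma = k ->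
  forall E : k.-tuple (Cspace R n), unitary_basis a x Sigma E ->
  forall X, X \in Sigma -> X != 0 -> 0 < ric a x E X.

Definition ric_neg (k : nat) : Prop :=
  forall (a : chart_index M) (x : M), domain a x ->
  forall Sigma : {vspace Cspace R n}, \dim Sigma = k ->
  forall E : k.-tuple (Cspace R n), unitary_basis a x Sigma E ->
  forall X, X \in Sigma -> X != 0 -> ric a x E X < 0.

End ChernCurvature.

Section TensorFields.
Context {R : realType} {n : nat} (M : complex_manifold R n).

(* T a x I J is the coefficient of
   d/dz_(I 0) (x) ... (x) d/dz_(I (p-1)) (x) dz_(J 0) (x) ... (x) dz_(J (q-1)). *)
Definition tensor_components (p q : nat) : Type :=
  chart_index M -> M -> {ffun 'I_p -> 'I_n} -> {ffun 'I_q -> 'I_n} -> Cplx R.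
Definition zero_tensor (p q : nat) : tensor_components p q :=
  fun _ _ _ _ => 0.

(* Gamma^p_q(M).  Components in a chart are normalised to 0 outside of its
   domain, so that equality of fields is equality of functions. *)
Definition Gamma (p q : nat) : set (tensor_components p q) :=
  [set T : tensor_components p q | [/\
    forall a (I : {ffun 'I_p -> 'I_n}) (J : {ffun 'I_q -> 'I_n}),
      holomorphic_in_chart a (fun x => T a x I J),
    forall a b x, domain a x -> domain b x ->
      forall (I : {ffun 'I_p -> 'I_n}) (J : {ffun 'I_q -> 'I_n}),
      T b x I J =
        \sum_(K : {ffun 'I_p -> 'I_n}) \sum_(L : {ffun 'I_q -> 'I_n})
          (\prod_(s < p) jac a b x (K s) (I s)) *
          (\prod_(t < q) jac b a x (J t) (L t)) * T a x K L &
    forall a x, ~ domain a x -> T a x = (fun _ _ => 0)]].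

(* Holomorphic q-forms: the alternating elements of Gamma^0_q(M). *)
Definition holomorphic_forms (q : nat) : set (tensor_components 0 q) :=
  [set T : tensor_components 0 q | Gamma T /\
    forall (sigma : {perm 'I_q}) a x (I : {ffun 'I_0 -> 'I_n})
      (J : {ffun 'I_q -> 'I_n}),
    T a x I [ffun t => J (sigma t)] = (-1) ^+ sigma * T a x I J].

End TensorFields.

Arguments zero_tensor {R n} M p q.
Arguments Gamma {R n} M p q.
Arguments holomorphic_forms {R n} M q.

Definition lin_indep {K : fieldType} {V : lmodType K} (d : nat)
    (s : 'I_d -> V) : Prop :=
  forall c : 'I_d -> K, \sum_(i < d) c i *: s i = 0 -> forall i, c i = 0.

(* Dimension, possibly +oo, of a linear subspace: the supremum of the sizes of
   its linearly independent families. *)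
Definition dimension {R : realType} {K : fieldType} {V : lmodType K}
    (S : set V) : \bar R :=
  ereal_sup [set (d%:R)%:E | d in
    [set d : nat | exists s : 'I_d -> V, (forall i, S (s i)) /\ lin_indep s]].

(* h^(q,0)(M) *)
Definition hodge_number {R : realType} {n : nat} (M : complex_manifold R n)
    (q : nat) : \bar R :=
  dimension (K := R[i])
    (V := chart_index M -> M ->
            {ffun 'I_0 -> 'I_n} -> {ffun 'I_q -> 'I_n} -> Cplx R)
    (holomorphic_forms M q).

(* Main.v *)
(* The norm of a tensor field T is replaced by its comass: the maximum, over
   points x, covectors xi_s and vectors w_t at x, of |T(xi, w)|^2 divided by the
   product of the squared norms of all the xi_s and w_t.  At a maximum, the xi_s
   and w_t are extended to holomorphic sections with vanishing covariant
   derivative.  Then T(xi, w) is holomorphic, and applying the Laplacian along a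
   complex line in direction X gives
     0 <= sum_s R(X,X,u_s,u_s)/|u_s|^2 - sum_t R(X,X,w_t,w_t)/|w_t|^2,
   where u_s is the metric dual of xi_s.
   If Ric_k > 0, choose a unitary k-frame E at x minimising
   sum_(i,j) R(E_i,E_i,E_j,E_j) over all unitary k-frames.  The first and second
   variations at E, the symmetries of R and Ric_k > 0 on the span of E show that
   A(Z) = sum_i R(E_i,E_i,Z,Z) is positive for every Z <> 0.  By compactness
   |Z|^2/c < A(Z) < c |Z|^2 for one constant c, and summing the inequality above
   over X = E_i yields q <= c^2 p as soon as T <> 0.  If Ric_k < 0, the same
   applies to -R with the roles of p and q exchanged. *)
Require Import Defs.
From HB Require Import structures.
From mathcomp Require Import all_boot all_order all_algebra all_fingroup.
From mathcomp Require Import complex.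
From mathcomp Require Import all_classical all_reals all_analysis.
From mathcomp Require Import ring lra.

Set Implicit Arguments.
Unset Strict Implicit.
Unset Printing Implicit Defensive.

Import Order.TTheory GRing.Theory Num.Theory numFieldNormedType.Exports.
Local Open Scope classical_set_scope.
Local Open Scope ring_scope.

(** * Complex-valued functions of a real variable *)

(** On the span of the frame, positivity of A is Ric_k > 0 itself; the obstacle is a vector Z
    orthogonal to the span, where for k < n the hypothesis gives no direct control. Tilting E_j
    towards Z, minimality gives, after averaging over Z and iZ, |Z|^2 A(E_j) <= A(Z) +
    R(E_j,E_j,Z,Z). Summed over j this is |Z|^2 sum_j A(E_j) <= (k + 1) A(Z). The first variation
    removes the terms of A that mix the span with its complement. Minimising frames need not vary
    continuously with the point. Only the strict positivity of A is kept, and the frame is continued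
    as a constant in a chart, so that the inequality persists nearby. The comass decouples the
    tensor slots: at the maximum each slot carries one nonzero vector, and each quotient A(u)/|u|^2
    lies between 1/c and c, whatever the other slots contain. The maximum is tested on one complex
    line at a time, so the extended arguments can be taken affine in the chart, with covariant
    derivative zero just at the centre and along that line. *)

Section ComplexDerivative.
Context {R : realType}.
Notation C := (Cplx R).
Implicit Types (f g : R -> C) (t : R) (a b d : C).

(** A relation, so that one statement carries both existence and value; the split into real and
    imaginary parts matches [dir_derivable] and [dir_deriv]. *)
Definition has_cderiv f t d : Prop :=
  is_derive t (1 : R) (fun s => complex.Re (f s)) (complex.Re d) /\
  is_derive t (1 : R) (fun s => complex.Im (f s)) (complex.Im d).

Lemma has_cderiv_eq f t d d' : d = d' -> has_cderiv f t d -> has_cderiv f t d'.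
Proof. by move=> ->. Qed.

Lemma has_cderiv_unique f t d d' :
  has_cderiv f t d -> has_cderiv f t d' -> d = d'.
Proof.
move=> [[_ r1] [_ i1]] [[_ r2] [_ i2]].
by case: d d' r1 i1 r2 i2 => [a b] [a' b'] /= <- <- <- <-.
Qed.

Lemma has_cderiv_near f g t d :
  (\near t, f t = g t) -> has_cderiv f t d -> has_cderiv g t d.
Proof.
move=> e [h1 h2]; split; [apply: near_eq_is_derive h1|apply: near_eq_is_derive h2].
  by near=> x; congr complex.Re; near: x.
by near=> x; congr complex.Im; near: x.
Unshelve. all: by end_near. Qed.

Lemma has_cderiv_ext f g t d : f =1 g -> has_cderiv f t d -> has_cderiv g t d.
Proof. by move=> /funext ->. Qed.

Lemma has_cderiv_cst a t : has_cderiv (fun=> a) t 0.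
Proof. by split; exact: is_derive_cst. Qed.

Lemma has_cderivD f g t a b : has_cderiv f t a -> has_cderiv g t b ->
  has_cderiv (fun s => f s + g s) t (a + b).
Proof.
move=> [h1 h2] [h3 h4]; split.
  rewrite (_ : (fun s => _) = (fun s => complex.Re (f s)) + (fun s => complex.Re (g s))).
    by rewrite raddfD; exact: is_deriveD.
  by apply/funext => s /=; rewrite raddfD.
rewrite (_ : (fun s => _) = (fun s => complex.Im (f s)) + (fun s => complex.Im (g s))).
  by rewrite raddfD; exact: is_deriveD.
by apply/funext => s /=; rewrite raddfD.
Qed.

Lemma has_cderivN f t a : has_cderiv f t a -> has_cderiv (fun s => - f s) t (- a).
Proof.
move=> [h1 h2]; split.
  rewrite (_ : (fun s => _) = - (fun s => complex.Re (f s))).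
    by rewrite raddfN; exact: is_deriveN.
  by apply/funext => s /=; rewrite raddfN.
rewrite (_ : (fun s => _) = - (fun s => complex.Im (f s))).
  by rewrite raddfN; exact: is_deriveN.
by apply/funext => s /=; rewrite raddfN.
Qed.

Lemma has_cderiv_conj f t a : has_cderiv f t a ->
  has_cderiv (fun s => Num.conj (f s)) t (Num.conj a).
Proof.
move=> [h1 h2]; split.
  rewrite (_ : (fun s => _) = (fun s => complex.Re (f s))); last first.
    by apply/funext => s /=; case: (f s).
  by case: a h1 {h2}.
rewrite (_ : (fun s => _) = - (fun s => complex.Im (f s))); last first.
  by apply/funext => s /=; rewrite /GRing.opp/=; case: (f s).
by rewrite (_ : complex.Im _ = - complex.Im a); [exact: is_deriveN|case: a {h1 h2}].
Qed.

Lemma Re_mulc a b : complex.Re (a * b) =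
  complex.Re a * complex.Re b - complex.Im a * complex.Im b.
Proof. by case: a b => [? ?] [? ?]. Qed.

Lemma Im_mulc a b : complex.Im (a * b) =
  complex.Re a * complex.Im b + complex.Im a * complex.Re b.
Proof. by case: a b => [? ?] [? ?]. Qed.

Lemma Re_invc a : complex.Re a^-1 =
  complex.Re a * (complex.Re a ^+ 2 + complex.Im a ^+ 2)^-1.
Proof. by case: a. Qed.

Lemma Im_invc a : complex.Im a^-1 =
  - complex.Im a * (complex.Re a ^+ 2 + complex.Im a ^+ 2)^-1.
Proof. by case: a => x y; rewrite mulNr. Qed.

Lemma has_cderivM f g t a b : has_cderiv f t a -> has_cderiv g t b ->
  has_cderiv (fun s => f s * g s) t (a * g t + f t * b).
Proof.
move=> [h1 h2] [h3 h4]; split.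
  rewrite (_ : (fun s => _) = (fun s => complex.Re (f s)) * (fun s => complex.Re (g s))
     - (fun s => complex.Im (f s)) * (fun s => complex.Im (g s))); last first.
    by apply/funext => s /=; rewrite Re_mulc.
  apply: (is_derive_eq (is_deriveB (is_deriveM h1 h3) (is_deriveM h2 h4))).
  rewrite [RHS]raddfD /= [X in _ = X + _]Re_mulc [X in _ = _ + X]Re_mulc.
  rewrite /GRing.scale /=; move: (complex.Re a) (complex.Re b) (complex.Im a)
    (complex.Im b) (complex.Re (f t)) (complex.Im (f t)) (complex.Re (g t))
    (complex.Im (g t)) => a1 b1 a2 b2 f1 f2 g1 g2.
  by rewrite (mulrC g1) (mulrC g2) !opprD; ring.
rewrite (_ : (fun s => _) = (fun s => complex.Re (f s)) * (fun s => complex.Im (g s))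
     + (fun s => complex.Im (f s)) * (fun s => complex.Re (g s))); last first.
  by apply/funext => s /=; rewrite Im_mulc.
apply: (is_derive_eq (is_deriveD (is_deriveM h1 h4) (is_deriveM h2 h3))).
rewrite [RHS]raddfD /= [X in _ = X + _]Im_mulc [X in _ = _ + X]Im_mulc.
rewrite /GRing.scale /=; move: (complex.Re a) (complex.Re b) (complex.Im a)
  (complex.Im b) (complex.Re (f t)) (complex.Im (f t)) (complex.Re (g t))
  (complex.Im (g t)) => a1 b1 a2 b2 f1 f2 g1 g2.
by ring.
Qed.

Lemma has_cderivZ c f t a : has_cderiv f t a ->
  has_cderiv (fun s => c * f s) t (c * a).
Proof.
move=> h; have := has_cderivM (has_cderiv_cst c t) h.
by apply: has_cderiv_eq; rewrite mul0r add0r.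
Qed.

Lemma has_cderiv_sum (I : Type) (r : seq I) (P : pred I) (F : I -> R -> C)
    (D : I -> C) t :
  (forall i, P i -> has_cderiv (F i) t (D i)) ->
  has_cderiv (fun s => \sum_(i <- r | P i) F i s) t (\sum_(i <- r | P i) D i).
Proof.
move=> h; elim: r => [|i r IH].
  rewrite big_nil; apply: has_cderiv_ext (has_cderiv_cst 0 t) => s.
  by rewrite big_nil.
rewrite big_cons; apply: (@has_cderiv_ext (fun s => if P i then F i s +
   \sum_(j <- r | P j) F j s else \sum_(j <- r | P j) F j s)).
  by move=> s; rewrite big_cons.
by case: ifP => [Pi|//]; apply: has_cderivD => //; apply: h.
Qed.

Lemma has_cderiv_real t : has_cderiv (fun s => (s%:C)%C) t 1.
Proof. by split; [exact: is_derive_id|exact: is_derive_cst]. Qed.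

(** The value stays existential: for matrix inverses it is recovered in [has_mderiv_inv] from a
    product identity. *)
Lemma has_cderiv_inv f t a : f t != 0 -> has_cderiv f t a ->
  exists d, has_cderiv (fun s => (f s)^-1) t d.
Proof.
move=> ft0 [h1 h2].
pose N s := complex.Re (f s) ^+ 2 + complex.Im (f s) ^+ 2.
have NE : N = (fun s => complex.Re (f s)) * (fun s => complex.Re (f s)) +
              (fun s => complex.Im (f s)) * (fun s => complex.Im (f s)).
  by apply/funext => s; rewrite /N !expr2.
have N0 : N t != 0.
  rewrite /N; apply: contra ft0; rewrite paddr_eq0 ?sqr_ge0// !sqrf_eq0.
  by case: (f t) => x y /= /andP[/eqP -> /eqP ->].
have [dN hN] : exists d : R, is_derive t (1 : R) N d.
  by eexists; rewrite NE; apply: is_deriveD.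
have hV := is_deriveV N0 hN.
have dr : exists d : R, is_derive t (1 : R) (fun s => complex.Re (f s)^-1) d.
  eexists; rewrite (_ : (fun s => _) = (fun s => complex.Re (f s)) * (fun s => (N s)^-1)); last first.
    by apply/funext => s /=; rewrite Re_invc.
  exact: is_deriveM.
have di : exists d : R, is_derive t (1 : R) (fun s => complex.Im (f s)^-1) d.
  eexists; rewrite (_ : (fun s => _) = (- (fun s => complex.Im (f s))) * (fun s => (N s)^-1)); last first.
    by apply/funext => s /=; rewrite Im_invc.
  exact: is_deriveM.
by case: dr di => x hx [y hy]; exists (x +i* y)%C; split.
Qed.

Lemma has_cderiv_ex_prod (I : Type) (r : seq I) (P : pred I) (F : I -> R -> C) t :
  (forall i, exists d, has_cderiv (F i) t d) ->
  exists d, has_cderiv (fun s => \prod_(i <- r | P i) F i s) t d.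
Proof.
move=> h; elim: r => [|i r [d IH]].
  exists 0; apply: has_cderiv_ext (has_cderiv_cst 1 t) => s.
  by rewrite big_nil.
have [e he] := h i.
case Pi : (P i).
  eexists; apply: (@has_cderiv_ext (fun s => F i s * \prod_(j <- r | P j) F j s)).
    by move=> s; rewrite big_cons Pi.
  exact: has_cderivM he IH.
by exists d; apply: has_cderiv_ext IH => s; rewrite big_cons Pi.
Qed.

Lemma has_cderiv_affine a b t : has_cderiv (fun s => a + (s%:C)%C * b) t b.
Proof.
have := has_cderivD (has_cderiv_cst a t)
  (has_cderivM (has_cderiv_real t) (has_cderiv_cst b t)).
by apply: has_cderiv_eq; rewrite mul1r mulr0 addr0 add0r.
Qed.

Lemma has_cderiv_shift f t0 t d : has_cderiv f (t0 + t) d ->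
  has_cderiv (fun s => f (t0 + s)) t d.
Proof.
have hs : is_derive t 1 (fun s => t0 + s) (1 : R).
  rewrite (_ : (fun s => _) = shift t0); first exact: is_derive_shift.
  by apply/funext => s; rewrite /= addrC.
move=> [h1 h2]; split.
  by rewrite -[X in is_derive _ _ _ X]mulr1; apply: is_derive1_comp h1 hs.
by rewrite -[X in is_derive _ _ _ X]mulr1; apply: is_derive1_comp h2 hs.
Qed.

End ComplexDerivative.

(** * Entrywise derivatives of matrix-valued functions *)

Section MatrixDerivative.
Context {R : realType}.
Notation C := (Cplx R).

Definition has_mderiv m n (A : R -> 'M[C]_(m, n)) (t : R) (D : 'M[C]_(m, n)) : Prop :=
  forall i j, has_cderiv (fun s => A s i j) t (D i j).

Lemma has_mderiv_eq m n (A : R -> 'M[C]_(m, n)) t D D' :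
  D = D' -> has_mderiv A t D -> has_mderiv A t D'.
Proof. by move=> ->. Qed.

Lemma has_mderiv_unique m n (A : R -> 'M[C]_(m, n)) t D D' :
  has_mderiv A t D -> has_mderiv A t D' -> D = D'.
Proof. by move=> h h'; apply/matrixP => i j; apply: has_cderiv_unique (h i j) (h' i j). Qed.

Lemma has_mderiv_near m n (A B : R -> 'M[C]_(m, n)) t D :
  (\near t, A t = B t) -> has_mderiv A t D -> has_mderiv B t D.
Proof.
move=> e h i j; apply: has_cderiv_near (h i j).
by near=> x; have -> // : A x = B x; near: x.
Unshelve. all: by end_near. Qed.

Lemma has_mderiv_cst m n (A : 'M[C]_(m, n)) t : has_mderiv (fun=> A) t 0.
Proof. by move=> i j; rewrite mxE; exact: has_cderiv_cst. Qed.

Lemma has_mderivD m n (A B : R -> 'M[C]_(m, n)) t D E :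
  has_mderiv A t D -> has_mderiv B t E ->
  has_mderiv (fun s => A s + B s) t (D + E).
Proof.
move=> h k i j; rewrite mxE; apply: has_cderiv_ext (has_cderivD (h i j) (k i j)).
by move=> s; rewrite mxE.
Qed.

Lemma has_mderivN m n (A : R -> 'M[C]_(m, n)) t D :
  has_mderiv A t D -> has_mderiv (fun s => - A s) t (- D).
Proof.
move=> h i j; rewrite mxE; apply: has_cderiv_ext (has_cderivN (h i j)).
by move=> s; rewrite mxE.
Qed.

Lemma has_mderivZ m n c (A : R -> 'M[C]_(m, n)) t D :
  has_mderiv A t D -> has_mderiv (fun s => c *: A s) t (c *: D).
Proof.
move=> h i j; rewrite mxE; apply: has_cderiv_ext (has_cderivZ c (h i j)).
by move=> s; rewrite mxE.
Qed.

Lemma has_mderivM m n p (A : R -> 'M[C]_(m, n)) (B : R -> 'M[C]_(n, p)) t D E :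
  has_mderiv A t D -> has_mderiv B t E ->
  has_mderiv (fun s => A s *m B s) t (D *m B t + A t *m E).
Proof.
move=> h k i j; rewrite !mxE -big_split.
apply: (@has_cderiv_ext _ (fun s => \sum_l A s i l * B s l j)).
  by move=> s; rewrite mxE.
by apply: has_cderiv_sum => l _; exact: has_cderivM.
Qed.

Lemma has_mderiv_adj m n (A : R -> 'M[C]_(m, n)) t D :
  has_mderiv A t D -> has_mderiv (fun s => adjmx (A s)) t (adjmx D).
Proof.
move=> h i j; rewrite !mxE.
by apply: has_cderiv_ext (has_cderiv_conj (h j i)) => s; rewrite !mxE.
Qed.

Lemma has_mderiv_affine m n (A B : 'M[C]_(m, n)) t :
  has_mderiv (fun s => A + (s%:C)%C *: B) t B.
Proof.
by move=> i j; apply: has_cderiv_ext (has_cderiv_affine (A i j) (B i j) t) => s; rewrite !mxE.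
Qed.

Lemma has_cderiv_det n (A : R -> 'M[C]_n) t D : has_mderiv A t D ->
  exists d, has_cderiv (fun s => \det (A s)) t d.
Proof.
move=> h.
have /choice[d hd] (sg : 'S_n) :
    exists d, has_cderiv (fun s => (-1) ^+ sg * \prod_i A s i (sg i)) t d.
  have [d hd] : exists d, has_cderiv (fun s => \prod_i A s i (sg i)) t d.
    by apply: has_cderiv_ex_prod => i; exists (D i (sg i)).
  by eexists; exact: has_cderivZ hd.
by exists (\sum_sg d sg); apply: has_cderiv_sum => sg _.
Qed.

(** Cramer's formula makes every entry of the inverse differentiable; differentiating
    [invmx (A s) *m A s = 1] then determines the value. *)
Lemma has_mderiv_inv n (A : R -> 'M[C]_n) t D :
  (\forall s \near t, A s \in unitmx) -> has_mderiv A t D ->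
  has_mderiv (fun s => invmx (A s)) t (- (invmx (A t) *m D *m invmx (A t))).
Proof.
move=> Au h.
have Aut : A t \in unitmx by exact: nbhs_singleton Au.
have h' i j : exists d, has_cderiv (fun s => invmx (A s) i j) t d.
  have [d hd] := has_cderiv_det h.
  have dt0 : \det (A t) != 0 by rewrite -unitfE -unitmxE.
  have [e he] := has_cderiv_inv dt0 hd.
  have [c hc] : exists d, has_cderiv (fun s => \det (row' j (col' i (A s)))) t d.
    apply: (@has_cderiv_det _ _ _ (row' j (col' i D))) => k l.
    by rewrite !mxE; apply: has_cderiv_ext (h (lift j k) (lift i l)) => s; rewrite !mxE.
  eexists; apply: has_cderiv_near (has_cderivM he (has_cderivZ ((-1) ^+ (j + i)) hc)).
  near=> s.
  have As : A s \in unitmx by near: s.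
  by rewrite /invmx As !mxE.
(* A choice of derivative for each entry assembles the entrywise existence [h'] into one derivative
   matrix. *)
pose f ij := xget 0 [set d | has_cderiv (fun s => invmx (A s) ij.1 ij.2) t d].
have {}h' : has_mderiv (fun s => invmx (A s)) t (\matrix_(i, j) f (i, j)).
  by move=> i j; rewrite mxE /f; case: xgetP => [? _ //|/= nh]; have [d hd] := h' i j; case: (nh d hd).
set E := \matrix_(i, j) f (i, j) in h'.
have e0 : E *m A t + invmx (A t) *m D = 0.
  apply: (has_mderiv_unique (has_mderivM h' h)).
  apply: has_mderiv_near (has_mderiv_cst 1%:M t).
  by near=> s; apply/esym/mulVmx; near: s.
apply: has_mderiv_eq h'.
have /(congr1 (mulmx^~ (invmx (A t)))) := e0.
rewrite mul0mx mulmxDl mulmxK// => /eqP; rewrite addr_eq0 => /eqP ->.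
Unshelve. all: by end_near. Qed.

End MatrixDerivative.

(** * Directional derivatives *)

Section TwoVariables.
Context {R : realType}.
Implicit Types (g : R -> R -> R) (f : R -> R).

Lemma MVT0 (f df : R -> R) (e h : R) :
  (forall x, `|x| < e -> is_derive x (1 : R) f (df x)) -> `|h| < e ->
  exists2 c, `|c| <= `|h| & f h - f 0 = df c * h.
Proof.
move=> hf he.
have cf (x : R) : `|x| < e -> {for x, continuous f}.
  move=> xe; apply: differentiable_continuous; apply/derivable1_diffP.
  by have [] := hf x xe.
have [h0|h0] := leP 0 h.
  have hb x : x \in `[0, h] -> `|x| <= `|h|.
    by rewrite in_itv/= => /andP[x0 xh]; rewrite !ger0_norm.
  have [||c /hb ch E] := @MVT_segment R f df 0 h h0.
  - move=> x /subset_itv_oo_cc /hb xh; apply: hf; exact: le_lt_trans he.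
  - apply: continuous_in_subspaceT => x /set_mem /hb xh.
    by apply: cf; exact: le_lt_trans he.
  by exists c; rewrite // E subr0.
have hb x : x \in `[h, 0] -> `|x| <= `|h|.
  by rewrite in_itv/= => /andP[x0 xh]; rewrite !ler0_norm ?lerN2// ltW.
have [||c /hb ch E] := @MVT_segment R f df h 0 (ltW h0).
- move=> x /subset_itv_oo_cc /hb xh; apply: hf; exact: le_lt_trans he.
- apply: continuous_in_subspaceT => x /set_mem /hb xh.
  by apply: cf; exact: le_lt_trans he.
by exists c; rewrite // -opprB E sub0r mulrN opprK.
Qed.

Definition cont00 g : Prop :=
  forall e : R, 0 < e -> exists2 d : R, 0 < d &
    forall s t, `|s| < d -> `|t| < d -> `|g s t - g 0 0| <= e.

(** The increment [g h h - g h 0] equals [gt h c * h] for some [c] between 0 and [h] by the mean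
    value theorem, and joint continuity of [gt] at the origin gives its limit slope. *)
Lemma diag_derive g gt (e a : R) : 0 < e ->
  (forall s t, `|s| < e -> `|t| < e -> is_derive t (1 : R) (g s) (gt s t)) ->
  cont00 gt -> is_derive 0 (1 : R) (g^~ 0) a ->
  is_derive 0 (1 : R) (fun h => g h h) (a + gt 0 0).
Proof.
move=> e0 hg cg ha.
rewrite (_ : (fun h => g h h) = (g^~ 0) + (fun h => g h h - g h 0)); last first.
  by apply/funext => h /=; rewrite /GRing.add /= addrC subrK.
apply: is_deriveD; apply/is_derive1_caratheodory.
exists (fun h => if h == 0 then gt 0 0 else (g h h - g h 0) / h).
split; last by rewrite eqxx.
  move=> z; case: eqVneq => [->|z0]; first by rewrite !subrr mulr0.
  by rewrite !subrr !subr0 divfK.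
apply/cvgrPdist_le => /= eps eps0; rewrite eqxx.
have [d d0 hd] := cg eps eps0.
exists (Num.min d e) => /=; first by rewrite lt_min d0.
move=> h /=; rewrite sub0r normrN lt_min => /andP[hd1 he1].
case: eqVneq => [_|h0]; first by rewrite subrr normr0 ltW.
have [c ch ->] := MVT0 (fun t ht => hg h t he1 ht) he1.
by rewrite mulfK// distrC; apply: hd => //; exact: le_lt_trans hd1.
Qed.

(** Two applications of the mean value theorem, first in [s] and then in [t], turn the second
    difference over the square of side [h] into [gst c c' * h ^+ 2] with [c] and [c'] small. *)
Lemma second_difference g gs gst (e eps : R) : 0 < e ->
  (forall s t, `|s| < e -> `|t| < e -> is_derive s (1 : R) (g^~ t) (gs s t)) ->
  (forall s t, `|s| < e -> `|t| < e -> is_derive t (1 : R) (gs s) (gst s t)) ->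
  cont00 gst -> 0 < eps -> exists2 d : R, 0 < d & forall h, 0 < h < d ->
  `|g h h - g h 0 - g 0 h + g 0 0 - gst 0 0 * h ^+ 2| <= eps * h ^+ 2.
Proof.
move=> e0 hs hst cg eps0; have [d d0 hd] := cg eps eps0.
exists (Num.min d e) => [|h]; first by rewrite lt_min d0.
move=> /andP[h0]; rewrite lt_min => /andP[hd1 he1].
have hn : `|h| = h by rewrite gtr0_norm.
have hne : `|h| < e by rewrite hn.
have [|c ch E1] := @MVT0 (fun s => g s h - g s 0) (fun s => gs s h - gs s 0) e h _ hne.
  move=> x xe; apply: is_deriveB; apply: hs => //.
  by rewrite normr0.
have ce : `|c| < e by exact: le_lt_trans hne.
have [c' ch' E2] := MVT0 (fun t ht => hst c t ce ht) hne.
have -> : g h h - g h 0 - g 0 h + g 0 0 = gst c c' * h ^+ 2.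
  rewrite expr2 mulrA -E2 -E1; ring.
rewrite -mulrBl normrM [`|h ^+ 2|]ger0_norm ?sqr_ge0// ler_wpM2r ?sqr_ge0//.
by apply: hd; apply: le_lt_trans; [exact: ch| rewrite hn|exact: ch'|rewrite hn].
Qed.

(** The second difference is symmetric in the two variables, so both mixed derivatives approximate
    the same number, each within [eps / 2] after division by [h ^+ 2]. *)
Lemma schwarz g gs gt gst gts (e : R) : 0 < e ->
  (forall s t, `|s| < e -> `|t| < e -> is_derive s (1 : R) (g^~ t) (gs s t)) ->
  (forall s t, `|s| < e -> `|t| < e -> is_derive t (1 : R) (gs s) (gst s t)) ->
  (forall s t, `|s| < e -> `|t| < e -> is_derive t (1 : R) (g s) (gt s t)) ->
  (forall s t, `|s| < e -> `|t| < e -> is_derive s (1 : R) (gt^~ t) (gts s t)) ->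
  cont00 gst -> cont00 gts -> gst 0 0 = gts 0 0.
Proof.
move=> e0 hs hst ht hts c1 c2; apply/eqP; rewrite -subr_eq0 -normr_le0.
apply/ler_addgt0Pl => eps eps0; rewrite addr0.
have e20 : 0 < eps / 2 by rewrite divr_gt0.
have [d d0 hd] := second_difference e0 hs hst c1 e20.
have [|||d' d'0 hd'] := @second_difference (fun t s => g s t) (fun t s => gt s t)
  (fun t s => gts s t) e (eps / 2) e0 _ _ _ e20.
- by move=> s t se te; exact: ht.
- by move=> s t se te; exact: hts.
- by move=> x x0; have [y y0 hy] := c2 x x0; exists y => // s t sy ty; exact: hy.
pose h := Num.min d d' / 2.
have m0 : 0 < Num.min d d' by rewrite lt_min d0.
have h0 : 0 < h by rewrite divr_gt0.
have hm : h < Num.min d d' by rewrite ltr_pdivrMr// ltr_pMr// ltr1n.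
have /hd k1 : 0 < h < d by rewrite h0 (lt_le_trans hm)// ge_min lexx.
have /hd' k2 : 0 < h < d' by rewrite h0 (lt_le_trans hm)// ge_min lexx orbT.
have h20 : 0 < h ^+ 2 by rewrite exprn_gt0.
rewrite -(ler_pM2r h20) -[X in _ * X <= _](gtr0_norm h20) -normrM.
have := le_trans (ler_normB _ _) (lerD k2 k1).
rewrite -mulrDl -splitr; congr (`| _ | <= _); ring.
Qed.

End TwoVariables.

(** * Real linearity in the direction, symmetry, and contraction with [dz] and [dzbar] *)

Section DirectionalDerivative.
Context {R : realType} {n : nat}.
Notation C := (Cplx R).
Notation V := (Cspace R n).
Implicit Types (f : V -> C) (u v z : V) (U : set V) (s t : R).

Lemma has_cderiv_dir f v z : dir_derivable f v z ->
  has_cderiv (fun t => f (z + (t%:C)%C *: v)) 0 (dir_deriv f v z).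
Proof.
by move=> [h1 h2]; split; rewrite /= derive1E; exact/derivableP.
Qed.

Lemma dir_derivE f v z d : has_cderiv (fun t => f (z + (t%:C)%C *: v)) 0 d ->
  dir_deriv f v z = d.
Proof.
move=> [[_ h1] [_ h2]]; rewrite /dir_deriv !derive1E.
by case: d h1 h2 => a b /= <- <-.
Qed.

Lemma has_cderiv_line f v z t : dir_derivable f v (z + (t%:C)%C *: v) ->
  has_cderiv (fun s => f (z + (s%:C)%C *: v)) t (dir_deriv f v (z + (t%:C)%C *: v)).
Proof.
move=> /has_cderiv_dir h.
have h' := h; rewrite -(addNr t) in h'.
apply: has_cderiv_ext (has_cderiv_shift h') => s.
by rewrite -addrA -scalerDl -rmorphD /= addrA addrN add0r.
Qed.

Lemma smooth_continuous U f z : smooth_on U f -> U z -> {for z, continuous f}.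
Proof. by move=> /(_ 0%N)[h _]; exact: h. Qed.

Lemma smooth_derivable U f v z : smooth_on U f -> U z -> dir_derivable f v z.
Proof. by move=> /(_ 1%N)[_ /(_ v)[h _]]; exact: h. Qed.

Lemma smooth_dir_deriv U f v : smooth_on U f -> smooth_on U (dir_deriv f v).
Proof. by move=> sf m; have [_ /(_ v)[]] := sf m.+1. Qed.

Lemma real_complex_continuous : continuous (fun t => (t%:C)%C : C).
Proof.
move=> t; apply/cvgrPdist_lt => /= e e0.
have e1 : 0 < complex.Re e by move: e0; rewrite ltcE => /andP[].
have eE : e = ((complex.Re e)%:C)%C by rewrite RRe_real// gtr0_real.
near=> s; rewrite -rmorphB /= normc_def /= expr0n /= addr0 sqrtr_sqr eE ltcR.
by near: s; exact: (cvgr_dist_lt id).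
Unshelve. all: by end_near. Qed.

Lemma plane_continuous z u v :
  continuous (fun p : R * R => z + (p.1%:C)%C *: u + (p.2%:C)%C *: v : V).
Proof.
move=> p; apply: cvgD; first apply: cvgD.
- exact: cvg_cst.
- apply: cvgZr_tmp; apply: (@cvg_comp _ _ _ (fst) (fun t : R => (t%:C)%C : C)).
    exact: cvg_fst.
  exact: real_complex_continuous.
apply: cvgZr_tmp; apply: (@cvg_comp _ _ _ (snd) (fun t : R => (t%:C)%C : C)).
  exact: cvg_snd.
exact: real_complex_continuous.
Qed.

Lemma near_plane z u v (P : set V) : nbhs z P -> exists2 e : R, 0 < e &
  forall s t, `|s| < e -> `|t| < e -> P (z + (s%:C)%C *: u + (t%:C)%C *: v).
Proof.
move=> Pz; have := @plane_continuous z u v (0, 0) P.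
rewrite /= !scale0r !addr0 => /(_ Pz) /= [[A B] /= [[a a0 hA] [b b0 hB]] hAB].
exists (Num.min a b) => /=; first by rewrite lt_min a0.
move=> s t; rewrite !lt_min => /andP[sa _] /andP[_ tb].
apply: (hAB (s, t)); split => /=; [apply: hA|apply: hB] => /=;
  by rewrite distrC subr0.
Qed.

Lemma normr_ReIm_le (c : C) (e : R) : `|c| < (e%:C)%C ->
  `|complex.Re c| <= e /\ `|complex.Im c| <= e.
Proof.
move=> ce; have e0 : 0 <= e.
  by rewrite -ler0c; apply: le_trans (normr_ge0 c) (ltW ce).
have h x y : `|x| <= Num.sqrt (x ^+ 2 + y ^+ 2 : R).
  by rewrite -sqrtr_sqr ler_wsqrtr// lerDl sqr_ge0.
move: ce; rewrite normc_def ltcR => /ltW ce; split.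
  exact: le_trans (h _ _) ce.
by apply: le_trans ce; rewrite addrC; exact: h.
Qed.

Lemma cont00_ReIm f z u v : {for z, continuous f} ->
  cont00 (fun s t => complex.Re (f (z + (s%:C)%C *: u + (t%:C)%C *: v))) /\
  cont00 (fun s t => complex.Im (f (z + (s%:C)%C *: u + (t%:C)%C *: v))).
Proof.
move=> cf; split=> e e0.
all: have ec : (0 : R[i]) < (e%:C)%C by rewrite ltcR.
all: have /cvgrPdist_lt /(_ _ ec) /(near_plane u v) [d d0 hd] := cf.
all: exists d => // s t sd td; rewrite !scale0r !addr0 distrC -raddfB.
all: by have [] := normr_ReIm_le (hd s t sd td).
Qed.

Section SmoothFunctions.
Variables (U : set V) (f : V -> C).
Hypotheses (oU : open U) (sf : smooth_on U f).

Lemma smooth_near_plane z u v : U z -> exists2 e : R, 0 < e &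
  forall s t, `|s| < e -> `|t| < e -> U (z + (s%:C)%C *: u + (t%:C)%C *: v).
Proof. by move=> Uz; apply: near_plane; exact: open_nbhs_nbhs. Qed.

(** Directional derivatives alone need not be additive in the direction. Here [diag_derive] applies
    to [f (z + s u + t v)], because the derivative along [v] is continuous at [z]. *)
Lemma dir_derivD u v z : U z ->
  dir_deriv f (u + v) z = dir_deriv f u z + dir_deriv f v z.
Proof.
move=> Uz; have [e e0 he] := smooth_near_plane u v Uz.
have hu : has_cderiv (fun s => f (z + (s%:C)%C *: u)) 0 (dir_deriv f u z).
  by apply: has_cderiv_dir; apply: smooth_derivable sf Uz.
have hv s t : `|s| < e -> `|t| < e ->
    has_cderiv (fun t => f (z + (s%:C)%C *: u + (t%:C)%C *: v)) t
      (dir_deriv f v (z + (s%:C)%C *: u + (t%:C)%C *: v)).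
  move=> se te; apply: has_cderiv_line; apply: smooth_derivable sf _; exact: he.
have [c1 c2] := cont00_ReIm u v (smooth_continuous (smooth_dir_deriv v sf) Uz).
have E (g : C -> R) : (fun h => g (f (z + (h%:C)%C *: (u + v)))) =
    (fun h => g (f (z + (h%:C)%C *: u + (h%:C)%C *: v))).
  by apply/funext => h; rewrite scalerDr addrA.
apply: dir_derivE; split; rewrite E raddfD.
- have := diag_derive e0 (fun s t hs ht => proj1 (hv s t hs ht)) c1.
  rewrite !scale0r !addr0; apply.
  rewrite (_ : (fun s => _) = (fun s => complex.Re (f (z + (s%:C)%C *: u)))); last first.
    by apply/funext => s; rewrite addr0.
  exact: hu.1.
- have := diag_derive e0 (fun s t hs ht => proj2 (hv s t hs ht)) c2.
  rewrite !scale0r !addr0; apply.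
  rewrite (_ : (fun s => _) = (fun s => complex.Im (f (z + (s%:C)%C *: u)))); last first.
    by apply/funext => s; rewrite addr0.
  exact: hu.2.
Qed.

(** Real scalars only: homogeneity under ['i] is the Cauchy-Riemann equation, which appears in
    [hol2_line] for holomorphic functions. *)
Lemma dir_derivZ r v z : U z ->
  dir_deriv f ((r%:C)%C *: v) z = (r%:C)%C * dir_deriv f v z.
Proof.
move=> Uz; have h : dir_derivable f v z by exact: smooth_derivable sf Uz.
have {h}[h1 h2] := has_cderiv_dir h.
have hr : is_derive 0 (1 : R) (fun s => r * s) r.
  rewrite (_ : (fun s => _) = r *: id); last by apply/funext => s.
  by rewrite -[X in is_derive _ _ _ X](mulr1 r); apply: is_deriveZ.
have E (g : C -> R) : (fun h => g (f (z + (h%:C)%C *: ((r%:C)%C *: v)))) =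
    (fun h => g (f (z + (h%:C)%C *: v))) \o (fun s => r * s).
  by apply/funext => h /=; rewrite scalerA -rmorphM mulrC.
apply: dir_derivE; split; rewrite E mulrC.
  rewrite (_ : complex.Re _ = complex.Re (dir_deriv f v z) * r); last first.
    by rewrite Re_mulc /= mulr0 subr0.
  by apply: is_derive1_comp hr; rewrite mulr0.
rewrite (_ : complex.Im _ = complex.Im (dir_deriv f v z) * r); last first.
  by rewrite Im_mulc /= mulr0 add0r.
by apply: is_derive1_comp hr; rewrite mulr0.
Qed.

Lemma dir_deriv_comm u v z : U z ->
  dir_deriv (dir_deriv f u) v z = dir_deriv (dir_deriv f v) u z.
Proof.
move=> Uz; have [e e0 he] := smooth_near_plane u v Uz.
have hl g w : smooth_on U g -> forall s t, `|s| < e -> `|t| < e ->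
    has_cderiv (fun r => g (z + (s%:C)%C *: u + (t%:C)%C *: v + (r%:C)%C *: w)) 0
      (dir_deriv g w (z + (s%:C)%C *: u + (t%:C)%C *: v)).
  by move=> sg s t se te; apply: has_cderiv_dir; apply: smooth_derivable sg _; exact: he.
have ht g : smooth_on U g -> forall s t, `|s| < e -> `|t| < e ->
    has_cderiv (fun t => g (z + (s%:C)%C *: u + (t%:C)%C *: v)) t
      (dir_deriv g v (z + (s%:C)%C *: u + (t%:C)%C *: v)).
  move=> sg s t se te; apply: has_cderiv_line; apply: smooth_derivable sg _; exact: he.
have hs g : smooth_on U g -> forall s t, `|s| < e -> `|t| < e ->
    has_cderiv (fun s => g (z + (s%:C)%C *: u + (t%:C)%C *: v)) s
      (dir_deriv g u (z + (s%:C)%C *: u + (t%:C)%C *: v)).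
  move=> sg s t se te; rewrite addrAC.
  apply: (@has_cderiv_ext _ (fun s => g (z + (t%:C)%C *: v + (s%:C)%C *: u))).
    by move=> r; rewrite addrAC.
  apply: has_cderiv_line; apply: smooth_derivable sg _; rewrite addrAC; exact: he.
have su := smooth_dir_deriv u sf; have sv := smooth_dir_deriv v sf.
have [a1 a2] := cont00_ReIm u v (smooth_continuous (smooth_dir_deriv v su) Uz).
have [b1 b2] := cont00_ReIm u v (smooth_continuous (smooth_dir_deriv u sv) Uz).
have E1 := schwarz e0 (fun s t a b => proj1 (hs _ sf s t a b))
  (fun s t a b => proj1 (ht _ su s t a b)) (fun s t a b => proj1 (ht _ sf s t a b))
  (fun s t a b => proj1 (hs _ sv s t a b)) a1 b1.
have E2 := schwarz e0 (fun s t a b => proj2 (hs _ sf s t a b))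
  (fun s t a b => proj2 (ht _ su s t a b)) (fun s t a b => proj2 (ht _ sf s t a b))
  (fun s t a b => proj2 (hs _ sv s t a b)) a2 b2.
by move: E1 E2; rewrite !scale0r !addr0;
  case: (dir_deriv _ v z) => a b; case: (dir_deriv _ u z) => c d /= -> ->.
Qed.

Lemma dir_deriv_sum (I : Type) (r : seq I) (F : I -> V) z : U z ->
  dir_deriv f (\sum_(i <- r) F i) z = \sum_(i <- r) dir_deriv f (F i) z.
Proof.
move=> Uz; elim: r => [|i r IH]; last by rewrite !big_cons dir_derivD// IH.
by rewrite !big_nil -(scale0r 0) dir_derivZ// mul0r.
Qed.

Lemma dir_deriv_coord v z : U z -> dir_deriv f v z =
  \sum_i (((complex.Re (v 0 i))%:C)%C * dir_deriv f (basis_vec i) z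
    + ((complex.Im (v 0 i))%:C)%C * dir_deriv f ('i%C *: basis_vec i) z).
Proof.
move=> Uz; rewrite {1}(row_sum_delta v) dir_deriv_sum//.
apply: eq_bigr => i _; rewrite {1}(complexE (v 0 i)) scalerDl dir_derivD//.
by rewrite mulrC -scalerA !dir_derivZ.
Qed.

(** Since the real derivative D_v is real linear in v, the combination (D_v - i D_(iv))/2 is complex
    linear. Both sides are compared after expansion along [e_i] and ['i *: e_i]. *)
Lemma sum_dz v z : U z -> \sum_i v 0 i * dz i f z =
  2^-1 * (dir_deriv f v z - 'i%C * dir_deriv f ('i%C *: v) z).
Proof.
move=> Uz; rewrite !(dir_deriv_coord _ Uz) mulr_sumr -sumrB mulr_sumr.
apply: eq_bigr => i _; rewrite /dz mxE.
rewrite [in LHS](complexE (v 0 i)) [_ * v 0 i]mulrC ReiNIm ImiRe.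
rewrite (rmorphN (real_complex R)) /=.
move: ((complex.Re (v 0 i))%:C)%C ((complex.Im (v 0 i))%:C)%C => x y.
move: (dir_deriv f (basis_vec i) z) (dir_deriv f ('i%C *: basis_vec i) z) => D E.
have := sqr_i R; rewrite expr2.
(* ['i%C] becomes a variable known only by its square, which leaves a polynomial identity. *)
move: ('i%C) => i2 ii.
rewrite mulrCA; congr (_ * _).
transitivity (x * D - i2 * x * E + i2 * y * D - (i2 * i2) * y * E); first ring.
rewrite ii; ring.
Qed.

Lemma sum_dzbar v z : U z -> \sum_i Num.conj (v 0 i) * dzbar i f z =
  2^-1 * (dir_deriv f v z + 'i%C * dir_deriv f ('i%C *: v) z).
Proof.
move=> Uz; rewrite !(dir_deriv_coord _ Uz) mulr_sumr -big_split mulr_sumr.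
apply: eq_bigr => i _; rewrite /dzbar mxE.
have -> : Num.conj (v 0 i) = (complex.Re (v 0 i))%:C%C - 'i%C * (complex.Im (v 0 i))%:C%C.
  by case: (v 0 i) => a b; rewrite /=; simpc.
rewrite [_ * v 0 i]mulrC ReiNIm ImiRe.
rewrite (rmorphN (real_complex R)) /=.
move: ((complex.Re (v 0 i))%:C)%C ((complex.Im (v 0 i))%:C)%C => x y.
move: (dir_deriv f (basis_vec i) z) (dir_deriv f ('i%C *: basis_vec i) z) => D E.
have := sqr_i R; rewrite expr2.
move: ('i%C) => i2 ii.
rewrite mulrCA; congr (_ * _).
transitivity (x * D + i2 * x * E - i2 * y * D - (i2 * i2) * y * E); first ring.
rewrite ii; ring.
Qed.

End SmoothFunctions.

End DirectionalDerivative.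

(** * Second-order jets *)

Section Jets.
Context {R : realType}.
Notation C := (Cplx R).

(** The first derivative is required on a whole neighbourhood, where the second-derivative test
    applies the mean value theorem. *)
Definition jet2 (f : R -> C) (a b c : C) : Prop :=
  f 0 = a /\ exists f' : R -> C,
    [/\ \forall s \near 0, has_cderiv f s (f' s), f' 0 = b & has_cderiv f' 0 c].

Definition mjet2 m n (A : R -> 'M[C]_(m, n)) (A0 A1 A2 : 'M[C]_(m, n)) : Prop :=
  A 0 = A0 /\ exists A' : R -> 'M[C]_(m, n),
    [/\ \forall s \near 0, has_mderiv A s (A' s), A' 0 = A1 & has_mderiv A' 0 A2].

Lemma jet2_eq f a b c a' b' c' : a = a' -> b = b' -> c = c' ->
  jet2 f a b c -> jet2 f a' b' c'.
Proof. by move=> -> -> ->. Qed.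

Lemma jet2_ext f g a b c : f =1 g -> jet2 f a b c -> jet2 g a b c.
Proof. by move=> /funext ->. Qed.

Lemma jet2_cst a : jet2 (fun=> a) a 0 0.
Proof.
split=> //; exists (fun=> 0); split=> //; last exact: has_cderiv_cst.
by near=> s; exact: has_cderiv_cst.
Unshelve. all: by end_near. Qed.

Lemma jet2_affine a b : jet2 (fun s => a + (s%:C)%C * b) a b 0.
Proof.
split; first by rewrite mul0r addr0.
exists (fun=> b); split=> //; last exact: has_cderiv_cst.
by near=> s; exact: has_cderiv_affine.
Unshelve. all: by end_near. Qed.

Lemma jet2D f g a b c a' b' c' : jet2 f a b c -> jet2 g a' b' c' ->
  jet2 (fun s => f s + g s) (a + a') (b + b') (c + c').
Proof.
move=> [<- [f' [h1 <- h2]]] [<- [g' [k1 <- k2]]]; split=> //.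
exists (fun s => f' s + g' s); split=> //; last exact: has_cderivD.
by near=> s; apply: has_cderivD; near: s.
Unshelve. all: by end_near. Qed.

Lemma jet2N f a b c : jet2 f a b c -> jet2 (fun s => - f s) (- a) (- b) (- c).
Proof.
move=> [<- [f' [h1 <- h2]]]; split=> //.
exists (fun s => - f' s); split=> //; last exact: has_cderivN.
by near=> s; apply: has_cderivN; near: s.
Unshelve. all: by end_near. Qed.

Lemma jet2_conj f a b c : jet2 f a b c ->
  jet2 (fun s => Num.conj (f s)) (Num.conj a) (Num.conj b) (Num.conj c).
Proof.
move=> [<- [f' [h1 <- h2]]]; split=> //.
exists (fun s => Num.conj (f' s)); split=> //; last exact: has_cderiv_conj.
by near=> s; apply: has_cderiv_conj; near: s.
Unshelve. all: by end_near. Qed.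

Lemma jet2M f g a b c a' b' c' : jet2 f a b c -> jet2 g a' b' c' ->
  jet2 (fun s => f s * g s) (a * a') (b * a' + a * b')
    (c * a' + 2%:R * (b * b') + a * c').
Proof.
move=> [<- [f' [h1 <- h2]]] [<- [g' [k1 <- k2]]]; split=> //.
exists (fun s => f' s * g s + f s * g' s); split=> //.
  by near=> s; apply: has_cderivM; near: s.
have h0 := nbhs_singleton h1; have k0 := nbhs_singleton k1.
apply: has_cderiv_eq (has_cderivD (has_cderivM h2 k0) (has_cderivM h0 k2)).
by rewrite mulr_natl mulr2n !addrA.
Unshelve. all: by end_near. Qed.

Lemma jet2Z c f a0 a1 a2 : jet2 f a0 a1 a2 ->
  jet2 (fun s => c * f s) (c * a0) (c * a1) (c * a2).
Proof.
move=> /(jet2M (jet2_cst c)); apply: jet2_eq => //.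
  by rewrite mul0r add0r.
by rewrite !mul0r mulr0 !add0r.
Qed.

(** With all first derivatives zero, the cross terms of the product rule vanish and the second
    derivatives add up, as for a logarithm. *)
Lemma jet2_prod_crit (I : Type) (r : seq I) (F : I -> R -> C) (c : I -> C) :
  (forall i, jet2 (F i) 1 0 (c i)) ->
  jet2 (fun s => \prod_(i <- r) F i s) 1 0 (\sum_(i <- r) c i).
Proof.
move=> h; elim: r => [|i r IH].
  rewrite big_nil; apply: jet2_ext (jet2_cst 1) => s.
  by rewrite big_nil.
apply: (@jet2_ext (fun s => F i s * \prod_(j <- r) F j s)).
  by move=> s; rewrite big_cons.
apply: jet2_eq (jet2M (h i) IH); rewrite ?big_cons ?mulr1 ?mul1r ?mul0r ?mulr0 ?addr0//.
Qed.

(** The real part has an interior minimum at 0, so its derivative there is 0. If [Re c] were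
    negative, the derivative would be negative just to the right of 0, and so would the function by
    the mean value theorem. *)
Lemma jet2_second_derivative_test f a b c : complex.Re a = 0 -> jet2 f a b c ->
  (\forall s \near (0 : R), 0 <= complex.Re (f s)) -> 0 <= complex.Re c.
Proof.
move=> a0 [fa [f' [h1 _ h2]]] fpos.
have [e e0 he] : exists2 e : R, 0 < e & forall s, `|s| < e ->
    is_derive s (1 : R) (fun s => complex.Re (f s)) (complex.Re (f' s)) /\
    0 <= complex.Re (f s).
  have [e e0 he] := filterI h1 fpos.
  exists e => // s se; have [|[hs _] ps] := he s; last by split.
  by rewrite /= sub0r normrN.
have f00 : complex.Re (f 0) = 0 by rewrite fa.
have f'0 : complex.Re (f' 0) = 0.
  have [_ d1] := proj1 (he 0 ltac:(by rewrite normr0)).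
  have [||||_ d2] := @derive1_at_min R (fun s => complex.Re (f s)) (- e) e 0.
  - by rewrite ge0_cp// ltW.
  - move=> t; rewrite in_itv/= -ltr_norml => te; by have [[]] := he t te.
  - by rewrite in_itv/= e0 oppr_lt0 e0.
  - move=> t; rewrite in_itv/= -ltr_norml => te; by rewrite f00; have [] := he t te.
  - exact: etrans (esym d1) d2.
(* [q] is the slope of [Re f'] between 0 and a point, extended by [Re c] at 0; being continuous
   there, it inherits the sign of [Re c] nearby. *)
have /is_derive1_caratheodory[q [hq cq q0]] := h2.1.
rewrite leNgt; apply/negP => c0.
have : \forall s \near (0 : R), q s < 0.
  by apply: (cvgr_lt (q 0) cq); rewrite q0.
move=> [d d0 hd].
pose h := Num.min d e / 2.
have m0 : 0 < Num.min d e by rewrite lt_min d0.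
have h0 : 0 < h by rewrite divr_gt0.
have : h < Num.min d e by rewrite ltr_pdivrMr// ltr_pMr// ltr1n.
rewrite lt_min => /andP[hd' he'].
have [||x] := @MVT R (fun s => complex.Re (f s)) (fun s => complex.Re (f' s)) 0 h h0.
- move=> x; rewrite in_itv/= => /andP[x0 xh].
  by apply: (proj1 (he x _)); rewrite gtr0_norm// (lt_trans xh).
- apply: continuous_in_subspaceT => x /set_mem; rewrite /= in_itv/= => /andP[x0 xh].
  apply: differentiable_continuous; apply/derivable1_diffP.
  by have [[]] := he x ltac:(by rewrite ger0_norm// (le_lt_trans xh)).
rewrite in_itv/= => /andP[x0 xh]; rewrite f00 !subr0.
have := hq x; rewrite f'0 !subr0 => ->.
have [_ fh] := he h ltac:(by rewrite gtr0_norm).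
move=> E; move: fh; rewrite E leNgt => /negP; apply.
rewrite -mulrA nmulr_rlt0 ?mulr_gt0//.
by apply: hd; rewrite /= sub0r normrN gtr0_norm// (lt_trans xh).
Qed.

Section MatrixJets.
Variables (m n p : nat).

Lemma mjet2_entry (A : R -> 'M[C]_(m, n)) A0 A1 A2 i j : mjet2 A A0 A1 A2 ->
  jet2 (fun s => A s i j) (A0 i j) (A1 i j) (A2 i j).
Proof.
move=> [<- [A' [h1 <- h2]]]; split=> //.
exists (fun s => A' s i j); split=> //.
by apply: filterS h1 => s; apply.
Qed.

Lemma mjet2_affine (A B : 'M[C]_(m, n)) : mjet2 (fun s => A + (s%:C)%C *: B) A B 0.
Proof.
split; first by rewrite scale0r addr0.
exists (fun=> B); split=> //; last exact: has_mderiv_cst.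
by near=> s; exact: has_mderiv_affine.
Unshelve. all: by end_near. Qed.

Lemma mjet2_adj (A : R -> 'M[C]_(m, n)) A0 A1 A2 : mjet2 A A0 A1 A2 ->
  mjet2 (fun s => adjmx (A s)) (adjmx A0) (adjmx A1) (adjmx A2).
Proof.
move=> [<- [A' [h1 <- h2]]]; split=> //.
exists (fun s => adjmx (A' s)); split=> //; last exact: has_mderiv_adj.
by near=> s; apply: has_mderiv_adj; near: s.
Unshelve. all: by end_near. Qed.

Lemma mjet2M (A : R -> 'M[C]_(m, n)) (B : R -> 'M[C]_(n, p)) A0 A1 A2 B0 B1 B2 :
  mjet2 A A0 A1 A2 -> mjet2 B B0 B1 B2 ->
  mjet2 (fun s => A s *m B s) (A0 *m B0) (A1 *m B0 + A0 *m B1)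
    (A2 *m B0 + (A1 *m B1) *+ 2 + A0 *m B2).
Proof.
move=> [<- [A' [h1 <- h2]]] [<- [B' [k1 <- k2]]]; split=> //.
exists (fun s => A' s *m B s + A s *m B' s); split=> //.
  by near=> s; apply: has_mderivM; near: s.
have h0 := nbhs_singleton h1; have k0 := nbhs_singleton k1.
apply: has_mderiv_eq (has_mderivD (has_mderivM h2 k0) (has_mderivM h0 k2)).
by rewrite mulr2n !addrA.
Unshelve. all: by end_near. Qed.

End MatrixJets.

Lemma mjet2_inv n (A : R -> 'M[C]_n) A0 A1 A2 :
  (\forall s \near 0, A s \in unitmx) -> mjet2 A A0 A1 A2 ->
  let K := invmx A0 in
  mjet2 (fun s => invmx (A s)) K (- (K *m A1 *m K))
    ((K *m A1 *m K *m A1 *m K) *+ 2 - K *m A2 *m K).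
Proof.
move=> Au [<- [A' [h1 <- h2]]] K; split=> //.
exists (fun s => - (invmx (A s) *m A' s *m invmx (A s))); split=> //.
  (* Differentiating the inverse at a nearby [s] asks for invertibility on a neighbourhood of [s],
     not just at [s]. *)
  have Au' := near_join Au.
  by near=> s; apply: has_mderiv_inv; near: s.
have k0 := has_mderiv_inv Au (nbhs_singleton h1).
apply: has_mderiv_eq (has_mderivN (has_mderivM (has_mderivM k0 h2) k0)).
rewrite -/K !mulNmx !mulmxN !mulmxDl !mulNmx !opprD !opprK mulr2n !mulmxA.
by rewrite addrAC.
Unshelve. all: by end_near. Qed.

End Jets.

(** * Chern curvature in a chart *)

Section Adjoint.
Context {R : realType}.
Notation C := (Cplx R).

Lemma adjmxD m n (A B : 'M[C]_(m, n)) : adjmx (A + B) = adjmx A + adjmx B.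
Proof. by apply/matrixP => i j; rewrite !mxE rmorphD. Qed.

Lemma adjmxN m n (A : 'M[C]_(m, n)) : adjmx (- A) = - adjmx A.
Proof. by apply/matrixP => i j; rewrite !mxE rmorphN. Qed.

Lemma adjmxB m n (A B : 'M[C]_(m, n)) : adjmx (A - B) = adjmx A - adjmx B.
Proof. by rewrite adjmxD adjmxN. Qed.

Lemma adjmxZ m n (c : R[i]) (A : 'M[C]_(m, n)) :
  adjmx (c *: A) = Num.conj c *: adjmx A.
Proof. by apply/matrixP => i j; rewrite !mxE rmorphM. Qed.

Lemma adjmxK m n (A : 'M[C]_(m, n)) : adjmx (adjmx A) = A.
Proof. by apply/matrixP => i j; rewrite !mxE conjCK. Qed.

Lemma adjmxM m n p (A : 'M[C]_(m, n)) (B : 'M[C]_(n, p)) :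
  adjmx (A *m B) = adjmx B *m adjmx A.
Proof. by rewrite /adjmx trmx_mul map_mxM. Qed.

Lemma adjmx_inv n (A : 'M[C]_n) : A \in unitmx -> adjmx A = A ->
  adjmx (invmx A) = invmx A.
Proof.
move=> Au hA; have : adjmx (invmx A) *m A = 1%:M.
  rewrite -{2}hA -adjmxM mulmxV// /adjmx trmx1.
  by apply/matrixP => i j; rewrite !mxE; case: (i == j); rewrite ?conjC0 ?conjC1.
by move=> /(congr1 (mulmx^~ (invmx A))); rewrite mulmxK// mul1mx.
Qed.

Lemma conj_i : Num.conj ('i%C : R[i]) = - 'i%C.
Proof. by rewrite -[RHS]/(Complex _ _) /=; simpc. Qed.

Lemma posdef_unit n (G : 'M[C]_n) :
  (forall v : Cspace R n, v != 0 -> 0 < hform G v v) -> G \in unitmx.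
Proof.
move=> hG; rewrite -row_free_unit -kermx_eq0; apply/eqP/row_matrixP => i.
rewrite row0; apply/eqP; apply: contraT => /hG.
by rewrite /hform -row_mul mulmx_ker row0 mul0mx mxE ltxx.
Qed.

End Adjoint.

(** The matrix identity behind [dzbar_christoffel]: [g] stands for [dz_mx i H], [Gi] for the inverse
    of [H], and the pairs [a], [b] and [p], [q] for the derivatives of [dz_mx i H] and of [H] along
    the two real directions. *)
Lemma christoffel_algebra (K : fieldType) n (a b g p q G Gi : 'M[K]_n) (h i2 : K) :
  (forall B : 'M[K]_n, B *m Gi *m G = B) ->
  h *: (a *m Gi - g *m Gi *m p *m Gi + i2 *: (b *m Gi - g *m Gi *m q *m Gi)) *m G =
  h *: (a + i2 *: b) - g *m Gi *m (h *: (p + i2 *: q)).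
Proof.
move=> KV; rewrite -scalemxAl mulmxDl -scalemxAl !mulmxBl !KV.
rewrite -scalemxAr mulmxDr -scalemxAr -scalerBr; congr (_ *: _).
by rewrite scalerBr opprD addrACA.
Qed.

Lemma sum_scale_mulmx (K : fieldType) m n p (I : finType) (Z : 'M[K]_(m, n))
    (x : I -> K) (a b : I -> 'M[K]_(n, p)) (h i2 : K) :
  h *: (\sum_i x i *: (Z *m a i) + i2 *: \sum_i x i *: (Z *m b i)) =
  \sum_i x i *: (Z *m (h *: (a i + i2 *: b i))).
Proof.
rewrite scaler_sumr -big_split scaler_sumr; apply: eq_bigr => i _ /=.
by rewrite -scalemxAr mulmxDr -scalemxAr !scalerDr !scalerA; congr (_ *: _ + _ *: _); ring.
Qed.

Lemma curvature_sum_algebra (K : fieldType) m n (I J : finType) (Z : 'M[K]_(m, n))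
    (x : I -> K) (y : J -> K) (D dd : I -> J -> 'M[K]_n) (g : I -> 'M[K]_n)
    (d : J -> 'M[K]_n) (G Gi : 'M[K]_n) :
  (forall i j, D i j *m G = dd i j - g i *m Gi *m d j) ->
  (\sum_j y j *: \sum_i x i *: (Z *m D i j)) *m G =
  Z *m (\sum_j y j *: (\sum_i x i *: dd i j)
        - (\sum_i x i *: g i) *m Gi *m \sum_j y j *: d j).
Proof.
move=> hD; rewrite mulmx_suml mulmx_sumr -sumrB mulmx_sumr.
apply: eq_bigr => j _; rewrite -scalemxAr -scalerBr -scalemxAr -scalemxAl.
congr (_ *: _); rewrite !mulmx_suml -sumrB mulmx_sumr; apply: eq_bigr => i _.
by rewrite -!scalemxAl -mulmxA hD -scalerBr -scalemxAr.
Qed.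

Lemma curvature_coef_algebra (K : fieldType) n (I J : finType)
    (x : I -> K) (y : J -> K) (dd : I -> J -> 'M[K]_n) (g : I -> 'M[K]_n)
    (d : J -> 'M[K]_n) (Gi : 'M[K]_n) :
  (\sum_i x i *: g i) *m Gi *m (\sum_j y j *: d j)
    - \sum_j y j *: (\sum_i x i *: dd i j) =
  \sum_i \sum_j (x i * y j) *: (g i *m Gi *m d j - dd i j).
Proof.
rewrite exchange_big mulmx_sumr -sumrB; apply: eq_bigr => j _.
rewrite -scalemxAr -scalerBr !mulmx_suml -sumrB scaler_sumr; apply: eq_bigr => i _.
by rewrite -!scalemxAl -scalerBr scalerA mulrC.
Qed.

Section LocalCurvature.
#[local] Opaque dir_deriv.
Context {R : realType} {n : nat}.
Notation C := (Cplx R).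
Notation V := (Cspace R n).

Implicit Types (X Y Z u v z : V).

Definition dmx p q (v : V) (F : V -> 'M[C]_(p, q)) (z : V) : 'M[C]_(p, q) :=
  \matrix_(k, l) dir_deriv (fun w => F w k l) v z.

Lemma dmxE p q v (F : V -> 'M[C]_(p, q)) z D :
  has_mderiv (fun t => F (z + (t%:C)%C *: v)) 0 D -> dmx v F z = D.
Proof. by move=> h; apply/matrixP => k l; rewrite mxE; apply: dir_derivE; exact: h. Qed.

Lemma dzbar_mxE p q j (F : V -> 'M[C]_(p, q)) z : dzbar_mx j F z =
  2^-1 *: (dmx (basis_vec j) F z + 'i%C *: dmx ('i%C *: basis_vec j) F z).
Proof. by apply/matrixP => k l; rewrite !mxE. Qed.

Lemma dz_mxE p q j (F : V -> 'M[C]_(p, q)) z : dz_mx j F z =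
  2^-1 *: (dmx (basis_vec j) F z - 'i%C *: dmx ('i%C *: basis_vec j) F z).
Proof. by apply/matrixP => k l; rewrite !mxE. Qed.

Variables (U : set V) (H : V -> 'M[C]_n).
Hypotheses (oU : open U) (sH : forall k l, smooth_on U (fun z => H z k l)).
Hypotheses (hermH : forall z, U z -> adjmx (H z) = H z).
Hypotheses (unitH : forall z, U z -> H z \in unitmx).

Let smooth_dmx u k l : smooth_on U (fun w => dmx u H w k l).
Proof.
rewrite (_ : (fun w => _) = dir_deriv (fun w => H w k l) u); last first.
  by apply/funext => w; rewrite mxE.
exact: smooth_dir_deriv.
Qed.

(* The derivatives of [H] along the (1,0)-vector [X] ([hder]), along its conjugate
   ([ader]), and along [X] and the conjugate of [Y] ([mixed]). *)
Definition hder (X : V) z : 'M[C]_n :=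
  2^-1 *: (dmx X H z - 'i%C *: dmx ('i%C *: X) H z).
Definition ader (X : V) z : 'M[C]_n :=
  2^-1 *: (dmx X H z + 'i%C *: dmx ('i%C *: X) H z).
Definition mixed (X Y : V) z : 'M[C]_n :=
  4^-1 *: (dmx X (dmx Y H) z - 'i%C *: dmx ('i%C *: X) (dmx Y H) z
    + 'i%C *: dmx X (dmx ('i%C *: Y) H) z + dmx ('i%C *: X) (dmx ('i%C *: Y) H) z).
(** The classical formula dH H^-1 dbar H - d dbar H for the curvature with its last index lowered by
    the metric. *)
Definition curv_mx (X Y : V) z : 'M[C]_n :=
  hder X z *m invmx (H z) *m ader Y z - mixed X Y z.

Lemma sum_dz_mx X z : U z -> \sum_i X 0 i *: dz_mx i H z = hder X z.
Proof.
move=> Uz; apply/matrixP => k l; rewrite summxE.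
have := sum_dz oU (sH k l) X Uz; rewrite !mxE => <-.
by apply: eq_bigr => i _; rewrite !mxE.
Qed.

Lemma sum_dzbar_mx Y z : U z -> \sum_i Num.conj (Y 0 i) *: dzbar_mx i H z = ader Y z.
Proof.
move=> Uz; apply/matrixP => k l; rewrite summxE.
have := sum_dzbar oU (sH k l) Y Uz; rewrite !mxE => <-.
by apply: eq_bigr => i _; rewrite !mxE.
Qed.

Lemma dmx2_entry u v z k l : dmx u (dmx v H) z k l =
  dir_deriv (dir_deriv (fun x => H x k l) v) u z.
Proof.
rewrite [LHS]mxE (_ : (fun w => _) = dir_deriv (fun x => H x k l) v)//.
by apply/funext => x; rewrite [LHS]mxE.
Qed.

Lemma dmx_comm u v z : U z -> dmx v (dmx u H) z = dmx u (dmx v H) z.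
Proof.
move=> Uz; apply/matrixP => k l.
have e := dir_deriv_comm oU (sH k l) u v Uz.
exact: (etrans (dmx2_entry v u z k l) (etrans e (esym (dmx2_entry u v z k l)))).
Qed.

Lemma smooth_has_mderiv p q (F : V -> 'M[C]_(p, q)) v z :
  (forall k l, smooth_on U (fun w => F w k l)) -> U z ->
  has_mderiv (fun t => F (z + (t%:C)%C *: v)) 0 (dmx v F z).
Proof.
move=> sF Uz k l; rewrite mxE; apply: has_cderiv_dir.
exact: smooth_derivable (sF k l) Uz.
Qed.

Lemma near_line v z : U z -> \forall t \near (0 : R), U (z + (t%:C)%C *: v).
Proof.
move=> Uz; have [e e0 he] := smooth_near_plane oU v 0 Uz.
exists e => // t /=; rewrite sub0r normrN => te.
have := he t 0; rewrite scaler0 addr0; apply=> //.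
by rewrite normr0.
Qed.

Lemma dmx_adj v z : U z -> adjmx (dmx v H z) = dmx v H z.
Proof.
move=> Uz; apply/esym/dmxE.
apply: has_mderiv_near (has_mderiv_adj (smooth_has_mderiv v sH Uz)).
by apply: filterS (near_line v Uz) => t; exact: hermH.
Qed.

Lemma dmx2_adj u v z : U z -> adjmx (dmx u (dmx v H) z) = dmx u (dmx v H) z.
Proof.
move=> Uz; apply/esym/dmxE.
apply: has_mderiv_near (has_mderiv_adj (smooth_has_mderiv u (smooth_dmx v) Uz)).
by apply: filterS (near_line u Uz) => t; exact: dmx_adj.
Qed.

Lemma hder_adj X z : U z -> adjmx (hder X z) = ader X z.
Proof.
move=> Uz; rewrite /hder /ader adjmxZ adjmxB adjmxZ !dmx_adj// conj_i scaleNr opprK.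
by rewrite fmorphV rmorph_nat.
Qed.

(** Adjunction exchanges [hder] with [ader]; in [mixed], the real second derivatives are Hermitian
    matrices and commute. *)
Lemma curv_mx_adj X Y z : U z -> adjmx (curv_mx X Y z) = curv_mx Y X z.
Proof.
move=> Uz; rewrite /curv_mx adjmxB !adjmxM hder_adj// adjmx_inv ?unitH ?hermH//.
rewrite -[in LHS](hder_adj Y Uz) adjmxK mulmxA; congr (_ - _).
rewrite /mixed.
have h1 := dmx2_adj X Y Uz; have h2 := dmx2_adj ('i%C *: X) Y Uz.
have h3 := dmx2_adj X ('i%C *: Y) Uz; have h4 := dmx2_adj ('i%C *: X) ('i%C *: Y) Uz.
rewrite (dmx_comm X Y Uz) (dmx_comm ('i%C *: X) Y Uz).
rewrite (dmx_comm X ('i%C *: Y) Uz) (dmx_comm ('i%C *: X) ('i%C *: Y) Uz).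
move: (dmx X (dmx Y H) z) (dmx ('i%C *: X) (dmx Y H) z) (dmx X (dmx ('i%C *: Y) H) z)
  (dmx ('i%C *: X) (dmx ('i%C *: Y) H) z) h1 h2 h3 h4 => a b c d ha hb hc hd.
rewrite adjmxZ 2!adjmxD adjmxB adjmxZ adjmxZ ha hb hc hd conj_i fmorphV rmorph_nat.
by rewrite !scaleNr opprK; congr (_ *: (_ + _)); rewrite addrAC.
Qed.

(** The contraction with the conjugate of [Y] is carried out first. Commuting real derivatives then
    lets [dz i] act last, on the derivatives of [f] along [Y] and ['i *: Y], where the contraction
    with [X] applies. *)
Lemma sum_dzbar_dz_mx X Y z : U z ->
  \sum_j Num.conj (Y 0 j) *: \sum_i X 0 i *: dzbar_mx j (dz_mx i H) z = mixed X Y z.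
Proof.
move=> Uz; apply/matrixP => k l.
pose f w := H w k l; have sf : smooth_on U f := sH k l.
have sD v : smooth_on U (dir_deriv f v) by exact: smooth_dir_deriv.
have dzl j (a b : C) u v : dzbar j (fun w => a * dir_deriv f u w + b * dir_deriv f v w) z
    = a * dzbar j (dir_deriv f u) z + b * dzbar j (dir_deriv f v) z.
  have E w : dir_deriv (fun w => a * dir_deriv f u w + b * dir_deriv f v w) w z =
      a * dir_deriv (dir_deriv f u) w z + b * dir_deriv (dir_deriv f v) w z.
    apply: dir_derivE; apply: has_cderivD; apply: has_cderivZ; apply: has_cderiv_dir;
      exact: smooth_derivable Uz.
  rewrite /dzbar (E (basis_vec j)) (E ('i%C *: basis_vec j)).
  have alg (h i2 p q r s : C) : h * ((a * p + b * q) + i2 * (a * r + b * s)) =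
      a * (h * (p + i2 * r)) + b * (h * (q + i2 * s)) by ring.
  exact: alg.
have -> : (\sum_j Num.conj (Y 0 j) *: \sum_i X 0 i *: dzbar_mx j (dz_mx i H) z) k l =
    \sum_i X 0 i * \sum_j Num.conj (Y 0 j) * dzbar j (dz i f) z.
  rewrite summxE; under eq_bigr do rewrite mxE summxE mulr_sumr.
  rewrite exchange_big; apply: eq_bigr => i _; rewrite mulr_sumr.
  apply: eq_bigr => j _; rewrite !mxE mulrCA; congr (_ * (_ * dzbar j _ z)).
  by apply/funext => w; rewrite mxE.
have E i : \sum_j Num.conj (Y 0 j) * dzbar j (dz i f) z =
    2^-1 * dz i (dir_deriv f Y) z + 2^-1 * 'i%C * dz i (dir_deriv f ('i%C *: Y)) z.
  have Ed : dz i f = fun w => 2^-1 * dir_deriv f (basis_vec i) w +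
      (- (2^-1 * 'i%C)) * dir_deriv f ('i%C *: basis_vec i) w.
    by apply/funext => w; rewrite /dz mulrBr mulrA mulNr.
  under eq_bigr do rewrite Ed dzl mulrDr.
  rewrite big_split /=.
  have F a v : \sum_j Num.conj (Y 0 j) * (a * dzbar j (dir_deriv f v) z) =
      a * (2^-1 * (dir_deriv (dir_deriv f Y) v z + 'i%C * dir_deriv (dir_deriv f ('i%C *: Y)) v z)).
    rewrite !(dir_deriv_comm oU sf _ v Uz) -(sum_dzbar oU (sD v) Y Uz) mulr_sumr.
    by apply: eq_bigr => j _; rewrite mulrCA.
  have alg (h i2 p q r s : C) : h * (h * (p + i2 * q)) + - (h * i2) * (h * (r + i2 * s)) =
      h * (h * (p - i2 * r)) + h * i2 * (h * (q - i2 * s)) by ring.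
  apply: etrans (alg _ _ _ _ _ _).
  exact: (congr2 +%R (F 2^-1 (basis_vec i)) (F (- (2^-1 * 'i%C)) ('i%C *: basis_vec i))).
under eq_bigr do rewrite E mulrDr.
rewrite big_split /=.
have F a v : \sum_i X 0 i * (a * dz i (dir_deriv f v) z) =
   a * (2^-1 * (dir_deriv (dir_deriv f v) X z - 'i%C * dir_deriv (dir_deriv f v) ('i%C *: X) z)).
  rewrite -(sum_dz oU (sD v) X Uz) mulr_sumr.
  by apply: eq_bigr => j _; rewrite mulrCA.
apply: (etrans (congr2 +%R (F 2^-1 Y) (F (2^-1 * 'i%C) ('i%C *: Y)))).
have entry (a b c d : 'M[C]_n) (h i2 : C) :
    (h *: (a - i2 *: b + i2 *: c + d)) k l =
    h * (a k l - i2 * b k l + i2 * c k l + d k l) by rewrite !mxE.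
apply: etrans (esym (entry _ _ _ _ _ _)).
have alg (h i2 p q r s p' q' r' s' : C) : h * h = 4^-1 -> i2 * i2 = -1 ->
    p' = p -> q' = q -> r' = r -> s' = s ->
    h * (h * (p - i2 * q)) + h * i2 * (h * (r - i2 * s)) =
    4^-1 * (p' - i2 * q' + i2 * r' + s').
  move=> <- ii -> -> -> ->.
  transitivity (h * h * (p - i2 * q + i2 * r - i2 * i2 * s)); first ring.
  by rewrite ii; ring.
apply: (alg _ _ _ _ _ _ _ _ _ _ _ _ (dmx2_entry X Y z k l)
  (dmx2_entry ('i%C *: X) Y z k l) (dmx2_entry X ('i%C *: Y) z k l)
  (dmx2_entry ('i%C *: X) ('i%C *: Y) z k l)).
  by rewrite -invfM -natrM.
by have := sqr_i R; rewrite expr2.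
Qed.

Lemma dz_mx_derivable i v z : U z ->
  has_mderiv (fun t => dz_mx i H (z + (t%:C)%C *: v)) 0 (dmx v (dz_mx i H) z).
Proof.
move=> Uz.
have h u := smooth_has_mderiv v (smooth_dmx u) Uz.
have k := has_mderivZ 2^-1 (has_mderivD (h (basis_vec i))
  (has_mderivN (has_mderivZ 'i%C (h ('i%C *: basis_vec i))))).
have E : (fun t => dz_mx i H (z + (t%:C)%C *: v)) = (fun s => 2^-1 *:
    (dmx (basis_vec i) H (z + (s%:C)%C *: v) +
     - ('i%C *: dmx ('i%C *: basis_vec i) H (z + (s%:C)%C *: v)))).
  by apply/funext => t; rewrite dz_mxE.
by rewrite -E in k; rewrite (dmxE k).
Qed.

Lemma christoffel_derivable i v z : U z ->
  has_mderiv (fun t => christoffel H i (z + (t%:C)%C *: v)) 0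
    (dmx v (dz_mx i H) z *m invmx (H z)
     - dz_mx i H z *m invmx (H z) *m dmx v H z *m invmx (H z)).
Proof.
move=> Uz.
have Hu : \forall t \near (0 : R), H (z + (t%:C)%C *: v) \in unitmx.
  by apply: filterS (near_line v Uz) => t; exact: unitH.
have h := has_mderiv_inv Hu (smooth_has_mderiv v sH Uz).
have := has_mderivM (dz_mx_derivable i v Uz) h.
by apply: has_mderiv_eq; rewrite !scale0r !addr0 mulmxN !mulmxA.
Qed.

Lemma dzbar_christoffel i j z : U z ->
  dzbar_mx j (christoffel H i) z *m H z =
  dzbar_mx j (dz_mx i H) z - dz_mx i H z *m invmx (H z) *m dzbar_mx j H z.
Proof.
move=> Uz; rewrite !dzbar_mxE !(dmxE (christoffel_derivable _ _ Uz)).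
by apply: christoffel_algebra => B; rewrite mulmxKV// unitH.
Qed.

(** The (0,1)-derivative of the constant section [Z] is 0, so the commutator reduces to minus the
    dbar-derivative of [Z] times the Christoffel matrices. Multiplication by [H z] lowers the index
    as [hform] does. *)
Lemma curvature_endoE X Y Z z : U z ->
  curvature_endo H X Y Z z *m H z = Z *m curv_mx X Y z.
Proof.
move=> Uz.
have dcst (W : V) v w : dmx v (fun=> W) w = 0 by apply: dmxE; exact: has_mderiv_cst.
rewrite /curvature_endo.
have -> : nabla01 Y (fun=> Z) = fun=> 0.
  apply/funext => w; rewrite /nabla01 big1// => i _.
  by rewrite dzbar_mxE !dcst !scaler0 addr0 !scaler0.
have -> : nabla10 H X (fun=> 0) z = 0.
  rewrite /nabla10 big1// => i _.
  by rewrite dz_mxE !dcst !scaler0 subr0 scaler0 mul0mx addr0 scaler0.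
have -> : nabla10 H X (fun=> Z) = fun w => \sum_i X 0 i *: (Z *m christoffel H i w).
  apply/funext => w; apply: eq_bigr => i _.
  by rewrite dz_mxE !dcst !scaler0 subr0 scaler0 add0r.
rewrite sub0r mulNmx /curv_mx -(sum_dz_mx _ Uz) -(sum_dzbar_mx _ Uz) -(sum_dzbar_dz_mx _ _ Uz).
rewrite -[RHS]opprK -[X in _ = - X]mulmxN opprB; congr (- _).
apply: etrans (curvature_sum_algebra _ _ _ (fun i j => dzbar_christoffel i j Uz)).
congr (_ *m _); apply: eq_bigr => j _; congr (_ *: _).
have hs v : has_mderiv (fun t => \sum_i X 0 i *: (Z *m christoffel H i (z + (t%:C)%C *: v))) 0
   (\sum_i X 0 i *: (Z *m dmx v (christoffel H i) z)).
  move=> k l; rewrite [X in has_cderiv _ _ X]summxE.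
  apply: (@has_cderiv_ext _ (fun t => \sum_i (X 0 i *: (Z *m christoffel H i (z + (t%:C)%C *: v))) k l)).
    by move=> t; rewrite [RHS]summxE.
  apply: has_cderiv_sum => i _; apply: (has_mderivZ (X 0 i)).
  have := has_mderivM (has_mderiv_cst Z 0) (christoffel_derivable i v Uz).
  by rewrite mul0mx add0r (dmxE (christoffel_derivable i v Uz)).
rewrite dzbar_mxE (dmxE (hs (basis_vec j))) (dmxE (hs ('i%C *: basis_vec j))).
rewrite sum_scale_mulmx; apply: eq_bigr => i _; congr (_ *: (_ *m _)).
by rewrite dzbar_mxE.
Qed.

Definition curv_coef i j z : 'M[C]_n :=
  dz_mx i H z *m invmx (H z) *m dzbar_mx j H z - dzbar_mx j (dz_mx i H) z.

(** Exhibits complex linearity in [X] and antilinearity in [Y], which the real directions in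
    [curv_mx] hide; the variation of frames relies on both. *)
Lemma curv_mx_coef X Y z : U z ->
  curv_mx X Y z = \sum_i \sum_j (X 0 i * Num.conj (Y 0 j)) *: curv_coef i j z.
Proof.
move=> Uz.
rewrite /curv_mx -(sum_dz_mx _ Uz) -(sum_dzbar_mx _ Uz) -(sum_dzbar_dz_mx _ _ Uz).
exact: curvature_coef_algebra.
Qed.

End LocalCurvature.

(** * Second variation of the norms of vectors and covectors *)

Section NormJetAlgebra.
Variables (F : fieldType) (n : nat).
Implicit Types (p q a b H G Gi : 'M[F]_n) (w x : 'rV[F]_n) (wa xi : 'cV[F]_n).

Let entD (a b : 'M[F]_1) : (a + b) 0 0 = a 0 0 + b 0 0. Proof. by rewrite mxE. Qed.
Let entN (a : 'M[F]_1) : (- a) 0 0 = - a 0 0. Proof. by rewrite mxE. Qed.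

(** Here and in the next three lemmas [p] and [q] are the (1,0)- and (0,1)-derivatives of the
    metric, [p + q] its real derivative, [H] its second derivative and [Gi] its inverse. *)
Lemma norm_jet1_algebra p q G Gi w wa : G *m Gi = 1%:M -> Gi *m G = 1%:M ->
  (- (w *m p *m Gi) *m G + w *m (p + q)) *m wa + w *m G *m - (Gi *m q *m wa) = 0.
Proof.
move=> GGi GiG.
have -> : - (w *m p *m Gi) *m G + w *m (p + q) = w *m q.
  by rewrite mulNmx -!mulmxA GiG mulmx1 mulmxDr addrA addNr add0r.
by rewrite mulmxN !mulmxA -(mulmxA w G Gi) GGi mulmx1 subrr.
Qed.

Lemma norm_jet2_algebra p q H G Gi w wa : Gi *m G = 1%:M ->
  (0 *m G + (- (w *m p *m Gi) *m (p + q)) *+ 2 + w *m H) *m wa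
  + ((- (w *m p *m Gi) *m G + w *m (p + q)) *m - (Gi *m q *m wa)) *+ 2
  + w *m G *m 0
  = w *m (H - (p *m Gi *m p) *+ 2 - (p *m Gi *m q) *+ 2 - (q *m Gi *m q) *+ 2) *m wa.
Proof.
move=> GiG; rewrite mul0mx add0r mulmx0 addr0.
have -> : - (w *m p *m Gi) *m G + w *m (p + q) = w *m q.
  by rewrite mulNmx -!mulmxA GiG mulmx1 mulmxDr addrA addNr add0r.
rewrite !(mulNmx, mulmxN, mulmxDr, mulmxDl, mulr2n, mulmxA, opprD).
apply/matrixP => i j; rewrite !ord1 !(entD, entN); ring.
Qed.

Lemma dual_jet1_algebra p q Gi x xi :
  (x *m Gi *m q *m Gi + x *m - (Gi *m (p + q) *m Gi)) *m xi
    + x *m Gi *m (p *m Gi *m xi) = 0.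
Proof.
rewrite !(mulNmx, mulmxN, mulmxDr, mulmxDl, mulr2n, mulmxA, opprD).
apply/matrixP => i j; rewrite !ord1 !(entD, entN) [RHS]mxE; ring.
Qed.

Lemma dual_jet2_algebra p q H Gi x xi :
  (0 *m Gi + (x *m Gi *m q *m - (Gi *m (p + q) *m Gi)) *+ 2
    + x *m ((Gi *m (p + q) *m Gi *m (p + q) *m Gi) *+ 2 - Gi *m H *m Gi)) *m xi
  + ((x *m Gi *m q *m Gi + x *m - (Gi *m (p + q) *m Gi)) *m (p *m Gi *m xi)) *+ 2
  + x *m Gi *m 0
  = x *m Gi *m ((p *m Gi *m q) *+ 2 - H) *m (Gi *m xi).
Proof.
rewrite mul0mx add0r mulmx0 addr0.
rewrite !(mulNmx, mulmxN, mulmxDr, mulmxDl, mulr2n, mulmxA, opprD).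
apply/matrixP => i j; rewrite !ord1 !(entD, entN); ring.
Qed.

(** Passing from [X] to ['i *: X] multiplies [p] by i and [q] by -i: in the sum over both directions
    the terms in [p Gi p] and [q Gi q] cancel, while those in [p Gi q] double. *)
Lemma norm_sum_algebra p q a b Gi w wa (i2 : F) : i2 * i2 = -1 -> (4 : F) != 0 ->
  (w *m (a - (p *m Gi *m p) *+ 2 - (p *m Gi *m q) *+ 2 - (q *m Gi *m q) *+ 2) *m wa) 0 0
  + (w *m (b - ((i2 *: p) *m Gi *m (i2 *: p)) *+ 2 - ((i2 *: p) *m Gi *m (- i2 *: q)) *+ 2
    - ((- i2 *: q) *m Gi *m (- i2 *: q)) *+ 2) *m wa) 0 0
  = - 4 * (w *m (p *m Gi *m q - 4^-1 *: (a + b)) *m wa) 0 0.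
Proof.
move=> ii f4.
rewrite -!scalemxAl -!scalemxAr !scalerA !mulrN !mulNr opprK ii opprK !scaleN1r scale1r.
rewrite !(mulNmx, mulmxN, mulmxDr, mulmxDl, mulr2n, mulmxA, opprD, opprK).
have E : (w *m (4^-1 *: (a + b)) *m wa) 0 0 =
    4^-1 * ((w *m a *m wa) 0 0 + (w *m b *m wa) 0 0).
  by rewrite -scalemxAr -scalemxAl [LHS]mxE mulmxDr mulmxDl entD.
by rewrite !(entD, entN) E; field.
Qed.

Lemma dual_sum_algebra p q a b Gi w wa (i2 : F) : i2 * i2 = -1 -> (4 : F) != 0 ->
  (w *m ((p *m Gi *m q) *+ 2 - a) *m wa) 0 0
  + (w *m (((i2 *: p) *m Gi *m (- i2 *: q)) *+ 2 - b) *m wa) 0 0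
  = 4 * (w *m (p *m Gi *m q - 4^-1 *: (a + b)) *m wa) 0 0.
Proof.
move=> ii f4.
rewrite -!scalemxAl -!scalemxAr !scalerA !(mulrN, mulNr) ii opprK scale1r.
rewrite !(mulNmx, mulmxN, mulmxDr, mulmxDl, mulr2n, mulmxA, opprD, opprK).
have E : (w *m (4^-1 *: (a + b)) *m wa) 0 0 =
    4^-1 * ((w *m a *m wa) 0 0 + (w *m b *m wa) 0 0).
  by rewrite -scalemxAr -scalemxAl [LHS]mxE mulmxDr mulmxDl entD.
by rewrite !(entD, entN) E; field.
Qed.

Lemma half_sum_difference a b : (2 : F) != 0 -> a = 2^-1 *: (a - b) + 2^-1 *: (a + b).
Proof.
move=> f2; rewrite -scalerDr addrACA addNr addr0 -mulr2n -scaler_nat scalerA.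
by rewrite mulVf// scale1r.
Qed.

End NormJetAlgebra.

Section NormJets.
Context {R : realType} {n : nat}.
Notation C := (Cplx R).
Notation V := (Cspace R n).
Variables (U : set V) (H : V -> 'M[C]_n).
Hypotheses (oU : open U) (sH : forall k l, smooth_on U (fun z => H z k l)).
Hypotheses (hermH : forall z, U z -> adjmx (H z) = H z).
Hypotheses (unitH : forall z, U z -> H z \in unitmx).
Implicit Types (v X z : V).
#[local] Opaque dir_deriv.

Lemma mjet2_line v z : U z ->
  mjet2 (fun s => H (z + (s%:C)%C *: v)) (H z) (dmx v H z) (dmx v (dmx v H) z).
Proof.
move=> Uz; split; first by rewrite scale0r addr0.
exists (fun s => dmx v H (z + (s%:C)%C *: v)); split.
- apply: filterS (near_line oU v Uz) => s Us k l.
  rewrite [X in has_cderiv _ _ X]mxE; apply: has_cderiv_line.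
  exact: smooth_derivable (sH k l) Us.
- by rewrite scale0r addr0.
- apply: smooth_has_mderiv Uz => k l.
  rewrite (_ : (fun w => _) = dir_deriv (fun w => H w k l) v); last first.
    by apply/funext => w; rewrite [LHS]mxE.
  exact: smooth_dir_deriv.
Qed.

Lemma dmx_hder v z : dmx v H z = hder H v z + ader H v z.
Proof.
by apply: half_sum_difference; rewrite pnatr_eq0.
Qed.

Lemma dmx_ii v z : U z -> dmx ('i%C *: ('i%C *: v)) H z = - dmx v H z.
Proof.
move=> Uz; apply/matrixP => k l; rewrite [LHS]mxE [RHS]mxE [X in _ = - X]mxE.
rewrite scalerA (_ : 'i%C * 'i%C = ((-1)%:C)%C); last first.
  by rewrite -expr2 sqr_i rmorphN1.
by rewrite (dir_derivZ (sH k l) (-1) v Uz) rmorphN1 mulN1r.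
Qed.

Lemma hder_i X z : U z -> hder H ('i%C *: X) z = 'i%C *: hder H X z.
Proof.
move=> Uz; rewrite /hder dmx_ii//.
move: (dmx X H z) (dmx ('i%C *: X) H z) => a b.
rewrite scalerN opprK scalerA mulrC -scalerA; congr (_ *: _).
by rewrite scalerBr scalerA -expr2 sqr_i scaleN1r opprK addrC.
Qed.

Lemma ader_i X z : U z -> ader H ('i%C *: X) z = - 'i%C *: ader H X z.
Proof.
move=> Uz; rewrite /ader dmx_ii//.
move: (dmx X H z) (dmx ('i%C *: X) H z) => a b.
rewrite scalerN scalerA mulrC -scalerA; congr (_ *: _).
by rewrite scalerDr scalerA mulNr -expr2 sqr_i opprK scale1r addrC scaleNr.
Qed.

Lemma mixed_diag X z : U z -> mixed H X X z =
  4^-1 *: (dmx X (dmx X H) z + dmx ('i%C *: X) (dmx ('i%C *: X) H) z).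
Proof.
move=> Uz; rewrite /mixed (dmx_comm oU sH X ('i%C *: X) Uz).
by congr (_ *: (_ + _)); rewrite subrK.
Qed.

(** For [K] the inverse Gram matrix, the squared dual norm of the covector [xi]. *)
Definition cform (K : 'M[C]_n) (xi : 'cV[C]_n) : C := (adjmx xi *m K *m xi) 0 0.

Definition norm_jet_value (w : V) v z (p q : 'M[C]_n) : C :=
  (w *m (dmx v (dmx v H) z - (p *m invmx (H z) *m p) *+ 2
     - (p *m invmx (H z) *m q) *+ 2 - (q *m invmx (H z) *m q) *+ 2) *m adjmx w) 0 0.

(* The affine section [w - s w Gamma] has zero covariant derivative at [s = 0],
   so its squared norm is critical there; likewise for covectors below. *)
Lemma norm_jet w v z : U z ->
  jet2 (fun s => hform (H (z + (s%:C)%C *: v))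
          (w + (s%:C)%C *: - (w *m hder H v z *m invmx (H z)))
          (w + (s%:C)%C *: - (w *m hder H v z *m invmx (H z))))
    (hform (H z) w w) 0 (norm_jet_value w v z (hder H v z) (ader H v z)).
Proof.
move=> Uz; set w1 := - _.
have hw := mjet2_affine w w1; have hH := mjet2_line v Uz.
have hA : adjmx w1 = - (invmx (H z) *m ader H v z *m adjmx w).
  rewrite /w1 adjmxN !adjmxM (hder_adj oU sH hermH v Uz).
  by rewrite (adjmx_inv (unitH Uz) (hermH Uz)) mulmxA.
have := mjet2_entry 0 0 (mjet2M (mjet2M hw hH) (mjet2_adj hw)).
have GK : H z *m invmx (H z) = 1%:M by rewrite mulmxV// unitH.
have KG : invmx (H z) *m H z = 1%:M by rewrite mulVmx// unitH.
apply: jet2_eq => //.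
  rewrite hA dmx_hder /w1; apply: etrans (_ : (0 : 'M[C]_1) 0 0 = 0); last by rewrite mxE.
  by congr (fun_of_matrix _ 0 0); exact: norm_jet1_algebra.
rewrite hA dmx_hder /w1 /norm_jet_value.
have -> : adjmx (0 : V) = 0 by apply/matrixP => i j; rewrite !mxE conjC0.
by congr (fun_of_matrix _ 0 0); exact: norm_jet2_algebra.
Qed.

Lemma norm_jet_sum w X z : U z ->
  norm_jet_value w X z (hder H X z) (ader H X z)
  + norm_jet_value w ('i%C *: X) z (hder H ('i%C *: X) z) (ader H ('i%C *: X) z)
  = - 4 * hform (curv_mx H X X z) w w.
Proof.
move=> Uz; rewrite (hder_i X Uz) (ader_i X Uz) /curv_mx (mixed_diag X Uz).
by apply: norm_sum_algebra; rewrite ?pnatr_eq0// -expr2 sqr_i.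
Qed.

Definition dual_jet_value (xi : 'cV[C]_n) v z (p q : 'M[C]_n) : C :=
  (adjmx xi *m invmx (H z) *m ((p *m invmx (H z) *m q) *+ 2 - dmx v (dmx v H) z)
    *m (invmx (H z) *m xi)) 0 0.

Lemma dual_jet xi v z : U z ->
  jet2 (fun s => cform (invmx (H (z + (s%:C)%C *: v)))
          (xi + (s%:C)%C *: (hder H v z *m invmx (H z) *m xi)))
    (cform (invmx (H z)) xi) 0 (dual_jet_value xi v z (hder H v z) (ader H v z)).
Proof.
move=> Uz; set x1 := _ *m xi.
have hx := mjet2_affine xi x1.
have Hu : \forall t \near (0 : R), H (z + (t%:C)%C *: v) \in unitmx.
  by apply: filterS (near_line oU v Uz) => t; exact: unitH.
have hK := mjet2_inv Hu (mjet2_line v Uz).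
have hA : adjmx x1 = adjmx xi *m invmx (H z) *m ader H v z.
  rewrite /x1 !adjmxM (hder_adj oU sH hermH v Uz).
  by rewrite (adjmx_inv (unitH Uz) (hermH Uz)) mulmxA.
have := mjet2_entry 0 0 (mjet2M (mjet2M (mjet2_adj hx) hK) hx).
apply: jet2_eq => //.
  rewrite hA dmx_hder /x1; apply: etrans (_ : (0 : 'M[C]_1) 0 0 = 0); last by rewrite mxE.
  by congr (fun_of_matrix _ 0 0); exact: dual_jet1_algebra.
rewrite hA dmx_hder /x1 /dual_jet_value.
have -> : adjmx (0 : 'cV[C]_n) = 0 by apply/matrixP => i j; rewrite !mxE conjC0.
by congr (fun_of_matrix _ 0 0); exact: dual_jet2_algebra.
Qed.

(** The cotangent bundle carries the opposite curvature: compared with [norm_jet_sum] the sign is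
    reversed and the curvature is evaluated at the metric dual of [xi]. *)
Lemma dual_jet_sum xi X z : U z ->
  dual_jet_value xi X z (hder H X z) (ader H X z)
  + dual_jet_value xi ('i%C *: X) z (hder H ('i%C *: X) z) (ader H ('i%C *: X) z)
  = 4 * hform (curv_mx H X X z) (adjmx xi *m invmx (H z)) (adjmx xi *m invmx (H z)).
Proof.
move=> Uz; rewrite (hder_i X Uz) (ader_i X Uz) /curv_mx (mixed_diag X Uz) /hform.
have -> : adjmx (adjmx xi *m invmx (H z)) = invmx (H z) *m xi.
  by rewrite adjmxM adjmxK adjmx_inv ?unitH ?hermH.
by apply: dual_sum_algebra; rewrite ?pnatr_eq0// -expr2 sqr_i.
Qed.

End NormJets.

(** * Holomorphic jets and the second-derivative test *)

Section HolomorphicJets.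
Context {R : realType}.
Notation C := (Cplx R).
Implicit Types (f g : R -> C) (a b c : C).

(* [f] and [g] behave to second order like a holomorphic function with value [a]
   at [z], restricted to the real lines in directions [X] and ['i *: X]. *)
Definition hol2 f g a : Prop :=
  exists b c, jet2 f a b c /\ jet2 g a ('i%C * b) (- c).

Lemma hol2_ext f f' g g' a : f =1 f' -> g =1 g' -> hol2 f g a -> hol2 f' g' a.
Proof. by move=> /funext -> /funext ->. Qed.

Lemma hol2_cst a : hol2 (fun=> a) (fun=> a) a.
Proof.
by exists 0, 0; split; [|apply: jet2_eq (jet2_cst a); rewrite ?mulr0 ?oppr0];
  rewrite //; exact: jet2_cst.
Qed.

Lemma hol2_affine a b : hol2 (fun s => a + (s%:C)%C * b)
  (fun s => a + (s%:C)%C * ('i%C * b)) a.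
Proof.
by exists b, 0; split; [|rewrite oppr0]; exact: jet2_affine.
Qed.

Lemma hol2D f g f' g' a a' : hol2 f g a -> hol2 f' g' a' ->
  hol2 (fun s => f s + f' s) (fun s => g s + g' s) (a + a').
Proof.
move=> [b [c [h1 h2]]] [b' [c' [h1' h2']]]; exists (b + b'), (c + c'); split.
  exact: jet2D.
by apply: jet2_eq (jet2D h2 h2') => //; rewrite ?mulrDr ?opprD.
Qed.

Lemma hol2M f g f' g' a a' : hol2 f g a -> hol2 f' g' a' ->
  hol2 (fun s => f s * f' s) (fun s => g s * g' s) (a * a').
Proof.
move=> [b [c [h1 h2]]] [b' [c' [h1' h2']]]; eexists _, _; split.
  exact: jet2M h1 h1'.
apply: jet2_eq (jet2M h2 h2') => //.
  move: ('i%C) => i2; ring.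
have := sqr_i R; rewrite expr2; move: ('i%C) => i2 ii.
transitivity (- c * a' + 2 * (i2 * i2 * (b * b')) + a * - c'); first ring.
by rewrite ii; ring.
Qed.

Lemma hol2_sum (I : Type) (r : seq I) (F G : I -> R -> C) (a : I -> C) :
  (forall i, hol2 (F i) (G i) (a i)) ->
  hol2 (fun s => \sum_(i <- r) F i s) (fun s => \sum_(i <- r) G i s) (\sum_(i <- r) a i).
Proof.
move=> h; elim: r => [|i r IH].
  rewrite big_nil.
  by apply: hol2_ext (hol2_cst 0) => s; rewrite big_nil.
rewrite big_cons; apply: hol2_ext (hol2D (h i) IH) => s; by rewrite big_cons.
Qed.

Lemma hol2_prod (I : Type) (r : seq I) (F G : I -> R -> C) (a : I -> C) :
  (forall i, hol2 (F i) (G i) (a i)) ->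
  hol2 (fun s => \prod_(i <- r) F i s) (fun s => \prod_(i <- r) G i s) (\prod_(i <- r) a i).
Proof.
move=> h; elim: r => [|i r IH].
  rewrite big_nil.
  by apply: hol2_ext (hol2_cst 1) => s; rewrite big_nil.
rewrite big_cons; apply: hol2_ext (hol2M (h i) IH) => s; by rewrite big_cons.
Qed.

(** Contracting [dzbar i f = 0] with [X] gives D_(iX) f = i D_X f on all of [U]. Differentiating it
    once more, with commuting derivatives, makes the second derivative along ['i *: X] minus the one
    along [X]. *)
Lemma hol2_line n (U : set (Cspace R n)) (f : Cspace R n -> C) X z :
  open U -> holomorphic_on U f -> U z ->
  hol2 (fun s => f (z + (s%:C)%C *: X)) (fun s => f (z + (s%:C)%C *: ('i%C *: X))) (f z).
Proof.
move=> oU [sf df] Uz.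
have jl v : jet2 (fun s => f (z + (s%:C)%C *: v)) (f z) (dir_deriv f v z)
    (dir_deriv (dir_deriv f v) v z).
  split; first by rewrite scale0r addr0.
  exists (fun s => dir_deriv f v (z + (s%:C)%C *: v)); split.
  - apply: filterS (near_line oU v Uz) => s Us.
    by apply: has_cderiv_line; exact: smooth_derivable sf Us.
  - by rewrite scale0r addr0.
  - apply: has_cderiv_dir; exact: smooth_derivable (smooth_dir_deriv v sf) Uz.
have ci w : U w -> dir_deriv f ('i%C *: X) w = 'i%C * dir_deriv f X w.
  move=> Uw; have := sum_dzbar oU sf X Uw.
  rewrite big1 => [/esym/eqP|i _]; last by rewrite df// mulr0.
  rewrite mulf_eq0 invr_eq0 pnatr_eq0 /= addr_eq0 => /eqP ->.
  by rewrite mulrN mulrA -expr2 sqr_i mulN1r opprK.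
have cii w : U w -> dir_deriv f ('i%C *: ('i%C *: X)) w = - dir_deriv f X w.
  move=> Uw; rewrite scalerA (_ : 'i%C * 'i%C = ((-1)%:C)%C); last first.
    by rewrite -expr2 sqr_i rmorphN1.
  by rewrite (dir_derivZ sf (-1) X Uw) rmorphN1 mulN1r.
exists (dir_deriv f X z), (dir_deriv (dir_deriv f X) X z); split; first exact: jl.
apply: jet2_eq (jl ('i%C *: X)) => //; first exact: ci.
have e v : dir_deriv (dir_deriv f ('i%C *: X)) v z = 'i%C * dir_deriv (dir_deriv f X) v z.
  apply: dir_derivE.
  have := has_cderivZ 'i%C (has_cderiv_dir (smooth_derivable v (smooth_dir_deriv X sf) Uz)).
  apply: has_cderiv_near.
  by apply: filterS (near_line oU v Uz) => s Us; rewrite (ci _ Us).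
rewrite (e ('i%C *: X)) (dir_deriv_comm oU sf X ('i%C *: X) Uz) (e X).
by rewrite mulrA -expr2 sqr_i mulN1r.
Qed.

(* [f] and [g] contribute opposite second derivatives, so the sum over both real
   directions only sees the [N i] and the term [- 4 `|f' 0| ^+ 2]. *)
Lemma max_ratio_second_derivative (I : finType) (f g : R -> C) (a : C)
    (N N' : I -> R -> C) (nu b b' : I -> C) :
  a != 0 -> (forall i, nu i != 0) -> hol2 f g a ->
  (forall i, jet2 (N i) (nu i) 0 (b i)) ->
  (forall i, jet2 (N' i) (nu i) 0 (b' i)) ->
  (\forall s \near (0 : R), f s * Num.conj (f s) * \prod_i nu i
     <= a * Num.conj a * \prod_i N i s) ->
  (\forall s \near (0 : R), g s * Num.conj (g s) * \prod_i nu i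
     <= a * Num.conj a * \prod_i N' i s) ->
  (0 < \prod_i nu i) ->
  0 <= complex.Re (\sum_i (b i + b' i) / nu i).
Proof.
move=> a0 nu0 [c [d [hf hg]]] hN hN' hmf hmg nupos.
have aa : 0 < a * Num.conj a by rewrite mul_conjC_gt0.
(* One real direction at a time: the difference of [a * Num.conj a] times the normalised norms and
   of the squared modulus of [F] is 0 at 0 and nonnegative nearby, so its second derivative has
   nonnegative real part. *)
have key (F : R -> C) x y (M : I -> R -> C) (e : I -> C) : jet2 F a x y ->
    (forall i, jet2 (M i) (nu i) 0 (e i)) ->
    (\forall s \near (0 : R), F s * Num.conj (F s) * \prod_i nu i
     <= a * Num.conj a * \prod_i M i s) ->
    0 <= complex.Re (a * Num.conj a * (\sum_i e i / nu i) -
      (y * Num.conj a + 2 * (x * Num.conj x) + a * Num.conj y)).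
  move=> hF hM hmF.
  have j1 i : jet2 (fun s => (nu i)^-1 * M i s) 1 0 (e i / nu i).
    by apply: jet2_eq (jet2Z (nu i)^-1 (hM i)); rewrite ?mulr0 ?mulVf// mulrC.
  have j2 := jet2Z (a * Num.conj a) (jet2_prod_crit (index_enum I) j1).
  have j3 := jet2D j2 (jet2N (jet2M hF (jet2_conj hF))).
  apply: jet2_second_derivative_test j3 _; first by rewrite mulr1 subrr.
  apply: filterS hmF => s hs.
  suff: 0 <= a * Num.conj a * \prod_i ((nu i)^-1 * M i s) - F s * Num.conj (F s).
    by rewrite lecE => /andP[].
  rewrite subr_ge0 big_split prodfV /= mulrA (mulrAC _ _ (\prod_i M i s)) ler_pdivlMr//.
have := key _ _ _ _ _ hg hN' hmg; have := key _ _ _ _ _ hf hN hmf.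
move=> k1 k2; have := addr_ge0 k1 k2; rewrite -raddfD /=.
have e2 : 'i%C * c * Num.conj ('i%C * c) = c * Num.conj c :> R[i].
  have -> : Num.conj ('i%C * c) = - 'i%C * Num.conj c by rewrite -conj_i; exact: rmorphM.
  by rewrite mulrACA mulrN -expr2 sqr_i opprK mul1r.
rewrite e2 rmorphN.
set S := \sum_i b i / nu i; set S' := \sum_i b' i / nu i.
have -> : \sum_i (b i + b' i) / nu i = S + S'.
  by rewrite -big_split; apply: eq_bigr => i _; rewrite mulrDl.
have cc : 0 <= c * Num.conj c by exact: mul_conjC_ge0.
move: (S) (S') (c * Num.conj c) cc (a * Num.conj a) aa => x y cc cc0 aa aa0.
have -> : aa * x - (d * Num.conj a + 2 * cc + a * Num.conj d) +
  (aa * y - (- d * Num.conj a + 2 * cc + a * - Num.conj d)) = aa * (x + y) - 4 * cc by ring.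
rewrite raddfD raddfN /= [X in X - _]Re_mulc [X in _ - X]Re_mulc.
have aai : complex.Im aa = 0 by apply: ger0_Im; rewrite ltW.
have aar : 0 < complex.Re aa by move: aa0; rewrite ltcE => /andP[].
have ccr : 0 <= complex.Re cc by move: cc0; rewrite lecE => /andP[].
have -> : complex.Re (4 : R[i]) = 4 by rewrite (_ : 4 = (4%:C)%C)// rmorph_nat.
have -> : complex.Im (4 : R[i]) = 0 by rewrite (_ : 4 = (4%:C)%C)// rmorph_nat.
rewrite aai !mul0r !subr0 => h.
rewrite -(pmulr_rge0 _ aar); apply: le_trans h _.
by rewrite gerBl mulr_ge0.
Qed.

End HolomorphicJets.

(** * Continuity and compactness *)

Section ComplexContinuity.
Context {R : realType}.
Notation C := (Cplx R).

Section Pointwise.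
Context {T : topologicalType}.
Implicit Types (f g : T -> C) (x : T).

Lemma cont_cst (c : C) x : {for x, continuous (fun=> c : C)}.
Proof. exact: cvg_cst. Qed.

Lemma contD f g x : {for x, continuous f} -> {for x, continuous g} ->
  {for x, continuous (fun y => f y + g y)}.
Proof. by move=> hf hg; exact: (@continuousD R[i] (Cplx R) _ f g _ hf hg). Qed.

Lemma contN f x : {for x, continuous f} -> {for x, continuous (fun y => - f y)}.
Proof. by move=> hf; exact: cvgN. Qed.

Lemma contM f g x : {for x, continuous f} -> {for x, continuous g} ->
  {for x, continuous (fun y => f y * g y)}.
Proof. by move=> hf hg; exact: (@continuousM R[i] _ f g _ hf hg). Qed.

Lemma contV f x : f x != 0 -> {for x, continuous f} ->
  {for x, continuous (fun y => (f y)^-1)}.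
Proof. by move=> f0 hf; exact: (@cvgV R[i]). Qed.

Lemma cont_conj f x : {for x, continuous f} ->
  {for x, continuous (fun y => Num.conj (f y))}.
Proof.
move=> /cvgrPdist_lt hf; apply/cvgrPdist_lt => e /hf; apply: filterS => y.
by rewrite -rmorphB norm_conjC.
Qed.

Lemma cont_sum (I : Type) (r : seq I) (P : pred I) (F : I -> T -> C) x :
  (forall i, {for x, continuous (F i)}) ->
  {for x, continuous (fun y => \sum_(i <- r | P i) F i y)}.
Proof.
move=> h; elim: r => [|i r IH].
  rewrite (_ : (fun y => _) = fun=> 0); first exact: cont_cst.
  by apply/funext => y; rewrite big_nil.
rewrite (_ : (fun y => _) = fun y => if P i then F i y + \sum_(j <- r | P j) F j y
   else \sum_(j <- r | P j) F j y); last first.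
  by apply/funext => y; rewrite big_cons.
by case: (P i); [exact: contD (h i) IH|exact: IH].
Qed.

Lemma cont_prod (I : Type) (r : seq I) (P : pred I) (F : I -> T -> C) x :
  (forall i, {for x, continuous (F i)}) ->
  {for x, continuous (fun y => \prod_(i <- r | P i) F i y)}.
Proof.
move=> h; elim: r => [|i r IH].
  rewrite (_ : (fun y => _) = fun=> 1); first exact: cont_cst.
  by apply/funext => y; rewrite big_nil.
rewrite (_ : (fun y => _) = fun y => if P i then F i y * \prod_(j <- r | P j) F j y
   else \prod_(j <- r | P j) F j y); last first.
  by apply/funext => y; rewrite big_cons.
by case: (P i); [exact: contM (h i) IH|exact: IH].
Qed.

Lemma cont_Re f x : {for x, continuous f} ->
  {for x, continuous (fun y => complex.Re (f y))}.
Proof.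
move=> /cvgrPdist_lt hf; apply/cvgrPdist_le => e e0.
have /hf : (0 : R[i]) < (e%:C)%C by rewrite ltcR.
apply: filterS => y; rewrite -raddfB => /normr_ReIm_le [].
by [].
Qed.

Lemma cont_det n (A : T -> 'M[C]_n) x :
  (forall i j, {for x, continuous (fun y => A y i j)}) ->
  {for x, continuous (fun y => \det (A y))}.
Proof.
move=> h; apply: cont_sum => s; apply: contM; first exact: cont_cst.
exact: cont_prod.
Qed.

Lemma cont_mulmx m n p (A : T -> 'M[C]_(m, n)) (B : T -> 'M[C]_(n, p)) x :
  (forall i j, {for x, continuous (fun y => A y i j)}) ->
  (forall i j, {for x, continuous (fun y => B y i j)}) ->
  forall i j, {for x, continuous (fun y => (A y *m B y) i j)}.
Proof.
move=> hA hB i j.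
rewrite (_ : (fun y => _) = fun y => \sum_k A y i k * B y k j); last first.
  by apply/funext => y; rewrite mxE.
by apply: cont_sum => k; exact: contM.
Qed.

Lemma cont_near f g x : (\forall y \near x, f y = g y) ->
  {for x, continuous f} -> {for x, continuous g}.
Proof.
move=> e hf; rewrite /prop_for /continuous_at -(nbhs_singleton e).
apply: cvg_trans hf; apply: near_eq_cvg.
by apply: filterS e => y.
Qed.

Lemma cont_invmx n (A : T -> 'M[C]_n) x :
  (\forall y \near x, A y \in unitmx) ->
  (forall i j, {for x, continuous (fun y => A y i j)}) ->
  forall i j, {for x, continuous (fun y => invmx (A y) i j)}.
Proof.
move=> Au h i j.
have Ax : \det (A x) != 0.
  by have := nbhs_singleton Au; rewrite unitmxE unitfE.
apply: (@cont_near (fun y => (\det (A y))^-1 * ((-1) ^+ (j + i) * \det (row' j (col' i (A y)))))).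
  by apply: filterS Au => y Ay; rewrite /invmx Ay !mxE.
apply: contM; first by apply: contV => //; exact: cont_det.
apply: contM; first exact: cont_cst.
apply: cont_det => k l.
rewrite (_ : (fun y => _) = fun y => A y (lift j k) (lift i l)); first exact: h.
by apply/funext => y; rewrite !mxE.
Qed.

Lemma cont_hform n (G : T -> 'M[C]_n) (u v : T -> Cspace R n) x :
  (forall i j, {for x, continuous (fun y => G y i j)}) ->
  (forall j, {for x, continuous (fun y => u y 0 j)}) ->
  (forall j, {for x, continuous (fun y => v y 0 j)}) ->
  {for x, continuous (fun y => hform (G y) (u y) (v y))}.
Proof.
move=> hG hu hv; apply: cont_mulmx.
  by apply: cont_mulmx => [i j|//]; rewrite (ord1 i).
move=> i j; rewrite (_ : (fun y => _) = fun y => Num.conj (v y 0 i)).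
  exact: cont_conj.
by apply/funext => y; rewrite !mxE (ord1 j).
Qed.

End Pointwise.

Lemma cont_entry m n (i : 'I_m) (j : 'I_n) (A : 'M[C]_(m, n)) :
  {for A, continuous (fun B : 'M[C]_(m, n) => B i j)}.
Proof. exact: (@coord_continuous R[i]). Qed.

Lemma Cplx_square_compact (r : R) :
  compact [set c : C | `|complex.Re c| <= r /\ `|complex.Im c| <= r].
Proof.
have -> : [set c : C | `|complex.Re c| <= r /\ `|complex.Im c| <= r] =
   (fun p : R * R => ((p.1%:C)%C + (p.2%:C)%C * 'i%C : C)) @` (`[- r, r] `*` `[- r, r]).
  have e (a b : R) : ((a%:C)%C + (b%:C)%C * 'i%C = (a +i* b)%C :> C).
    by rewrite mulrC; exact: esym (complexE (a +i* b)%C).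
  apply/seteqP; split => [[a b] /= [ha hb]|c /= [[a b] /= [ha hb] <-]].
    by exists (a, b); rewrite //= !in_itv/= -!ler_norml.
  by rewrite e /=; move: ha hb; rewrite !in_itv/= -!ler_norml.
apply: continuous_compact; last by apply: compact_setX; exact: segment_compact.
apply: continuous_subspaceT => p.
have h1 : {for p, continuous (fun q : R * R => (q.1%:C)%C : C)}.
  apply: (@cvg_comp _ _ _ (fst) (fun t : R => (t%:C)%C : C)); first exact: cvg_fst.
  exact: real_complex_continuous.
have h2 : {for p, continuous (fun q : R * R => (q.2%:C)%C : C)}.
  apply: (@cvg_comp _ _ _ (snd) (fun t : R => (t%:C)%C : C)); first exact: cvg_snd.
  exact: real_complex_continuous.
have h3 := contM h2 (@cont_cst _ 'i%C p).
have h := contD h1 h3; exact: h.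
Qed.

End ComplexContinuity.

(** * The Euclidean unit sphere of coordinate vectors *)

Section Sphere.
Context {R : realType} {n : nat}.
Notation C := (Cplx R).
Notation V := (Cspace R n).

Definition euclid2 (v : V) : C := \sum_i v 0 i * Num.conj (v 0 i).
(** A compact set of directions that does not depend on the point or the metric; homogeneity carries
    estimates on it to all vectors. *)
Definition sphere : set V := [set v | euclid2 v = 1].

Lemma euclid2_ge0 v : 0 <= euclid2 v.
Proof. by apply: sumr_ge0 => i _; exact: mul_conjC_ge0. Qed.

Lemma euclid2_eq0 v : (euclid2 v == 0) = (v == 0).
Proof.
apply/eqP/eqP => [|->]; last by rewrite /euclid2 big1// => i _; rewrite mxE mul0r.
move=> /eqP; rewrite psumr_eq0 => [/allP h|i _]; last exact: mul_conjC_ge0.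
apply/rowP => i; rewrite mxE; apply/eqP; rewrite -mul_conjC_eq0.
by apply: h; rewrite mem_index_enum.
Qed.

Lemma euclid2Z c v : euclid2 (c *: v) = c * Num.conj c * euclid2 v.
Proof.
rewrite /euclid2 mulr_sumr; apply: eq_bigr => i _.
by rewrite mxE rmorphM mulrACA.
Qed.

Lemma cont_euclid2 (v : V) : {for v, continuous euclid2}.
Proof.
apply: cont_sum => i; apply: contM; first exact: cont_entry.
by apply: cont_conj; exact: cont_entry.
Qed.

Lemma normalize v : v != 0 -> exists c : C, exists2 u, sphere u & v = c *: u.
Proof.
rewrite -euclid2_eq0 => v0.
pose r := sqrtC (euclid2 v).
have r0 : r != 0 by rewrite sqrtC_eq0.
have rr : Num.conj r^-1 = r^-1.
  by apply: CrealP; apply: ger0_real; rewrite invr_ge0 sqrtC_ge0 euclid2_ge0.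
exists r, (r^-1 *: v); last by rewrite scalerA mulfV// scale1r.
by rewrite /sphere /= euclid2Z rr -invfM -expr2 sqrtCK mulVf.
Qed.

Lemma box_compact (r : R) : compact [set v : V | forall i,
  `|complex.Re (v 0 i)| <= r /\ `|complex.Im (v 0 i)| <= r].
Proof.
exact: (@rV_compact _ _ (fun=> [set c : C | `|complex.Re c| <= r /\ `|complex.Im c| <= r])
  (fun=> @Cplx_square_compact R r)).
Qed.

Lemma entry_bounded (v : V) (r : R) : 0 <= r -> complex.Re (euclid2 v) <= r ^+ 2 ->
  forall i, `|complex.Re (v 0 i)| <= r /\ `|complex.Im (v 0 i)| <= r.
Proof.
move=> r0 hv i.
have : complex.Re (v 0 i * Num.conj (v 0 i)) <= r ^+ 2.
  apply: le_trans hv; rewrite /euclid2 (bigD1 i)//= raddfD /= lerDl.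
  rewrite raddf_sum; apply: sumr_ge0 => j _.
  by have := mul_conjC_ge0 (v 0 j); rewrite lecE => /andP[].
have -> : complex.Re (v 0 i * Num.conj (v 0 i)) =
   complex.Re (v 0 i) ^+ 2 + complex.Im (v 0 i) ^+ 2.
  by case: (v 0 i) => a b /=; rewrite !expr2 mulrN opprK.
move=> h; split; rewrite -(ler_pXn2r (ltn0Sn 1)) ?nnegrE// real_normK ?num_real//.
  by apply: le_trans h; rewrite lerDl sqr_ge0.
by apply: le_trans h; rewrite lerDr sqr_ge0.
Qed.

Lemma euclid_closed_compact (r : R) (A : set V) : closed A ->
  (forall v, A v -> complex.Re (euclid2 v) <= r ^+ 2) -> 0 <= r -> compact A.
Proof.
move=> cA hA r0; apply: (subclosed_compact cA (@box_compact r)) => v /hA.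
exact: entry_bounded.
Qed.

Lemma closed_level (T : topologicalType) (f : T -> C) (c : C) :
  (forall x, {for x, continuous f}) -> closed [set x | f x = c].
Proof.
move=> cf; have -> : [set x | f x = c] = f @^-1` [set c] by apply/seteqP; split.
apply: closed_comp => [x _|]; first exact: cf.
apply: accessible_closed_set1; apply: hausdorff_accessible.
exact: (@norm_hausdorff R[i] (Cplx R)).
Qed.

Lemma sphere_compact : compact sphere.
Proof.
apply: (@euclid_closed_compact 1) => //.
  by apply: closed_level => x; exact: cont_euclid2.
by move=> v /= ->; rewrite expr1n.
Qed.

End Sphere.

(** * Variation of a minimal unitary frame *)

Section SmallParameter.
Context {R : realType}.
Implicit Types (a b c d : R).

Lemma ge0_of_small a M : (forall t, 0 < t <= 1 -> - (M * t) <= a) -> 0 <= a.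
Proof.
move=> h; rewrite leNgt; apply/negP => a0.
have M0 : 0 < M.
  rewrite ltNge; apply/negP => M0; have := h 1; rewrite ltr01 lexx mulr1 => /(_ isT).
  by rewrite leNgt (lt_le_trans a0)// oppr_ge0.
(* With [a < 0], this choice keeps [M * t] at most [- a / 2], which violates the assumed bound. *)
pose t := Num.min 1 (- a / (2 * M)).
have t0 : 0 < t by rewrite lt_min ltr01 divr_gt0 ?oppr_gt0// mulr_gt0.
have /h : 0 < t <= 1 by rewrite t0 ge_min lexx.
apply/negP; rewrite -ltNge ltrNr.
have tM : t <= - a / (2 * M) by rewrite ge_min lexx orbT.
rewrite mulrC -ltr_pdivlMr//; apply: le_lt_trans tM _.
rewrite ltr_pM2l ?oppr_gt0// ltf_pV2 ?posrE ?mulr_gt0//.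
by rewrite ltr_pMl// ltr1n.
Qed.

(** Dividing by [t] near 0 from both sides gives the two signs of [a]; after that, dividing by
    [t ^+ 2] gives the sign of [b]. *)
Lemma quartic_ge0 a b c d :
  (forall t, 0 <= a * t + b * t ^+ 2 + c * t ^+ 3 + d * t ^+ 4) -> a = 0 /\ 0 <= b.
Proof.
move=> h.
have key (x y z w : R) : (forall t, 0 < t <= 1 -> 0 <= x + y * t + z * t ^+ 2 + w * t ^+ 3) -> 0 <= x.
  move=> k; apply: (@ge0_of_small _ (`|y| + `|z| + `|w|)) => t /andP[t0 t1].
  have := k t; rewrite t0 t1 => /(_ isT) {}k.
  have t2 : t ^+ 2 <= t by rewrite expr2 ger_pMl.
  have t3 : t ^+ 3 <= t.
    by rewrite exprS ger_pMr//; apply: le_trans t2 t1.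
  have hy : y * t <= `|y| * t by rewrite ler_pM2r// ler_norm.
  have hz : z * t ^+ 2 <= `|z| * t.
    by apply: le_trans (ler_wpM2l (normr_ge0 z) t2); rewrite ler_wpM2r ?sqr_ge0// ler_norm.
  have hw : w * t ^+ 3 <= `|w| * t.
    apply: le_trans (ler_wpM2l (normr_ge0 w) t3); rewrite ler_wpM2r ?ler_norm//.
    by rewrite exprn_ge0// ltW.
  by lra.
have a0 : 0 <= a.
  apply: (key a b c d) => t /andP[t0 _].
  by rewrite -(pmulr_rge0 _ t0); apply: le_trans (h t) _; rewrite le_eqVlt; apply/orP; left; apply/eqP; ring.
have a1 : 0 <= - a.
  apply: (key (- a) b (- c) d) => t /andP[t0 _].
  by rewrite -(pmulr_rge0 _ t0); apply: le_trans (h (- t)) _; rewrite le_eqVlt; apply/orP; left; apply/eqP; ring.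
have ae : a = 0 by lra.
split=> //; apply: (key b c d 0) => t /andP[t0 _].
rewrite -(pmulr_rge0 _ t0) -(pmulr_rge0 _ t0); apply: le_trans (h t) _.
by rewrite ae le_eqVlt; apply/orP; left; apply/eqP; ring.
Qed.

End SmallParameter.

Lemma Re_realM {R : realType} (x : R) (z : R[i]) : complex.Re (x%:C%C * z) = x * complex.Re z.
Proof. by case: z => a b /=; rewrite mul0r subr0. Qed.

(** * Curvature tensors with the Kähler symmetries, on frames of minimal scalar curvature *)

Section Variation.
Context {R : realType} {V : lmodType R[i]} {k : nat}.
Variables (Rm : V -> V -> V -> V -> R[i]) (ip : V -> V -> R[i]).
Implicit Types (X Y Z W : V) (E : 'I_k -> V) (a : R[i]).
Hypothesis RmD : forall X X' Y Z W, Rm (X + X') Y Z W = Rm X Y Z W + Rm X' Y Z W.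
Hypothesis RmZ : forall a X Y Z W, Rm (a *: X) Y Z W = a * Rm X Y Z W.
Hypothesis Rm_swap : forall X Y Z W, Rm X Y Z W = Rm Z Y X W.
Hypothesis Rm_conj : forall X Y Z W, Num.conj (Rm X Y Z W) = Rm Y X W Z.
Hypothesis ipD : forall X X' Y, ip (X + X') Y = ip X Y + ip X' Y.
Hypothesis ipZ : forall a X Y, ip (a *: X) Y = a * ip X Y.
Hypothesis ip_conj : forall X Y, Num.conj (ip X Y) = ip Y X.
Hypothesis ip_pos : forall X, X != 0 -> 0 < ip X X.

Definition orthonormal_family E : Prop := forall i j, ip (E i) (E j) = (i == j)%:R.
(** The scalar curvature of the span of a unitary frame. *)
Definition scal E : R[i] := \sum_i \sum_j Rm (E i) (E i) (E j) (E j).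

Lemma ipDr X Y Y' : ip X (Y + Y') = ip X Y + ip X Y'.
Proof. by rewrite -ip_conj ipD rmorphD /= !ip_conj. Qed.
Lemma ipZr a X Y : ip X (a *: Y) = Num.conj a * ip X Y.
Proof. by rewrite -ip_conj ipZ rmorphM /= ip_conj. Qed.
Lemma RmD2 X Y Y' Z W : Rm X (Y + Y') Z W = Rm X Y Z W + Rm X Y' Z W.
Proof. by rewrite -Rm_conj RmD rmorphD /= !Rm_conj. Qed.
Lemma RmZ2 a X Y Z W : Rm X (a *: Y) Z W = Num.conj a * Rm X Y Z W.
Proof. by rewrite -Rm_conj RmZ rmorphM /= Rm_conj. Qed.
Lemma RmD3 X Y Z Z' W : Rm X Y (Z + Z') W = Rm X Y Z W + Rm X Y Z' W.
Proof. by rewrite Rm_swap RmD -!(Rm_swap X). Qed.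
Lemma RmZ3 a X Y Z W : Rm X Y (a *: Z) W = a * Rm X Y Z W.
Proof. by rewrite Rm_swap RmZ -(Rm_swap X). Qed.
Lemma RmD4 X Y Z W W' : Rm X Y Z (W + W') = Rm X Y Z W + Rm X Y Z W'.
Proof. by rewrite -Rm_conj RmD3 rmorphD /= !Rm_conj. Qed.
Lemma RmZ4 a X Y Z W : Rm X Y Z (a *: W) = Num.conj a * Rm X Y Z W.
Proof. by rewrite -Rm_conj RmZ3 rmorphM /= Rm_conj. Qed.
(** Conjugation carries the swap of the linear slots to the antilinear ones. The two swaps together
    give [Rm_pair], which identifies Ric_k on the span with [trace_form]. *)
Lemma Rm_swap_conj X Y Z W : Rm X Y Z W = Rm X W Z Y.
Proof. by rewrite -Rm_conj Rm_swap Rm_conj. Qed.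
Lemma Rm_pair X Y Z W : Rm X Y Z W = Rm Z W X Y.
Proof. by rewrite Rm_swap Rm_swap_conj. Qed.

Lemma Rm_real X Y : Num.conj (Rm X X Y Y) = Rm X X Y Y.
Proof. by rewrite Rm_conj. Qed.

Variable E : 'I_k -> V.
Hypothesis orthoE : orthonormal_family E.
Hypothesis minE : forall E', orthonormal_family E' ->
  complex.Re (scal E) <= complex.Re (scal E').

(** The polarised form of A: its values at [Z] and [E j] carry the first variation. *)
Definition trace_form Z W : R[i] := \sum_i Rm (E i) (E i) Z W.

Lemma real_conj (t : R) : Num.conj ((t%:C)%C : R[i]) = (t%:C)%C.
Proof. exact: conjc_real. Qed.

(** Grouping terms by how often the replaced vector occurs leaves only [r ^+ 2] and [r ^+ 4], so the
    square root in the normalisation disappears. *)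
Lemma scal_replace (j : 'I_k) (v : V) (r : R) :
  scal (fun i => if i == j then (r%:C)%C *: v else E i) =
  \sum_(i | i != j) \sum_(l | l != j) Rm (E i) (E i) (E l) (E l)
  + 2 * (r ^+ 2)%:C%C * (\sum_(i | i != j) Rm (E i) (E i) v v)
  + (r ^+ 4)%:C%C * Rm v v v v.
Proof.
rewrite /scal (bigD1 j)//= eqxx (bigD1 j)//= eqxx.
rewrite RmZ RmZ2 RmZ3 RmZ4 real_conj.
rewrite (eq_bigr (fun l => (r ^+ 2)%:C%C * Rm (E l) (E l) v v)); last first.
  move=> l /negbTE ->; rewrite RmZ RmZ2 real_conj Rm_pair mulrA.
  by rewrite -rmorphM -expr2.
rewrite -mulr_sumr.
rewrite [X in _ + X](eq_bigr (fun i => (r ^+ 2)%:C%C * Rm (E i) (E i) v v +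
   \sum_(l | l != j) Rm (E i) (E i) (E l) (E l))); last first.
  move=> i /negbTE ->; rewrite (bigD1 j)//= eqxx RmZ3 RmZ4 real_conj mulrA.
  rewrite -rmorphM -expr2; congr (_ + _).
  by apply: eq_bigr => l /negbTE ->.
rewrite big_split -mulr_sumr /=.
have -> : ((r ^+ 4)%:C%C : R[i]) = r%:C%C * r%:C%C * r%:C%C * r%:C%C.
  by rewrite -!rmorphM /= !exprS expr0 mulr1 !mulrA.
move: (\sum_(i | _) Rm _ _ v v) (\sum_(i | _) \sum_(l | _) _) ((r ^+ 2)%:C%C) (r%:C%C)
  (Rm v v v v) => B S r2 r1 H; ring.
Qed.

(* Compare [E] with the frame in which [E j] is replaced by the normalisation of
   [E j + t Z]: the coefficients of [t] and [t ^+ 2] give the two claims. *)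
Lemma first_second_variation (j : 'I_k) Z :
  (forall i, ip Z (E i) = 0) ->
  complex.Re (trace_form Z (E j)) = 0 /\
  0 <= complex.Re (trace_form Z Z + Rm (E j) (E j) Z Z + Rm Z (E j) Z (E j)
     - ip Z Z * trace_form (E j) (E j)).
Proof.
move=> hZ; pose e := E j.
have ee : ip e e = 1 by rewrite orthoE eqxx.
have eZ i : ip (E i) Z = 0 by rewrite -ip_conj hZ conjC0.
pose N := complex.Re (ip Z Z).
have NE : ip Z Z = N%:C%C.
  by rewrite /N RRe_real//; apply/CrealP; exact: ip_conj.
have N0 : 0 <= N.
  have [Z0|/ip_pos] := eqVneq Z 0; last by rewrite NE ltcR => /ltW.
  by rewrite /N {1}Z0 -(scale0r (0 : V)) ipZ mul0r.
pose B X := \sum_(i | i != j) Rm (E i) (E i) X X.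
pose b := \sum_(i | i != j) Rm (E i) (E i) Z e.
have Bv t : B (e + t%:C%C *: Z) = B e + t%:C%C * (b + Num.conj b) + (t ^+ 2)%:C%C * B Z.
  rewrite /B /b rmorph_sum /= !mulrDr !mulr_sumr -!big_split /=; apply: eq_bigr => i _.
  rewrite RmD3 !RmD4 RmZ3 RmZ3 !RmZ4 real_conj Rm_conj rmorphXn /=.
  by move: (Rm _ _ _ _) (Rm _ _ _ _) (Rm _ _ _ _) (Rm _ _ _ _) => *; ring.
pose h1 := Rm e e Z e.
pose h3 := Rm e Z Z Z.
have Hv t : let v := e + t%:C%C *: Z in Rm v v v v =
   Rm e e e e + 2 * t%:C%C * (h1 + Num.conj h1)
   + (t ^+ 2)%:C%C * (4 * Rm e e Z Z + (Rm Z e Z e + Num.conj (Rm Z e Z e)))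
   + 2 * (t ^+ 3)%:C%C * (h3 + Num.conj h3) + (t ^+ 4)%:C%C * Rm Z Z Z Z.
  rewrite /= RmD !RmD2 !RmD3 !RmD4 !RmZ !RmZ2 !RmZ3 !RmZ4 !real_conj.
  rewrite /h1 /h3 !Rm_conj.
  rewrite (Rm_swap Z e e e) (Rm_swap_conj e Z e e) (Rm_swap Z e e Z) (Rm_swap_conj e Z Z e).
  rewrite (Rm_pair Z Z e e) (Rm_swap_conj Z Z Z e) (Rm_swap Z Z e Z) !rmorphXn /=.
  rewrite (Rm_swap_conj Z e Z Z).
  by move: (Rm e e e e) (Rm e e Z e) (Rm e e e Z) (Rm e e Z Z) (Rm Z e Z e) (Rm e Z e Z)
    (Rm e Z Z Z) (Rm Z Z Z e) (Rm Z Z Z Z) => *; ring.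
have Re2 (z : R[i]) : complex.Re (2 * z) = 2 * complex.Re z.
  by rewrite !mulr_natl raddfMn.
have Re4 (z : R[i]) : complex.Re (4 * z) = 4 * complex.Re z.
  by rewrite !mulr_natl raddfMn.
have ReC (z : R[i]) : complex.Re (z + Num.conj z) = 2 * complex.Re z.
  by case: z => x y /=; ring.
(* These are the coefficients of the difference of the two scalar curvatures multiplied by the
   square of [d = 1 + t ^+ 2 * N], the squared norm of [E j + t Z]; this clears the
   normalisation. *)
have [|lin quad] := @quartic_ge0 R (4 * complex.Re b + 4 * complex.Re h1)
  (2 * complex.Re (B Z) + 4 * complex.Re (Rm e e Z Z) + 2 * complex.Re (Rm Z e Z e)
     - 2 * N * (complex.Re (B e) + complex.Re (Rm e e e e)))
  (4 * N * complex.Re b + 4 * complex.Re h3)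
  (2 * N * complex.Re (B Z) + complex.Re (Rm Z Z Z Z)
     - N ^+ 2 * (2 * complex.Re (B e) + complex.Re (Rm e e e e))).
  move=> t; pose d := 1 + t ^+ 2 * N.
  have d0 : 0 < d by rewrite ltr_pwDl// mulr_ge0// sqr_ge0.
  pose r := (Num.sqrt d)^-1.
  have r2 : r ^+ 2 = d^-1 by rewrite exprVn sqr_sqrtr// ltW.
  pose v := e + t%:C%C *: Z.
  have vv : ip v v = d%:C%C.
    rewrite /v ipD !ipDr !ipZ !ipZr ee eZ hZ real_conj NE /d !(mulr0, addr0, add0r).
    by rewrite rmorphD rmorphM rmorphXn rmorph1 /= expr2 mulrA.
  have vE i : i != j -> ip v (E i) = 0.
    move=> ij; rewrite /v ipD ipZ hZ mulr0 addr0 orthoE eq_sym (negbTE ij) //.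
  have Ev i : i != j -> ip (E i) v = 0 by move=> ij; rewrite -ip_conj vE// conjC0.
  have := @minE (fun i => if i == j then r%:C%C *: v else E i).
  (* Writing [E] itself as a replaced frame with [r = 1] lets [scal_replace] expand both sides, and
     their common part cancels. *)
  have -> : scal E = scal (fun i => if i == j then (1%:C)%C *: e else E i).
    by congr scal; apply/funext => i; case: eqVneq => // ->; rewrite scale1r.
  rewrite !scal_replace -/(B e) -/(B v).
  have orth : orthonormal_family (fun i => if i == j then r%:C%C *: v else E i).
    move=> i l; case: (eqVneq i j) => [->|ij]; case: (eqVneq l j) => [lE|lj].
    - rewrite ipZ ipZr real_conj vv -!rmorphM /= mulrA -expr2 r2 mulVf//.
      by rewrite gt_eqF.
    - by rewrite ipZ vE// mulr0.
    - by rewrite ipZr Ev// mulr0 lE (negbTE ij).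
    - exact: orthoE.
  have RB : complex.Re (B v) = complex.Re (B e) + t * (2 * complex.Re b)
      + t ^+ 2 * complex.Re (B Z).
    by rewrite Bv 2!raddfD /= !Re_realM ReC.
  have RH : complex.Re (Rm v v v v) = complex.Re (Rm e e e e)
      + 2 * (t * (2 * complex.Re h1))
      + t ^+ 2 * (4 * complex.Re (Rm e e Z Z) + 2 * complex.Re (Rm Z e Z e))
      + 2 * (t ^+ 3 * (2 * complex.Re h3)) + t ^+ 4 * complex.Re (Rm Z Z Z Z).
    rewrite (Hv t) 4!raddfD /= -!mulrA !Re2 !Re_realM !ReC.
    by rewrite [X in t ^+ 2 * X]raddfD /= Re4 ReC; ring.
  have expand (x y z : R[i]) (p : R) : complex.Re (x + 2 * (p ^+ 2)%:C%C * y + (p ^+ 4)%:C%C * z) =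
      complex.Re x + 2 * (p ^+ 2 * complex.Re y) + p ^+ 2 ^+ 2 * complex.Re z.
    by rewrite 2!raddfD /= -(mulrA 2) Re2 !Re_realM -exprM.
  move=> /(_ orth); rewrite !expand RB RH r2 !expr1n !mul1r.
  move: (complex.Re (B e)) (complex.Re (B Z)) (complex.Re b) (complex.Re h1)
    (complex.Re h3) (complex.Re (Rm e e e e)) (complex.Re (Rm e e Z Z))
    (complex.Re (Rm Z e Z e)) (complex.Re (Rm Z Z Z Z)) => B0 B2 b1 g1 g3 H0 q s H4.
  rewrite -!addrA lerD2l -subr_ge0 -(pmulr_lge0 _ (exprn_gt0 2 d0)).
  move=> ineq; apply: le_trans ineq _; rewrite le_eqVlt; apply/orP; left; apply/eqP.
  rewrite /d; field.
  by rewrite -/d gt_eqF.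
have tfE W : trace_form W W = Rm e e W W + B W.
  by rewrite /trace_form (bigD1 j).
split.
  rewrite /trace_form (bigD1 j)//= raddfD /=; move: lin.
  rewrite -/e -/b -/h1 => lin; lra.
rewrite -/e NE !tfE raddfB /= Re_realM !raddfD /=; lra.
Qed.

(** The first variation along [Z] kills the real part, and along ['i *: Z] the imaginary part. *)
Lemma cross_variation (j : 'I_k) Z : (forall i, ip Z (E i) = 0) -> trace_form Z (E j) = 0.
Proof.
move=> hZ; have [h _] := first_second_variation j hZ.
have hiZ i : ip ('i%C *: Z) (E i) = 0 by rewrite ipZ hZ mulr0.
have [] := first_second_variation j hiZ.
have -> : trace_form ('i%C *: Z) (E j) = 'i%C * trace_form Z (E j).
  by rewrite /trace_form mulr_sumr; apply: eq_bigr => i _; rewrite RmZ3.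
move=> h' _; apply/eqP; rewrite eq_complex; apply/andP; split; first exact/eqP.
by move: h'; case: (trace_form Z (E j)) => x y /=; rewrite mul0r mul1r sub0r => /eqP; rewrite oppr_eq0.
Qed.

(* Averaging over [Z] and ['i *: Z] removes [Rm Z (E j) Z (E j)]. *)
Lemma trace_form_perp_ge (j : 'I_k) Z : (forall i, ip Z (E i) = 0) ->
  ip Z Z * trace_form (E j) (E j) <= trace_form Z Z + Rm (E j) (E j) Z Z.
Proof.
move=> hZ; have [_ h] := first_second_variation j hZ.
have hiZ i : ip ('i%C *: Z) (E i) = 0 by rewrite ipZ hZ mulr0.
have [_] := first_second_variation j hiZ.
have ii : 'i%C * Num.conj 'i%C = 1 :> R[i] by rewrite conj_i mulrN -expr2 sqr_i opprK.
have -> : trace_form ('i%C *: Z) ('i%C *: Z) = trace_form Z Z.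
  by apply: eq_bigr => i _; rewrite RmZ3 RmZ4 mulrA ii mul1r.
rewrite RmZ3 RmZ4 RmZ RmZ3 ipZ ipZr !mulrA ii !mul1r -expr2 sqr_i mulN1r => h'.
have : 0 <= complex.Re (trace_form Z Z + Rm (E j) (E j) Z Z - ip Z Z * trace_form (E j) (E j)).
  move: h h'; rewrite !raddfB !raddfD /= ?raddfN /=; lra.
have tr W : Num.conj (trace_form W W) = trace_form W W.
  by rewrite /trace_form rmorph_sum; apply: eq_bigr => i _; exact: Rm_conj.
rewrite -ler0c RRe_real ?subr_ge0//; apply/CrealP.
by rewrite rmorphB rmorphD rmorphM /= !tr Rm_real ip_conj.
Qed.

Hypothesis ric_pos : forall X, X != 0 -> (exists x : 'I_k -> R[i], X = \sum_i x i *: E i) ->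
  0 < \sum_i Rm X X (E i) (E i).
Hypothesis k_gt0 : (0 < k)%N.

Lemma trace_form_span_gt0 X : X != 0 -> (exists x : 'I_k -> R[i], X = \sum_i x i *: E i) ->
  0 < trace_form X X.
Proof.
move=> X0 hX; have := ric_pos X0 hX.
by rewrite (eq_bigr (fun i => Rm (E i) (E i) X X))// => i _; exact: Rm_pair.
Qed.

(** In the sum of [trace_form_perp_ge] over [j], the terms [Rm (E j) (E j) Z Z] make up one more
    [trace_form Z Z], whence the factor [k.+1]. The left side is positive because each [E j] lies in
    the span. *)
Lemma trace_form_perp_gt0 Z : (forall i, ip Z (E i) = 0) -> Z != 0 -> 0 < trace_form Z Z.
Proof.
move=> hZ Z0.
have S0 : 0 < \sum_j trace_form (E j) (E j).
  have pos j : 0 < trace_form (E j) (E j).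
    apply: trace_form_span_gt0.
      apply/eqP => E0; have := orthoE j j; rewrite eqxx E0 -(scale0r (0 : V)) ipZ mul0r.
      by move/eqP; rewrite eq_sym oner_eq0.
    exists (fun i => (i == j)%:R); rewrite (bigD1 j)//= eqxx scale1r big1 ?addr0//.
    by move=> i /negbTE ->; rewrite scale0r.
  rewrite (bigD1 (Ordinal k_gt0))//=; apply: ltr_pwDl; first exact: pos.
  by apply: sumr_ge0 => j _; exact: ltW.
have : ip Z Z * \sum_j trace_form (E j) (E j) <= (k.+1)%:R * trace_form Z Z.
  rewrite mulr_sumr; apply: le_trans (ler_sum _ (fun j _ => trace_form_perp_ge j hZ)) _.
  by rewrite big_split /= sumr_const card_ord -/(trace_form Z Z) mulr_natl mulrSr.
move=> h; have : 0 < (k.+1)%:R * trace_form Z Z.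
  by apply: lt_le_trans h; rewrite mulr_gt0// ip_pos.
by rewrite pmulr_rgt0// ltr0n.
Qed.

(** [cross_variation] makes the span and its orthogonal complement orthogonal for [trace_form] too,
    so positivity on each of them adds up. *)
Lemma trace_form_gt0 Z : Z != 0 -> 0 < trace_form Z Z.
Proof.
move=> Z0; pose P := \sum_i ip Z (E i) *: E i; pose Q := Z - P.
have hQ i : ip Q (E i) = 0.
  rewrite /Q ipD -scaleN1r ipZ mulN1r.
  have -> : ip P (E i) = ip Z (E i); last by rewrite subrr.
  have ipS (r : seq 'I_k) (f : 'I_k -> V) W : ip (\sum_(j <- r) f j) W = \sum_(j <- r) ip (f j) W.
    elim: r => [|a r IH]; last by rewrite !big_cons ipD IH.
    by rewrite !big_nil -(scale0r (0 : V)) ipZ mul0r.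
  rewrite /P ipS (bigD1 i)//= ipZ orthoE eqxx mulr1 big1 ?addr0// => j ji.
  by rewrite ipZ orthoE (negbTE ji) mulr0.
have tS (r : seq 'I_k) (f : 'I_k -> V) W : trace_form W (\sum_(j <- r) f j) = \sum_(j <- r) trace_form W (f j).
  elim: r => [|a r IH]; last first.
    rewrite !big_cons -IH /trace_form -big_split; apply: eq_bigr => i _; exact: RmD4.
  rewrite !big_nil /trace_form big1// => i _.
  by rewrite -(scale0r (0 : V)) RmZ4 conjC0 mul0r.
have QP : trace_form Q P = 0.
  rewrite /P tS big1// => i _.
  have -> : trace_form Q (ip Z (E i) *: E i) = Num.conj (ip Z (E i)) * trace_form Q (E i).
    by rewrite /trace_form mulr_sumr; apply: eq_bigr => l _; rewrite RmZ4.
  by rewrite cross_variation// mulr0.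
have PQ : trace_form P Q = 0.
  have -> : trace_form P Q = Num.conj (trace_form Q P).
    by rewrite /trace_form rmorph_sum; apply: eq_bigr => i _; rewrite /= Rm_conj.
  by rewrite QP conjC0.
have -> : trace_form Z Z = trace_form P P + trace_form Q Q.
  have ZE : Z = P + Q by rewrite /Q addrC subrK.
  have : trace_form Z Z = trace_form P P + trace_form Q P + (trace_form P Q + trace_form Q Q).
    rewrite /trace_form -!big_split; apply: eq_bigr => i _ /=.
    by rewrite {1 2}ZE RmD4 !RmD3.
  by rewrite QP PQ addr0 add0r.
have Pspan : exists x : 'I_k -> R[i], P = \sum_i x i *: E i by exists (fun i => ip Z (E i)).
have [P0|P0] := eqVneq P 0.
  have Q0 : Q != 0 by rewrite /Q P0 subr0.
  rewrite P0 (_ : trace_form 0 0 = 0) ?add0r; first exact: trace_form_perp_gt0.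
  by rewrite /trace_form big1// => i _; rewrite -(scale0r (0 : V)) RmZ3 mul0r.
have [Q0|Q0] := eqVneq Q 0.
  rewrite Q0 (_ : trace_form 0 0 = 0) ?addr0; first exact: trace_form_span_gt0.
  by rewrite /trace_form big1// => i _; rewrite -(scale0r (0 : V)) RmZ3 mul0r.
by rewrite addr_gt0//; [exact: trace_form_span_gt0|exact: trace_form_perp_gt0].
Qed.

End Variation.

(** * Positive frames in a fibre *)

Section HermitianForm.
Context {R : realType} {n : nat}.
Notation C := (Cplx R).
Notation V := (Cspace R n).
Implicit Types (G : 'M[C]_n) (u v w : V) (a : R[i]).

Lemma hformDl G u v w : hform G (u + v) w = hform G u w + hform G v w.
Proof. by rewrite /hform !mulmxDl mxE. Qed.

Lemma hformZl G a u v : hform G (a *: u) v = a * hform G u v.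
Proof. by rewrite /hform -!scalemxAl mxE. Qed.

Lemma hformZr G a u v : hform G u (a *: v) = Num.conj a * hform G u v.
Proof. by rewrite /hform adjmxZ -scalemxAr mxE. Qed.

Lemma hform_conj G u v : Num.conj (hform G u v) = hform (adjmx G) v u.
Proof.
transitivity (adjmx (u *m G *m adjmx v) 0 0); first by rewrite [RHS]mxE [in RHS]mxE.
by rewrite !adjmxM adjmxK mulmxA.
Qed.

Lemma hform_coef_sum (I J : finType) (c : I -> J -> R[i]) (G : I -> J -> 'M[C]_n) u v :
  hform (\sum_i \sum_j c i j *: G i j) u v = \sum_i \sum_j c i j * hform (G i j) u v.
Proof.
rewrite /hform mulmx_sumr mulmx_suml summxE; apply: eq_bigr => i _.
rewrite mulmx_sumr mulmx_suml summxE; apply: eq_bigr => j _.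
by rewrite -scalemxAr -scalemxAl mxE.
Qed.

End HermitianForm.

Section Fibre.
Context {R : realType} {n : nat}.
Notation C := (Cplx R).
Notation V := (Cspace R n).
Variables (G : 'M[C]_n).
Hypotheses (hermG : adjmx G = G) (posG : forall v : V, v != 0 -> 0 < hform G v v).

Lemma hform_herm_conj (u v : V) : Num.conj (hform G u v) = hform G v u.
Proof. by rewrite hform_conj hermG. Qed.

(** The [k] conditions form an [n] by [k] matrix, of rank below [n], so its left kernel is
    nonzero. *)
Lemma exists_orthogonal k (E : 'I_k -> V) : (k < n)%N ->
  exists2 Z : V, Z != 0 & forall i, hform G Z (E i) = 0.
Proof.
move=> kn; pose A := G *m \matrix_(l < n, i < k) Num.conj (E i 0 l).
have : kermx A != 0.
  rewrite -mxrank_eq0 mxrank_ker subn_eq0 -ltnNge.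
  by apply: leq_ltn_trans kn; exact: rank_leq_col.
case/rowV0Pn => Z /sub_kermxP ZA Z0; exists Z => // i.
transitivity ((Z *m A) 0 i); last by rewrite ZA mxE.
rewrite /A mulmxA /hform !mxE; apply: eq_bigr => l _; by rewrite !mxE.
Qed.

Lemma exists_unit (Z : V) : Z != 0 -> exists2 a : C, a != 0 & hform G (a *: Z) (a *: Z) = 1.
Proof.
move=> Z0; pose r := sqrtC (hform G Z Z).
have p := posG Z0.
have r0 : r != 0 by rewrite sqrtC_eq0 gt_eqF.
have rr : Num.conj r^-1 = r^-1.
  by apply: CrealP; apply: ger0_real; rewrite invr_ge0 sqrtC_ge0 ltW.
exists r^-1; first by rewrite invr_eq0.
by rewrite hformZl hformZr rr mulrA -invfM -expr2 sqrtCK mulVf// gt_eqF.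
Qed.

Lemma exists_orthonormal k : (k <= n)%N ->
  exists E : 'I_k -> V, orthonormal_family (hform G) E.
Proof.
elim: k => [_|k IH kn]; first by exists (fun=> 0) => -[].
have [E hE] := IH (ltnW kn).
have [Z Z0 hZ] := exists_orthogonal E kn.
have [a a0 ha] := exists_unit Z0.
have hZ' i : hform G (a *: Z) (E i) = 0 by rewrite hformZl hZ mulr0.
exists (fun i => if unlift ord_max i is Some j then E j else a *: Z) => i j.
case: (unliftP ord_max i) => [i'|] ->; case: (unliftP ord_max j) => [j'|] ->.
- by rewrite hE (inj_eq lift_inj).
- by rewrite -hform_herm_conj hZ' conjC0 eq_sym (negbTE (neq_lift _ _)).
- by rewrite hZ' (negbTE (neq_lift _ _)).
- by rewrite ha eqxx.
Qed.

Lemma hform_sphere_lower : exists2 m : R, 0 < m &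
  forall v : V, (m%:C)%C * euclid2 v <= hform G v v.
Proof.
(* An empty sphere means that every vector is 0; otherwise the minimum of the form on the sphere is
   the constant. *)
have [v0|/set0P s0] := eqVneq (@sphere R n) set0.
  exists 1 => // v; have [->|/normalize[c [u su]]] := eqVneq v 0.
    by rewrite (eqP (_ : euclid2 0 == 0)) ?euclid2_eq0// mulr0 /hform !mul0mx mxE.
  by move: su; rewrite v0.
have cf v : {for v, continuous (fun v : V => complex.Re (hform G v v))}.
  apply: cont_Re; apply: (@cont_hform _ _ _ (fun=> G) id id) => *; first exact: cont_cst.
    exact: cont_entry.
  exact: cont_entry.
have [u /set_mem su hu] := compact_EVT_min s0 sphere_compact (continuous_subspaceT cf).
have u0 : u != 0 by rewrite -euclid2_eq0 su oner_eq0.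
have hr v : hform G v v = ((complex.Re (hform G v v))%:C)%C.
  by rewrite RRe_real//; apply/CrealP; exact: hform_herm_conj.
have p : 0 < complex.Re (hform G u u) by rewrite -ltcR -hr; exact: posG.
exists (complex.Re (hform G u u)) => // v.
have [->|/normalize[c [w sw ->]]] := eqVneq v 0.
  by rewrite (eqP (_ : euclid2 0 == 0)) ?euclid2_eq0// mulr0 /hform !mul0mx mxE.
rewrite euclid2Z sw mulr1 hformZl hformZr [leLHS]mulrC [leRHS]mulrA.
rewrite ler_wpM2l ?mul_conjC_ge0// [in leRHS]hr lecR; apply: hu; exact/mem_set.
Qed.

Lemma hform_sphere_compact : compact [set v : V | hform G v v = 1].
Proof.
have [m m0 hm] := hform_sphere_lower.
have r0 : 0 <= Num.sqrt m^-1 by exact: sqrtr_ge0.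
apply: euclid_closed_compact r0.
  apply: closed_level => v.
  apply: (@cont_hform _ _ _ (fun=> G) id id) => *; first exact: cont_cst.
    exact: cont_entry.
  exact: cont_entry.
move=> v /= hv; rewrite sqr_sqrtr ?invr_ge0 ?(ltW m0)//.
have := hm v; rewrite hv lecE Re_realM => /andP[_ h].
by rewrite -[m^-1]mul1r ler_pdivlMr// mulrC.
Qed.

Variables (k : nat) (c : 'I_n -> 'I_n -> 'M[C]_n).
Hypothesis kn : (0 < k <= n)%N.

Let Rm (X Y Z W : V) : C :=
  \sum_i \sum_j X 0 i * Num.conj (Y 0 j) * hform (c i j) Z W.
Hypothesis Rm_swap : forall X Y Z W, Rm X Y Z W = Rm Z Y X W.
Hypothesis Rm_conj : forall X Y Z W, Num.conj (Rm X Y Z W) = Rm Y X W Z.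
Hypothesis ric_pos : forall E : 'I_k -> V, orthonormal_family (hform G) E ->
  forall X, X != 0 -> (exists x : 'I_k -> R[i], X = \sum_i x i *: E i) ->
  0 < \sum_i Rm X X (E i) (E i).

(** Orthonormal families form a closed subset of a product of compact unit spheres, so the
    continuous function [scal] has a minimiser, to which [trace_form_gt0] applies. *)
Lemma exists_positive_frame : exists E : 'I_k -> V,
  forall Z, Z != 0 -> 0 < \sum_i Rm (E i) (E i) Z Z.
Proof.
have [k0 kn'] := andP kn.
pose T := prod_topology (fun _ : 'I_k => V).
pose St : set T := [set E : T | orthonormal_family (hform G) E].
have [E0 hE0] := exists_orthonormal kn'.
have cE (E : T) i l : {for E, continuous (fun F : T => F i 0 l)}.
  apply: (@cvg_comp _ _ _ (fun F : T => F i) (fun v : V => v 0 l : C)).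
    exact: (@proj_continuous _ (fun _ : 'I_k => V) i E).
  exact: cont_entry.
have Stc : compact St.
  apply: (subclosed_compact (B := [set E : T | forall i, [set v : V | hform G v v = 1] (E i)])).
  - have -> : St = \bigcap_(ij in [set: 'I_k * 'I_k])
        [set E : T | hform G (E ij.1) (E ij.2) = (ij.1 == ij.2)%:R].
      by apply/seteqP; split=> [E hE [i j] _|E hE i j]; [exact: hE|exact: (hE (i, j))].
    apply: closed_bigI => -[i j] _; apply: closed_level => E.
    apply: (@cont_hform _ _ _ (fun=> G) (fun F : T => F i) (fun F : T => F j)) => *.
    + exact: cont_cst.
    + exact: cE.
    + exact: cE.
  - exact: (@tychonoff _ (fun _ : 'I_k => V) (fun=> [set v : V | hform G v v = 1])
      (fun=> hform_sphere_compact)).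
  - by move=> E hE i /=; rewrite hE eqxx.
have cS (E : T) : {for E, continuous (fun F : T => complex.Re (scal Rm F))}.
  apply: cont_Re; apply: cont_sum => i; apply: cont_sum => j.
  apply: cont_sum => l; apply: cont_sum => m; apply: contM.
    by apply: contM; [exact: cE|apply: cont_conj; exact: cE].
  apply: (@cont_hform _ _ _ (fun=> c l m) (fun F : T => F j) (fun F : T => F j)) => *.
  + exact: cont_cst.
  + exact: cE.
  + exact: cE.
have [E /set_mem hE minE] := compact_EVT_min (ex_intro _ _ hE0 : St !=set0) Stc (continuous_subspaceT cS).
exists E => Z Z0.
apply: (@trace_form_gt0 _ _ _ Rm (hform G)) => //.
- move=> X X' Y U W; rewrite /Rm -big_split; apply: eq_bigr => i _.
  by rewrite -big_split; apply: eq_bigr => j _; rewrite mxE !mulrDl.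
- move=> a X Y U W; rewrite /Rm mulr_sumr; apply: eq_bigr => i _.
  by rewrite mulr_sumr; apply: eq_bigr => j _; rewrite mxE !mulrA.
- by move=> X X' Y; exact: hformDl.
- by move=> a X Y; exact: hformZl.
- exact: hform_herm_conj.
- by move=> E' hE'; apply: minE; exact/mem_set.
- exact: ric_pos.
Qed.

End Fibre.

(** * Uniform pinching on a compact manifold *)

(** Otherwise the sets where [Q r] fails, directed by monotonicity in [r], generate a proper filter,
    and the local hypothesis fails at its cluster point. [P] lets the global [r] keep a property of
    the local ones: positivity of a pinching constant, or being an attained ratio. *)
Lemma compact_local_to_global (R : realType) (T : topologicalType)
    (P : R -> Prop) (Q : R -> T -> Prop) :
  compact [set: T] ->
  (forall r r' x, r <= r' -> Q r x -> Q r' x) -> (exists r, P r) ->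
  (forall x : T, exists2 r, P r & \forall y \near x, Q r y) ->
  exists2 r, P r & forall x, Q r x.
Proof.
move=> cT mono [r0 Pr0] loc; apply: contrapT => no.
pose F : set_system T := [set B | exists2 r, P r & [set y | ~ Q r y] `<=` B].
have FF : ProperFilter F.
  apply: Build_ProperFilter.
    by move=> [r Pr hr]; apply: no; exists r => // x; apply: contrapT => /hr.
  constructor.
  - by exists r0.
  - move=> A B [r Pr hA] [r' Pr' hB]; have [rr|rr] := leP r r'.
      by exists r' => // y ny; split; [apply: hA => /(mono _ _ _ rr)|exact: hB].
    by exists r => // y ny; split; [exact: hA|apply: hB => /(mono _ _ _ (ltW rr))].
  - by move=> A B AB [r Pr hA]; exists r => // y /hA /AB.
have [x [_ cx]] := cT F FF filterT.
have [r Pr nr] := loc x.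
have Fr : F [set y | ~ Q r y] by exists r.
by have [y [ny yQ]] := cx _ _ Fr nr; apply: ny.
Qed.

Lemma sum_mul_delta (A : nzRingType) k (c : 'I_k -> A) (i : 'I_k) :
  \sum_j c j * (j == i)%:R = c i.
Proof.
rewrite (bigD1 i)//= eqxx mulr1 big1 ?addr0// => j /negbTE ->.
by rewrite mulr0.
Qed.

(** The factor 4 absorbs a doubling of [f0] and a halving of [g0] on a neighbourhood. *)
Lemma double_halve_lt (F : realFieldType) (f0 g0 f g c : F) :
  0 < c -> 4 * f0 <= c * g0 -> f < 2 * f0 -> g0 / 2 < g -> f < c * g.
Proof.
move=> c0 h hf hg; have : c * (g0 / 2) < c * g by rewrite ltr_pM2l.
by rewrite mulrA; lra.
Qed.

Section Manifold.
Context {R : realType} {n : nat} {M : complex_manifold R n}.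
Variable h : hermitian_metric M.
Notation C := (Cplx R).
Notation V := (Cspace R n).
Implicit Types (a b : chart_index M) (x y : M).

Definition image_of a : set V := Defs.coord (atlas a) @` domain a.
Notation H a := (local a (gram h a)).

Lemma image_open a : open (image_of a). Proof. exact: coord_open. Qed.

Lemma image_of_coord a x : domain a x -> image_of a (Defs.coord (atlas a) x).
Proof. by exists x. Qed.

Lemma param_coord a x : domain a x -> param (atlas a) (Defs.coord (atlas a) x) = x.
Proof. exact: coordK. Qed.

Lemma param_domain a z : image_of a z ->
  domain a (param (atlas a) z) /\ Defs.coord (atlas a) (param (atlas a) z) = z.
Proof. by move=> [x dx <-]; rewrite param_coord. Qed.

Lemma gram_local a x : domain a x -> gram h a x = H a (Defs.coord (atlas a) x).
Proof. by move=> dx; rewrite /local /= param_coord. Qed.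

Lemma gram_local_smooth a k l : smooth_on (image_of a) (fun z => H a z k l).
Proof. exact: gram_smooth. Qed.

Lemma gram_local_herm a z : image_of a z -> adjmx (H a z) = H a z.
Proof. by case/param_domain => dz _; exact: gram_hermitian. Qed.

Lemma gram_unit a x : domain a x -> gram h a x \in unitmx.
Proof. by move=> dx; apply: posdef_unit; exact: gram_pos dx. Qed.

Lemma gram_local_unit a z : image_of a z -> H a z \in unitmx.
Proof. by case/param_domain => dz _; exact: gram_unit. Qed.

Definition curv a x (X Y : V) : 'M[C]_n := curv_mx (H a) X Y (Defs.coord (atlas a) x).

Lemma chern_curvatureE a x X Y Z W : domain a x ->
  chern_curvature h a x X Y Z W = hform (curv a x X Y) Z W.
Proof.
move=> dx; rewrite /chern_curvature /hform (gram_local dx).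
rewrite (curvature_endoE (@image_open a) (@gram_local_smooth a) (@gram_local_unit a))//.
exact: image_of_coord.
Qed.

Lemma curv_adj a x X Y : domain a x -> adjmx (curv a x X Y) = curv a x Y X.
Proof.
move=> dx; apply: (curv_mx_adj (@image_open a) (@gram_local_smooth a)
  (@gram_local_herm a) (@gram_local_unit a)).
exact: image_of_coord.
Qed.

Lemma curv_hform_coef a x X Y Z W : domain a x ->
  hform (curv a x X Y) Z W = \sum_i \sum_j X 0 i * Num.conj (Y 0 j) *
    hform (curv_coef (H a) i j (Defs.coord (atlas a) x)) Z W.
Proof.
move=> dx; rewrite /curv (curv_mx_coef (@image_open a) (@gram_local_smooth a)).
  exact: hform_coef_sum.
exact: image_of_coord.
Qed.

Lemma unitary_basis_of a x k (E : 'I_k -> V) : domain a x ->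
  orthonormal_family (hform (gram h a x)) E ->
  unitary_basis h a x <<[tuple E i | i < k]>>%VS [tuple E i | i < k] /\
  \dim <<[tuple E i | i < k]>>%VS = k.
Proof.
move=> dx oE.
have fr : free [tuple E i | i < k].
  apply/freeP => c c0 i.
  have : hform (gram h a x) (\sum_j c j *: [tuple E i | i < k]`_j) (E i) = 0.
    by rewrite c0 /hform !mul0mx mxE.
  have -> : \sum_j c j *: [tuple E i | i < k]`_j = \sum_j c j *: E j.
    by apply: eq_bigr => j _; rewrite -tnth_nth tnth_mktuple.
  have S (r : seq 'I_k) (f : 'I_k -> V) W : hform (gram h a x) (\sum_(j <- r) f j) W =
     \sum_(j <- r) hform (gram h a x) (f j) W.
    elim: r => [|j r IH]; last by rewrite !big_cons hformDl IH.
    by rewrite !big_nil /hform !mul0mx mxE.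
  rewrite S => e; rewrite -(sum_mul_delta c i) -[RHS]e; apply: eq_bigr => j _.
  by rewrite hformZl oE.
split; last by move: fr; rewrite /free size_tuple => /eqP.
split; first by rewrite /basis_of eqxx.
by move=> i j; rewrite !tnth_mktuple; exact: oE.
Qed.

Lemma cont_local a (f : V -> C) x : domain a x -> smooth_on (image_of a) f ->
  {for x, continuous (fun y : M => f (Defs.coord (atlas a) y))}.
Proof.
move=> dx sf; apply: continuous_comp; first exact: coord_cont.
exact: smooth_continuous sf (image_of_coord dx).
Qed.

Lemma domain_near a x : domain a x -> \forall y \near x, domain a y.
Proof. by move=> dx; apply: open_nbhs_nbhs; split=> //; exact: dom_open. Qed.

Lemma cont_gram a x : domain a x ->
  forall i j, {for x, continuous (fun y : M => gram h a y i j)}.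
Proof.
move=> dx i j; apply: cont_near (cont_local dx (@gram_local_smooth a i j)).
by apply: filterS (domain_near dx) => y dy; rewrite -gram_local.
Qed.

Lemma cont_curv a x (X Y : V) : domain a x ->
  forall i j, {for x, continuous (fun y : M => curv a y X Y i j)}.
Proof.
move=> dx i j.
have d1 v k l : {for x, continuous (fun y : M => dmx v (H a) (Defs.coord (atlas a) y) k l)}.
  apply: (@cont_local a (fun z => dmx v (H a) z k l)) => //.
  rewrite (_ : (fun z => _) = dir_deriv (fun z => H a z k l) v); last first.
    by apply/funext => z; rewrite [LHS]mxE.
  by apply: smooth_dir_deriv; exact: gram_local_smooth.
have d2 u v k l : {for x, continuous (fun y : M => dmx u (dmx v (H a)) (Defs.coord (atlas a) y) k l)}.
  apply: (@cont_local a (fun z => dmx u (dmx v (H a)) z k l)) => //.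
  rewrite (_ : (fun z => _) = dir_deriv (dir_deriv (fun z => H a z k l) v) u); last first.
    by apply/funext => z; rewrite (dmx2_entry _ u v).
  by do 2! apply: smooth_dir_deriv; exact: gram_local_smooth.
have hd (e : C) v k l : {for x, continuous (fun y : M =>
    (2^-1 *: (dmx v (H a) (Defs.coord (atlas a) y) +
       e *: dmx ('i%C *: v) (H a) (Defs.coord (atlas a) y))) k l)}.
  rewrite (_ : (fun y => _) = fun y => 2^-1 * (dmx v (H a) (Defs.coord (atlas a) y) k l +
     e * dmx ('i%C *: v) (H a) (Defs.coord (atlas a) y) k l)); last first.
    by apply/funext => y; rewrite [LHS]mxE [X in _ * X]mxE [X in _ + X]mxE.
  apply: contM; first exact: cont_cst.
  by apply: contD => //; apply: contM => //; exact: cont_cst.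
rewrite (_ : (fun y => _) = fun y => (hder (H a) X (Defs.coord (atlas a) y) *m
  invmx (H a (Defs.coord (atlas a) y)) *m ader (H a) Y (Defs.coord (atlas a) y)) i j +
  - mixed (H a) X Y (Defs.coord (atlas a) y) i j); last first.
  by apply/funext => y; rewrite [LHS]mxE [X in _ + X]mxE.
apply: contD.
  apply: cont_mulmx; last exact: hd.
  apply: cont_mulmx.
    move=> k0 l0; rewrite (_ : (fun y => _) = fun y : M =>
      (2^-1 *: (dmx X (H a) (Defs.coord (atlas a) y) +
       (- 'i%C) *: dmx ('i%C *: X) (H a) (Defs.coord (atlas a) y))) k0 l0); first exact: hd.
    by apply/funext => y; rewrite /hder scaleNr.
  apply: cont_invmx.
    by apply: filterS (domain_near dx) => y dy; rewrite -gram_local// gram_unit.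
  by move=> k0 l0; exact: (cont_local dx (@gram_local_smooth a k0 l0)).
apply: contN.
rewrite (_ : (fun y => _) = fun y => 4^-1 * (dmx X (dmx Y (H a)) (Defs.coord (atlas a) y) i j +
   - 'i%C * dmx ('i%C *: X) (dmx Y (H a)) (Defs.coord (atlas a) y) i j +
   'i%C * dmx X (dmx ('i%C *: Y) (H a)) (Defs.coord (atlas a) y) i j +
   dmx ('i%C *: X) (dmx ('i%C *: Y) (H a)) (Defs.coord (atlas a) y) i j)); last first.
  apply/funext => y.
  have entry (p q r t : 'M[C]_n) : (4^-1 *: (p - 'i%C *: q + 'i%C *: r + t)) i j =
    4^-1 * (p i j + - 'i%C * q i j + 'i%C * r i j + t i j) by rewrite !mxE mulNr.
  exact: entry.
apply: contM; first exact: cont_cst.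
apply: contD => //; apply: contD; last by apply: contM => //; exact: cont_cst.
by apply: contD => //; apply: contM => //; exact: cont_cst.
Qed.

Variables (k : nat) (s : R[i]).
Hypothesis kn : (0 < k <= n)%N.
Hypothesis s_real : Num.conj s = s.
Hypothesis kahler_like : chern_kahler_like h.
Hypothesis ric_sign : forall a x, domain a x ->
  forall Sigma : {vspace V}, \dim Sigma = k ->
  forall E : k.-tuple V, unitary_basis h a x Sigma E ->
  forall X, X \in Sigma -> X != 0 -> 0 < s * ric h a x E X.

(** The form A for the tensor [s R]; taking [s] to be 1 or -1 treats both signs of Ric_k at once. *)
Definition frame_trace a x (E : 'I_k -> V) (Z : V) : C :=
  s * \sum_i hform (curv a x (E i) (E i)) Z Z.

Lemma positive_frame_at a x : domain a x ->
  exists E : 'I_k -> V, forall Z, Z != 0 -> 0 < frame_trace a x E Z.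
Proof.
move=> dx.
(* Scaling the coefficients by [s] applies the frame construction to [s R], whose Ric_k is
   positive. *)
pose c i j := s *: curv_coef (H a) i j (Defs.coord (atlas a) x).
have cE (X Y Z W : V) : \sum_i \sum_j X 0 i * Num.conj (Y 0 j) * hform (c i j) Z W =
   s * hform (curv a x X Y) Z W.
  rewrite curv_hform_coef// mulr_sumr; apply: eq_bigr => i _.
  rewrite mulr_sumr; apply: eq_bigr => j _.
  by rewrite /c /hform -scalemxAr -scalemxAl mxE mulrCA.
have sw (X Y Z W : V) : hform (curv a x X Y) Z W = hform (curv a x Z Y) X W.
  exact: (etrans (esym (chern_curvatureE X Y Z W dx)) (etrans (kahler_like dx X Y Z W)
    (chern_curvatureE Z Y X W dx))).
have cj (X Y Z W : V) : Num.conj (s * hform (curv a x X Y) Z W) = s * hform (curv a x Y X) W Z.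
  by rewrite rmorphM /= s_real hform_conj curv_adj.
have [|||E hE] := @exists_positive_frame R n (gram h a x) (gram_hermitian h dx)
  (gram_pos h dx) k c kn.
- move=> X Y Z W.
  exact: (etrans (cE X Y Z W) (etrans (congr1 (fun t => s * t) (sw X Y Z W))
    (esym (cE Z Y X W)))).
- move=> X Y Z W.
  exact: (etrans (congr1 Num.conj (cE X Y Z W)) (etrans (cj X Y Z W) (esym (cE Y X W Z)))).
- move=> E oE X X0 [t Xt].
  have [ub dimk] := unitary_basis_of dx oE.
  have XS : X \in <<[tuple E i | i < k]>>%VS.
    rewrite Xt; apply: rpred_sum => i _; apply: rpredZ; apply: memv_span.
    by apply/tnthP; exists i; rewrite tnth_mktuple.
  have := ric_sign dx dimk ub XS X0; rewrite /ric mulr_sumr.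
  congr (_ < _); apply: eq_bigr => i _; rewrite tnth_mktuple.
  exact: (etrans (congr1 (fun t => s * t) (chern_curvatureE X X (E i) (E i) dx))
    (esym (cE X X (E i) (E i)))).
- exists E => Z /hE; rewrite /frame_trace mulr_sumr.
  by congr (_ < _); apply: eq_bigr => i _; exact: cE.
Qed.

Lemma frame_trace_real a x E Z : domain a x ->
  frame_trace a x E Z = ((complex.Re (frame_trace a x E Z))%:C)%C.
Proof.
move=> dx; rewrite RRe_real//; apply/CrealP.
rewrite /frame_trace rmorphM /= s_real rmorph_sum /=; congr (_ * _).
by apply: eq_bigr => i _; rewrite hform_conj curv_adj.
Qed.

Lemma gram_real a x Z : domain a x ->
  hform (gram h a x) Z Z = ((complex.Re (hform (gram h a x) Z Z))%:C)%C.
Proof.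
by move=> dx; rewrite RRe_real//; apply/CrealP; rewrite hform_conj gram_hermitian.
Qed.

Lemma frame_traceZ a x E (c : C) Z :
  frame_trace a x E (c *: Z) = c * Num.conj c * frame_trace a x E Z.
Proof.
rewrite /frame_trace mulrCA; congr (_ * _); rewrite mulr_sumr; apply: eq_bigr => i _.
by rewrite hformZl hformZr mulrA.
Qed.

Lemma cont_frame_trace a x E (Z : V) : domain a x ->
  {for (Z, x), continuous (fun p : V * M => complex.Re (frame_trace a p.2 E p.1))}.
Proof.
move=> dx; apply: cont_Re; apply: contM; first exact: cont_cst.
apply: cont_sum => i; apply: (@cont_hform _ _ _
  (fun p : V * M => curv a p.2 (E i) (E i)) fst fst).
- move=> i1 j1; apply: (@continuous_comp _ _ _ snd (fun y : M => curv a y (E i) (E i) i1 j1)).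
    exact: cvg_snd.
  exact: cont_curv.
- by move=> j1; apply: (@continuous_comp _ _ _ fst (fun v : V => v 0 j1));
    [exact: cvg_fst|exact: cont_entry].
- by move=> j1; apply: (@continuous_comp _ _ _ fst (fun v : V => v 0 j1));
    [exact: cvg_fst|exact: cont_entry].
Qed.

Lemma cont_gram_form a x (Z : V) : domain a x ->
  {for (Z, x), continuous (fun p : V * M => complex.Re (hform (gram h a p.2) p.1 p.1))}.
Proof.
move=> dx; apply: cont_Re; apply: (@cont_hform _ _ _
  (fun p : V * M => gram h a p.2) fst fst).
- move=> i1 j1; apply: (@continuous_comp _ _ _ snd (fun y : M => gram h a y i1 j1)).
    exact: cvg_snd.
  exact: cont_gram.
- by move=> j1; apply: (@continuous_comp _ _ _ fst (fun v : V => v 0 j1));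
    [exact: cvg_fst|exact: cont_entry].
- by move=> j1; apply: (@continuous_comp _ _ _ fst (fun v : V => v 0 j1));
    [exact: cvg_fst|exact: cont_entry].
Qed.

(* The frame is not required to be unitary at [x]: it is constant in the chart
   [a], hence serves on a whole neighbourhood. *)
Definition pinched (c : R) (x : M) : Prop := 0 < c /\ exists a (E : 'I_k -> V),
  domain a x /\ forall Z, Z != 0 ->
    frame_trace a x E Z < c%:C%C * hform (gram h a x) Z Z /\
    hform (gram h a x) Z Z < c%:C%C * frame_trace a x E Z.

Lemma pinched_mono (c c' : R) x : c <= c' -> pinched c x -> pinched c' x.
Proof.
move=> cc [c0 [a [E [dx hE]]]]; split; first exact: lt_le_trans cc.
exists a, E; split=> // Z Z0; have [h1 h2] := hE Z Z0.
have N0 : 0 < hform (gram h a x) Z Z by exact: gram_pos.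
have A0 : 0 < frame_trace a x E Z.
  by have := lt_trans N0 h2; rewrite pmulr_rgt0// ltcR.
split; first by apply: lt_le_trans h1 _; rewrite ler_pM2r// lecR.
by apply: lt_le_trans h2 _; rewrite ler_pM2r// lecR.
Qed.

(** For each direction on the sphere, both inequalities hold for nearby directions, for [y] near [x]
    and for [c] large. Compactness of the sphere makes the neighbourhood and the threshold uniform,
    and homogeneity extends them to all nonzero vectors. *)
Lemma pinched_near x : exists2 c : R, 0 < c & \forall y \near x, pinched c y.
Proof.
have [a dx] := atlas_cover x; have [E hE] := positive_frame_at dx.
pose f Z y := complex.Re (frame_trace a y E Z).
pose g Z y := complex.Re (hform (gram h a y) Z Z).
pose F : set_system (M * R) := filter_prod (nbhs x) (pinfty_nbhs R).
pose P (i : M * R) (Z : V) := f Z i.1 < i.2 * g Z i.1 /\ g Z i.1 < i.2 * f Z i.1.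
have [] : F [set i | @sphere R n `<=` P i].
  apply: (proj1 (compact_near_coveringP _) sphere_compact (M * R)%type F P) => Z sZ.
  have Z0 : Z != 0 by rewrite -euclid2_eq0 sZ oner_eq0.
  have f0 : 0 < f Z x by rewrite -ltcR -frame_trace_real//; exact: hE.
  have g0 : 0 < g Z x by rewrite -ltcR -gram_real//; exact: gram_pos.
  have cf := @cont_frame_trace a x E Z dx; have cg := @cont_gram_form a x Z dx.
  have nf : \forall p \near (Z, x), f Z x / 2 < f p.1 p.2 < 2 * f Z x.
    near=> p; apply/andP; split; near: p.
      by apply: (cvgr_gt (f Z x) cf); rewrite ltr_pdivrMr// ltr_pMr// ltr1n.
    by apply: (cvgr_lt (f Z x) cf); rewrite ltr_pMl// ltr1n.
  have ng : \forall p \near (Z, x), g Z x / 2 < g p.1 p.2 < 2 * g Z x.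
    near=> p; apply/andP; split; near: p.
      by apply: (cvgr_gt (g Z x) cg); rewrite ltr_pdivrMr// ltr_pMr// ltr1n.
    by apply: (cvgr_lt (g Z x) cg); rewrite ltr_pMl// ltr1n.
  have [[A B] /= [nA nB] AB] := filterI nf ng.
  pose c0 := 4 * f Z x / g Z x + 4 * g Z x / f Z x.
  have c1 : 0 < 4 * f Z x / g Z x by rewrite divr_gt0// mulr_gt0.
  have c2 : 0 < 4 * g Z x / f Z x by rewrite divr_gt0// mulr_gt0.
  exists (A, [set i | B i.1 /\ c0 < i.2]) => /=.
    split=> //; exists (B, [set c | c0 < c]) => /=; last by move=> [y c] /= [].
    by split=> //; exists c0; rewrite num_real.
  move=> [W [y c]] /= [AW [By cc]].
  have [/andP[f1 f2] /andP[g1 g2]] := AB (W, y) (conj AW By).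
  rewrite /P /= in f1 f2 g1 g2 *.
  have cpos : 0 < c by apply: lt_trans cc; rewrite addr_gt0.
  split.
    apply: (double_halve_lt cpos _ f2 g1); rewrite -ler_pdivrMr//.
    by apply: le_trans (ltW cc); rewrite /c0 lerDl ltW.
  apply: (double_halve_lt cpos _ g2 f1); rewrite -ler_pdivrMr//.
  by apply: le_trans (ltW cc); rewrite /c0 lerDr ltW.
move=> [B D] /= [nB [c0 [_ cD]]] BD.
(* Above the threshold [c0], which may be negative, and positive. *)
pose c := Num.max c0 0 + 1.
have c0c : c0 < c by rewrite /c ltr_pwDr// le_max lexx.
have cpos : 0 < c by rewrite /c ltr_pwDr// le_max lexx orbT.
exists c => //; apply: filterS (filterI nB (domain_near dx)) => y [By dy].
split=> //; exists a, E; split=> // Z Z0; have [l [u su ZE]] := normalize Z0.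
have l0 : 0 < l * Num.conj l.
  rewrite mul_conjC_gt0; apply: contra Z0 => /eqP l0.
  by rewrite ZE l0 scale0r.
have [h1 h2] : P (y, c) u by apply: (BD (y, c)) => //; split=> //=; exact: cD.
have eh : hform (gram h a y) Z Z = l * Num.conj l * hform (gram h a y) u u.
  by rewrite ZE hformZl hformZr mulrA.
have ef : frame_trace a y E Z = l * Num.conj l * frame_trace a y E u.
  by rewrite ZE frame_traceZ.
rewrite {}eh {}ef; move: (l * Num.conj l) l0 => L L0.
have cut (p q : R[i]) : p < c%:C%C * q -> L * p < c%:C%C * (L * q).
  by rewrite mulrCA ltr_pM2l.
by split; apply: cut; rewrite frame_trace_real// gram_real// -rmorphM ltcR.
Unshelve. all: by end_near. Qed.

Lemma exists_pinching : compact [set: M] -> exists2 c : R, 0 < c & forall x, pinched c x.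
Proof.
move=> cM; apply: (compact_local_to_global cM).
- by move=> c c' x; exact: pinched_mono.
- by exists 1.
- exact: pinched_near.
Qed.

End Manifold.

(** * Maximum of the norm of a tensor field *)

(** Transfers a change of components from the tensor to its arguments: a product over slots of sums
    over indices is a sum over multi-indices of products. *)
Lemma tensor_change_of_frame (A : comNzRingType) (n p q : nat)
    (P Q : 'I_n -> 'I_n -> A) (T : {ffun 'I_p -> 'I_n} -> {ffun 'I_q -> 'I_n} -> A)
    (x : 'I_p -> 'I_n -> A) (w : 'I_q -> 'I_n -> A) :
  \sum_(I : {ffun 'I_p -> 'I_n}) \sum_(J : {ffun 'I_q -> 'I_n})
    (\sum_(K : {ffun 'I_p -> 'I_n}) \sum_(L : {ffun 'I_q -> 'I_n})
       (\prod_s P (K s) (I s)) * (\prod_t Q (J t) (L t)) * T K L)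
    * (\prod_s x s (I s)) * (\prod_t w t (J t)) =
  \sum_(K : {ffun 'I_p -> 'I_n}) \sum_(L : {ffun 'I_q -> 'I_n})
    T K L * (\prod_s \sum_i x s i * P (K s) i) * (\prod_t \sum_j w t j * Q j (L t)).
Proof.
transitivity (\sum_(I : {ffun 'I_p -> 'I_n}) \sum_(K : {ffun 'I_p -> 'I_n})
    \sum_(J : {ffun 'I_q -> 'I_n}) \sum_(L : {ffun 'I_q -> 'I_n})
    (\prod_s P (K s) (I s)) * (\prod_t Q (J t) (L t)) * T K L
      * (\prod_s x s (I s)) * (\prod_t w t (J t))).
  apply: eq_bigr => I _; rewrite exchange_big; apply: eq_bigr => J _.
  rewrite !mulr_suml; apply: eq_bigr => K _; by rewrite !mulr_suml.
rewrite exchange_big; apply: eq_bigr => K _.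
transitivity (\sum_(I : {ffun 'I_p -> 'I_n}) \sum_(L : {ffun 'I_q -> 'I_n})
    \sum_(J : {ffun 'I_q -> 'I_n})
    (\prod_s P (K s) (I s)) * (\prod_t Q (J t) (L t)) * T K L
      * (\prod_s x s (I s)) * (\prod_t w t (J t))).
  by apply: eq_bigr => I _; exact: exchange_big.
rewrite exchange_big; apply: eq_bigr => L _.
rewrite !bigA_distr_bigA /= -mulrA mulr_suml mulr_sumr; apply: eq_bigr => I _.
rewrite !mulr_sumr; apply: eq_bigr => J _.
rewrite !big_split /=; ring.
Qed.

Lemma unitmx_congr (A : comUnitRingType) n (J B K : 'M[A]_n) :
  J *m B *m K \in unitmx -> J \in unitmx /\ K \in unitmx.
Proof. by rewrite !unitmx_mul => /andP[/andP[]]. Qed.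

Section MaximumPrinciple.
Context {R : realType} {n : nat} {M : complex_manifold R n}.
Variable h : hermitian_metric M.
Notation C := (Cplx R).
Notation V := (Cspace R n).
Implicit Types (a b : chart_index M) (y : M).
Notation H a := (local a (gram h a)).
Variables (p q : nat) (T : tensor_components M p q).
Hypotheses (n_gt0 : (0 < n)%N) (compactM : compact [set: M]) (GT : Gamma M p q T).

(* The covector paired with the [s]-th contravariant index is the column
   [(x s)^T]; storing it as a row lets both kinds of arguments share [sphere]. *)
Definition tensor_value a y (x : 'I_p -> V) (w : 'I_q -> V) : C :=
  \sum_I \sum_J T a y I J * (\prod_s x s 0 (I s)) * (\prod_t w t 0 (J t)).

Definition norm_product a y (x : 'I_p -> V) (w : 'I_q -> V) : C :=
  (\prod_s cform (invmx (gram h a y)) (x s)^T) * \prod_t hform (gram h a y) (w t) (w t).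

Lemma jac_unit a b y : domain a y -> domain b y ->
  jac a b y \in unitmx /\ adjmx (jac a b y) \in unitmx.
Proof.
move=> da db; have := gram_unit h da.
by rewrite (gram_compat h da db); exact: unitmx_congr.
Qed.

(** The dual norm of a covector is the norm of its metric dual, so positivity for covectors reduces
    to [gram_pos]. *)
Lemma cform_sharp (G : 'M[C]_n) (xi : 'cV[C]_n) : G \in unitmx -> adjmx G = G ->
  cform (invmx G) xi = hform G (adjmx xi *m invmx G) (adjmx xi *m invmx G).
Proof.
move=> Gu Gh; rewrite /cform /hform adjmxM adjmxK adjmx_inv// mulmxKV//.
by rewrite mulmxA.
Qed.

Lemma cform_gt0 a y (xi : 'cV[C]_n) : domain a y -> xi != 0 ->
  0 < cform (invmx (gram h a y)) xi.
Proof.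
move=> da xi0; rewrite cform_sharp ?gram_unit// ?gram_hermitian//.
apply: gram_pos => //; apply: contra xi0 => /eqP e.
have : adjmx (adjmx xi *m invmx (gram h a y) *m gram h a y) = 0.
  by rewrite e mul0mx; apply/matrixP => i j; rewrite !mxE conjC0.
by rewrite mulmxKV ?gram_unit// adjmxK => ->.
Qed.

Lemma trmx_neq0 (v : V) : v != 0 -> v^T != 0.
Proof. by apply: contra => /eqP e; rewrite -(trmxK v) e trmx0. Qed.

Lemma cform0 (K : 'M[C]_n) : cform K 0 = 0.
Proof. by rewrite /cform mulmx0 mxE. Qed.

Lemma hform00 (K : 'M[C]_n) : hform K 0 0 = 0.
Proof. by rewrite /hform !mul0mx mxE. Qed.

Lemma norm_product_gt0 a y x w : domain a y ->
  (forall s, x s != 0) -> (forall t, w t != 0) -> 0 < norm_product a y x w.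
Proof.
move=> da x0 w0; apply: mulr_gt0; apply: prodr_gt0 => i _.
  by apply: cform_gt0 => //; exact: trmx_neq0.
exact: gram_pos.
Qed.

Lemma norm_product_ge0 a y x w : domain a y -> 0 <= norm_product a y x w.
Proof.
move=> da; apply: mulr_ge0; apply: prodr_ge0 => i _.
  have [->|x0] := eqVneq (x i) 0; first by rewrite trmx0 cform0.
  by apply/ltW/cform_gt0 => //; exact: trmx_neq0.
have [->|w0] := eqVneq (w i) 0; first by rewrite hform00.
exact/ltW/gram_pos.
Qed.

Lemma norm_product_neq0 a y x w : norm_product a y x w != 0 ->
  (forall s, x s != 0) /\ (forall t, w t != 0).
Proof.
rewrite mulf_eq0 negb_or => /andP[/prodf_neq0 hx /prodf_neq0 hw]; split=> i.
  by apply: contra (hx i isT) => /eqP ->; rewrite trmx0 cform0.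
by apply: contra (hw i isT) => /eqP ->; rewrite hform00.
Qed.

Lemma tensor_value_chart a b y x w : domain a y -> domain b y ->
  tensor_value b y x w =
  tensor_value a y (fun s => x s *m (jac a b y)^T) (fun t => w t *m jac b a y).
Proof.
move=> da db; have [_ cmp _] := GT.
rewrite /tensor_value.
transitivity (\sum_(I : {ffun 'I_p -> 'I_n}) \sum_(J : {ffun 'I_q -> 'I_n})
    (\sum_(K : {ffun 'I_p -> 'I_n}) \sum_(L : {ffun 'I_q -> 'I_n})
       (\prod_s jac a b y (K s) (I s)) * (\prod_t jac b a y (J t) (L t)) * T a y K L)
    * (\prod_s x s 0 (I s)) * (\prod_t w t 0 (J t))).
  by apply: eq_bigr => I _; apply: eq_bigr => J _; rewrite (cmp a b y da db).
rewrite (tensor_change_of_frame (jac a b y) (jac b a y) (T a y)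
  (fun s i => x s 0 i) (fun t j => w t 0 j)); apply: eq_bigr => K _; apply: eq_bigr => L _.
congr (_ * _ * _); apply: eq_bigr => i _; rewrite [RHS]mxE; apply: eq_bigr => j _ //.
by rewrite [X in _ = _ * X]mxE.
Qed.

(* [gram_compat] alone makes the Jacobians invertible, so the chain rule
   [jac a b *m jac b a = 1] is never needed. *)
Lemma norm_product_chart a b y x w : domain a y -> domain b y ->
  norm_product b y x w =
  norm_product a y (fun s => x s *m (jac a b y)^T) (fun t => w t *m jac b a y).
Proof.
move=> da db; congr (_ * _); apply: eq_bigr => i _.
  have [Ju Jau] := jac_unit da db.
  rewrite trmx_mul trmxK /cform adjmxM; congr (fun_of_matrix _ 0 0).
  rewrite !mulmxA; congr (_ *m _); rewrite -!mulmxA; congr (_ *m _); rewrite mulmxA.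
  apply: (can_inj (mulmxK (gram_unit h db))); rewrite mulVmx ?gram_unit//.
  apply: (can_inj (mulmxK Jau)); rewrite mul1mx.
  rewrite -!mulmxA (mulmxA (jac a b y)) -(gram_compat h da db).
  by rewrite mulVmx ?gram_unit// mulmx1.
by rewrite /hform (gram_compat h db da) adjmxM !mulmxA.
Qed.

Lemma tensor_valueZ a y (l : 'I_p -> C) (m : 'I_q -> C) x w :
  tensor_value a y (fun s => l s *: x s) (fun t => m t *: w t) =
  (\prod_s l s) * (\prod_t m t) * tensor_value a y x w.
Proof.
rewrite /tensor_value mulr_sumr; apply: eq_bigr => I _.
rewrite mulr_sumr; apply: eq_bigr => J _.
have -> : \prod_s (l s *: x s) 0 (I s) = \prod_s l s * \prod_s x s 0 (I s).
  by rewrite -big_split; apply: eq_bigr => s _; rewrite mxE.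
have -> : \prod_t (m t *: w t) 0 (J t) = \prod_t m t * \prod_t w t 0 (J t).
  by rewrite -big_split; apply: eq_bigr => s _; rewrite mxE.
have alg (c l' x' m' w' : C) : c * (l' * x') * (m' * w') = l' * m' * (c * x' * w') by ring.
exact: alg.
Qed.

Lemma norm_productZ a y (l : 'I_p -> C) (m : 'I_q -> C) x w :
  norm_product a y (fun s => l s *: x s) (fun t => m t *: w t) =
  ((\prod_s l s) * (\prod_t m t)) * Num.conj ((\prod_s l s) * (\prod_t m t))
  * norm_product a y x w.
Proof.
have sw (e e' g g' z z' : C) : e * e' * z * (g * g' * z') = e * g * (e' * g') * (z * z').
  by ring.
rewrite rmorphM !rmorph_prod /= -sw; congr (_ * _); rewrite -!big_split; apply: eq_bigr => i _ /=.
  by rewrite /cform linearZ /= adjmxZ -!scalemxAl -scalemxAr scalerA mxE (mulrC (Num.conj (l i))).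
by rewrite hformZl hformZr mulrA.
Qed.

Definition normsq (c : C) : C := c * Num.conj c.

Lemma normsqM (c d : C) : normsq (c * d) = normsq c * normsq d.
Proof. by rewrite /normsq rmorphM /= mulrACA. Qed.

Definition tensor_ratio a y x w : R :=
  complex.Re (normsq (tensor_value a y x w) / norm_product a y x w).

Definition attained (r : R) : Prop := exists a y x w,
  [/\ domain a y, forall s, x s != 0, forall t, w t != 0 & tensor_ratio a y x w = r].

(** Multiplied out rather than stated for [tensor_ratio], so that it also speaks of zero arguments;
    ranging over all charts makes it a property of the point. *)
Definition bounds (r : R) y : Prop := forall b x w, domain b y ->
  normsq (tensor_value b y x w) <= r%:C%C * norm_product b y x w.

Lemma bounds_mono r r' y : r <= r' -> bounds r y -> bounds r' y.
Proof.
move=> rr hr b x w db; apply: le_trans (hr b x w db) _.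
by rewrite ler_wpM2r ?norm_product_ge0// lecR.
Qed.

Lemma tensor_ratioE a y x w : domain a y -> (forall s, x s != 0) -> (forall t, w t != 0) ->
  normsq (tensor_value a y x w) = (tensor_ratio a y x w)%:C%C * norm_product a y x w.
Proof.
move=> da x0 w0; have D0 := norm_product_gt0 da x0 w0.
rewrite /tensor_ratio RRe_real; first by rewrite divfK// gt_eqF.
by apply: ger0_real; rewrite divr_ge0 ?mul_conjC_ge0// ltW.
Qed.

Lemma tensor_ratio_ge0 a y x w : domain a y -> 0 <= tensor_ratio a y x w.
Proof.
move=> da; rewrite /tensor_ratio -ler0c RRe_real.
  by rewrite divr_ge0 ?mul_conjC_ge0// norm_product_ge0.
by apply: ger0_real; rewrite divr_ge0 ?mul_conjC_ge0// norm_product_ge0.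
Qed.

Lemma tensor_value_eq0 a y x w :
  (exists s, x s = 0) \/ (exists t, w t = 0) -> tensor_value a y x w = 0.
Proof.
move=> hz; rewrite /tensor_value big1// => I _; rewrite big1// => J _.
case: hz => [[s xs]|[t wt]].
  by rewrite (bigD1 s)//= xs mxE mul0r mulr0 mul0r.
by rewrite (bigD1 t)//= wt mxE mul0r mulr0.
Qed.

(** Both sides scale by the same factor when the arguments are rescaled, and the left side is 0 as
    soon as one argument vanishes. *)
Lemma bound_of_spheres a y r : domain a y -> 0 <= r ->
  (forall x w, (forall s, sphere (x s)) -> (forall t, sphere (w t)) ->
     tensor_ratio a y x w <= r) ->
  forall x w, normsq (tensor_value a y x w) <= r%:C%C * norm_product a y x w.
Proof.
move=> da r0 hr x w.
have [hx|hx] := pselect (exists s, x s = 0).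
  rewrite tensor_value_eq0; last by left.
  by rewrite /normsq mul0r mulr_ge0 ?norm_product_ge0// ler0c.
have [hw|hw] := pselect (exists t, w t = 0).
  rewrite tensor_value_eq0; last by right.
  by rewrite /normsq mul0r mulr_ge0 ?norm_product_ge0// ler0c.
have /choice[lu hlu] s : exists lu : C * V, sphere lu.2 /\ x s = lu.1 *: lu.2.
  have : x s != 0 by apply/eqP => xs; apply: hx; exists s.
  by move=> /normalize[l [u su e]]; exists (l, u).
have /choice[mv hmv] t : exists lu : C * V, sphere lu.2 /\ w t = lu.1 *: lu.2.
  have : w t != 0 by apply/eqP => wt; apply: hw; exists t.
  by move=> /normalize[l [u su e]]; exists (l, u).
have -> : x = fun s => (lu s).1 *: (lu s).2 by apply/funext => s; have [] := hlu s.
have -> : w = fun s => (mv s).1 *: (mv s).2 by apply/funext => s; have [] := hmv s.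
rewrite tensor_valueZ norm_productZ normsqM (mulrCA (r%:C)%C).
apply: ler_wpM2l; first exact: mul_conjC_ge0.
have sphere_neq0 (v : V) : sphere v -> v != 0.
  by move=> sv; rewrite -euclid2_eq0 sv oner_eq0.
rewrite tensor_ratioE//; last first.
- by move=> t; apply: sphere_neq0; have [] := hmv t.
- by move=> s; apply: sphere_neq0; have [] := hlu s.
apply: ler_wpM2r; first exact: norm_product_ge0.
by rewrite lecR; apply: hr => [s|t]; [have [] := hlu s|have [] := hmv t].
Qed.

Let SP := prod_topology (fun _ : 'I_p => V).
Let SQ := prod_topology (fun _ : 'I_q => V).

Lemma cont_tensor_coef a y I J : domain a y ->
  {for y, continuous (fun y => T a y I J)}.
Proof.
move=> da; have [hol _ _] := GT; have [sf _] := hol a I J.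
apply: cont_near (cont_local da sf).
by apply: filterS (domain_near da) => z dz; rewrite /local /= param_coord.
Qed.

Lemma cont_ratio a y (x : SP) (w : SQ) : domain a y ->
  (forall s, x s != 0) -> (forall t, w t != 0) ->
  {for (y, (x, w)), continuous (fun P : M * (SP * SQ) => tensor_ratio a P.1 P.2.1 P.2.2)}.
Proof.
move=> da x0 w0.
have cx s l : {for (y, (x, w)), continuous (fun P : M * (SP * SQ) => P.2.1 s 0 l)}.
  apply: (@continuous_comp _ _ _ (fun P : M * (SP * SQ) => P.2) (fun P : SP * SQ => P.1 s 0 l)).
    exact: cvg_snd.
  apply: (@continuous_comp _ _ _ fst (fun F : SP => F s 0 l)); first exact: cvg_fst.
  apply: (@continuous_comp _ _ _ (fun F : SP => F s) (fun v : V => v 0 l)).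
    exact: (@proj_continuous _ (fun _ : 'I_p => V) s x).
  exact: cont_entry.
have cw t l : {for (y, (x, w)), continuous (fun P : M * (SP * SQ) => P.2.2 t 0 l)}.
  apply: (@continuous_comp _ _ _ (fun P : M * (SP * SQ) => P.2) (fun P : SP * SQ => P.2 t 0 l)).
    exact: cvg_snd.
  apply: (@continuous_comp _ _ _ snd (fun F : SQ => F t 0 l)); first exact: cvg_snd.
  apply: (@continuous_comp _ _ _ (fun F : SQ => F t) (fun v : V => v 0 l)).
    exact: (@proj_continuous _ (fun _ : 'I_q => V) t w).
  exact: cont_entry.
have cM (f : M -> C) : {for y, continuous f} ->
    {for (y, (x, w)), continuous (fun P : M * (SP * SQ) => f P.1)}.
  by move=> cf; apply: (@continuous_comp _ _ _ fst f) => //; exact: cvg_fst.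
have cT : {for (y, (x, w)), continuous (fun P : M * (SP * SQ) => tensor_value a P.1 P.2.1 P.2.2)}.
  apply: cont_sum => I; apply: cont_sum => J; apply: contM.
    apply: contM; last by apply: cont_prod => s; exact: cx.
    exact: cM (cont_tensor_coef da).
  by apply: cont_prod => t; exact: cw.
have cK k l : {for (y, (x, w)), continuous
    (fun P : M * (SP * SQ) => invmx (gram h a P.1) k l)}.
  apply: (cM (fun z => invmx (gram h a z) k l)); apply: cont_invmx => [|k' l'].
    by apply: filterS (domain_near da) => z dz; exact: gram_unit.
  exact: cont_gram.
have cX i : {for (y, (x, w)), continuous
    (fun P : M * (SP * SQ) => cform (invmx (gram h a P.1)) (P.2.1 i)^T)}.
  have hA k l : {for (y, (x, w)), continuous (fun P : M * (SP * SQ) => adjmx (P.2.1 i)^T k l)}.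
    rewrite (_ : (fun P => _) = fun P : M * (SP * SQ) => Num.conj (P.2.1 i 0 l)).
      exact: cont_conj (cx i l).
    by apply/funext => P; rewrite !mxE (ord1 k).
  have hB k l : {for (y, (x, w)), continuous (fun P : M * (SP * SQ) => (P.2.1 i)^T k l)}.
    rewrite (_ : (fun P => _) = fun P : M * (SP * SQ) => P.2.1 i 0 k); first exact: cx.
    by apply/funext => P; rewrite mxE (ord1 l).
  by have e := @cont_mulmx _ _ _ _ _ _ _ _ (@cont_mulmx _ _ _ _ _ _ _ _ hA cK) hB 0 0; exact: e.
have cW i : {for (y, (x, w)), continuous
    (fun P : M * (SP * SQ) => hform (gram h a P.1) (P.2.2 i) (P.2.2 i))}.
  have cG k l : {for (y, (x, w)), continuous (fun P : M * (SP * SQ) => gram h a P.1 k l)}.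
    by have e := cM (fun z => gram h a z k l) (@cont_gram R n M h a y da k l); exact: e.
  have e := @cont_hform _ _ _ (fun P : M * (SP * SQ) => gram h a P.1)
    (fun P => P.2.2 i) (fun P => P.2.2 i) _ cG (cw i) (cw i).
  exact: e.
have cD := contM (@cont_prod _ _ _ (index_enum 'I_p) xpredT _ _ cX)
  (@cont_prod _ _ _ (index_enum 'I_q) xpredT _ _ cW).
have D0 : norm_product a y x w != 0 by rewrite gt_eqF//; exact: norm_product_gt0.
have cV : {for (y, (x, w)), continuous
    (fun P : M * (SP * SQ) => (norm_product a P.1 P.2.1 P.2.2)^-1)}.
  have e := @contV _ _ (fun P : M * (SP * SQ) => norm_product a P.1 P.2.1 P.2.2)
    (y, (x, w)) D0 cD.
  exact: e.
by have e := cont_Re (contM (contM cT (cont_conj cT)) cV); exact: e.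
Qed.

(** The ratio is continuous on a compact neighbourhood inside one chart times products of spheres,
    so it attains a maximum there; the change-of-chart lemmas extend the bound to every other
    chart. *)
Lemma local_maximum y : exists2 r, attained r & \forall z \near y, bounds r z.
Proof.
have [a da] := atlas_cover y.
(* A compact Hausdorff space is regular: some neighbourhood of [y] has its closure inside the chart
   domain. *)
have [B nB BD] : filter_from (nbhs y) closure (domain a).
  apply: (@compact_regular M y setT (@carrier_hausdorff _ _ M) compactM filterT).
  exact: domain_near.
pose K := closure B.
have cK : compact K by apply: subclosed_compact compactM _ => //; exact: closed_closure.
pose S1 : set SP := [set x | forall s, sphere (x s)].
pose S2 : set SQ := [set w | forall t, sphere (w t)].
have c1 : compact S1 by exact: (@tychonoff _ (fun _ : 'I_p => V) _ (fun=> sphere_compact)).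
have c2 : compact S2 by exact: (@tychonoff _ (fun _ : 'I_q => V) _ (fun=> sphere_compact)).
have sphere_neq0 (v : V) : sphere v -> v != 0.
  by move=> sv; rewrite -euclid2_eq0 sv oner_eq0.
(* A point of the sphere, available since [n > 0], so that the set to be maximised over is
   nonempty. *)
have sb : sphere (basis_vec (Ordinal n_gt0) : V).
  rewrite /sphere /= /euclid2 (bigD1 (Ordinal n_gt0))//= !mxE !eqxx conjC1 mulr1.
  by rewrite big1 ?addr0// => i ni; rewrite !mxE (negbTE ni) andbF mul0r.
pose A := K `*` (S1 `*` S2).
have cA : compact A by apply: compact_setX => //; exact: compact_setX.
have A0 : A !=set0.
  exists (y, ((fun=> basis_vec (Ordinal n_gt0)), (fun=> basis_vec (Ordinal n_gt0)))).
  split=> /=; first exact: subset_closure (nbhs_singleton nB).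
  by split=> /= s.
have [|[z [x w]] /set_mem /= [Kz [S1x S2w]] mx] := @compact_EVT_max _ R
  (fun P : M * (SP * SQ) => tensor_ratio a P.1 P.2.1 P.2.2) A A0 cA.
  apply: continuous_in_subspaceT => -[z [x w]] /set_mem /= [Kz [S1x S2w]].
  apply: cont_ratio => [|s|t]; first exact: BD.
    exact/sphere_neq0/S1x.
  exact/sphere_neq0/S2w.
have dz := BD _ Kz.
exists (tensor_ratio a z x w).
  exists a, z, x, w; split=> // [s|t]; first exact/sphere_neq0/S1x.
  exact/sphere_neq0/S2w.
apply: filterS nB => z' Bz' b x' w' db.
have dz' : domain a z' by apply: BD; exact: subset_closure.
rewrite (tensor_value_chart x' w' dz' db) (norm_product_chart x' w' dz' db).
apply: (bound_of_spheres dz' (tensor_ratio_ge0 x w dz)).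
move=> x1 w1 s1 s2; apply: (mx (z', (x1, w1))); apply/mem_set.
by split=> //=; exact: subset_closure.
Qed.

Lemma global_maximum (y0 : M) : exists2 r, attained r & forall y, bounds r y.
Proof.
apply: (compact_local_to_global compactM); first by move=> r r' y; exact: bounds_mono.
  by have [r ar _] := local_maximum y0; exists r.
exact: local_maximum.
Qed.

End MaximumPrinciple.

(** * Curvature at the maximum *)

Lemma add_scale_entry (A : nzRingType) m n (B D : 'M[A]_(m, n)) c e i j :
  (B + c *: (e *: D)) i j = B i j + c * (e * D i j).
Proof. by rewrite !mxE. Qed.

Section CurvatureInequality.
Context {R : realType} {n : nat} {M : complex_manifold R n}.
Variable h : hermitian_metric M.
Notation C := (Cplx R).
Notation V := (Cspace R n).
Implicit Types (a b : chart_index M) (y : M).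
Notation H a := (local a (gram h a)).
Variables (p q : nat) (T : tensor_components M p q).
Hypothesis GT : Gamma M p q T.

Definition sharp a y (x : V) : V := adjmx x^T *m invmx (gram h a y).

Variables (a : chart_index M) (y : M) (x : 'I_p -> V) (w : 'I_q -> V) (r : R).
Hypotheses (da : domain a y) (x0 : forall s, x s != 0) (w0 : forall t, w t != 0).
Hypotheses (ratio_r : tensor_ratio h T a y x w = r) (bounds_r : forall z, bounds h T r z).
Hypothesis (value_neq0 : tensor_value T a y x w != 0).
Variable X : V.

Let z0 := Defs.coord (atlas a) y.
(** The velocities prescribed by [dual_jet] and [norm_jet], for which the norms of all arguments are
    critical at 0. *)
Let x1 (v : V) s := hder (H a) v z0 *m invmx (H a z0) *m (x s)^T.
Let w1 (v : V) t := - (w t *m hder (H a) v z0 *m invmx (H a z0)).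
Let xl (v : V) (c : R) s : V := ((x s)^T + c%:C%C *: x1 v s)^T.
Let wl (v : V) (c : R) t : V := w t + c%:C%C *: w1 v t.
Let f (v : V) (c : R) : C :=
  tensor_value T a (param (atlas a) (z0 + c%:C%C *: v)) (xl v c) (wl v c).
Let N (v : V) (i : 'I_p + 'I_q) (c : R) : C := match i with
  | inl s => cform (invmx (H a (z0 + c%:C%C *: v))) ((x s)^T + c%:C%C *: x1 v s)
  | inr t => hform (H a (z0 + c%:C%C *: v)) (wl v c t) (wl v c t) end.
Let nu (i : 'I_p + 'I_q) : C := match i with
  | inl s => cform (invmx (H a z0)) (x s)^T
  | inr t => hform (H a z0) (w t) (w t) end.
Let second (v : V) (i : 'I_p + 'I_q) : C := match i with
  | inl s => dual_jet_value (H a) (x s)^T v z0 (hder (H a) v z0) (ader (H a) v z0)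
  | inr t => norm_jet_value (H a) (w t) v z0 (hder (H a) v z0) (ader (H a) v z0) end.

Let Uz : image_of a z0. Proof. exact: image_of_coord. Qed.

Let prod_nu : \prod_i nu i = norm_product h a y x w.
Proof.
by rewrite big_sumType /norm_product (gram_local h da).
Qed.

Let prod_N v c : image_of a (z0 + c%:C%C *: v) ->
  \prod_i N v i c = norm_product h a (param (atlas a) (z0 + c%:C%C *: v)) (xl v c) (wl v c).
Proof.
move=> Uc; rewrite big_sumType /norm_product; congr (_ * _).
by apply: eq_bigr => s _; rewrite /xl trmxK.
Qed.

Let nu_neq0 i : nu i != 0.
Proof.
case: i => i /=; rewrite -(gram_local h da) gt_eqF//.
  by apply: cform_gt0 => //; exact: trmx_neq0.
exact: gram_pos.
Qed.

Let jets v i : jet2 (N v i) (nu i) 0 (second v i).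
Proof.
case: i => i /=.
  exact: (dual_jet (@image_open _ _ _ a) (@gram_local_smooth _ _ _ h a)
    (@gram_local_herm _ _ _ h a) (@gram_local_unit _ _ _ h a)).
exact: (norm_jet (@image_open _ _ _ a) (@gram_local_smooth _ _ _ h a)
  (@gram_local_herm _ _ _ h a) (@gram_local_unit _ _ _ h a)).
Qed.

Let bound_line v : \forall c \near (0 : R),
  f v c * Num.conj (f v c) * \prod_i nu i
  <= tensor_value T a y x w * Num.conj (tensor_value T a y x w) * \prod_i N v i c.
Proof.
apply: filterS (near_line (@image_open _ _ _ a) v Uz) => c Uc.
have [dc _] := param_domain Uc.
rewrite (prod_N Uc) prod_nu.
have := tensor_ratioE h T da x0 w0; rewrite ratio_r /normsq => ->.
rewrite [leRHS]mulrAC; apply: ler_wpM2r; first exact: norm_product_ge0.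
exact: (@bounds_r (param (atlas a) (z0 + c%:C%C *: v)) a (xl v c) (wl v c) dc).
Qed.

(** By [hder_i] the velocities along ['i *: X] are ['i] times those along [X], so the arguments are
    complex affine on the complex line and the value is a polynomial in holomorphic functions. *)
Let hol_line : hol2 (f X) (f ('i%C *: X)) (tensor_value T a y x w).
Proof.
have [hol _ _] := GT.
have ex s i : hol2 (fun c => xl X c s 0 i) (fun c => xl ('i%C *: X) c s 0 i) (x s 0 i).
  apply: hol2_ext (hol2_affine (x s 0 i) (x1 X s i 0)) => c; first by rewrite /xl !mxE.
  rewrite /xl /x1 (hder_i (@gram_local_smooth _ _ _ h a) X Uz) -!scalemxAl.
  by rewrite [RHS]mxE add_scale_entry [X in _ = X + _]mxE.
have ew t i : hol2 (fun c => wl X c t 0 i) (fun c => wl ('i%C *: X) c t 0 i) (w t 0 i).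
  apply: hol2_ext (hol2_affine (w t 0 i) (w1 X t 0 i)) => c.
    by rewrite /wl [RHS]mxE [X in _ = _ + X]mxE.
  have -> : wl ('i%C *: X) c t = w t + c%:C%C *: ('i%C *: w1 X t).
    congr (_ + _ *: _); rewrite /w1 (hder_i (@gram_local_smooth _ _ _ h a) X Uz).
    by rewrite -scalemxAr -scalemxAl scalerN.
  by rewrite add_scale_entry.
apply: hol2_sum => I; apply: hol2_sum => J.
apply: hol2M; last by apply: hol2_prod => t; exact: ew.
apply: hol2M; last by apply: hol2_prod => s; exact: ex.
rewrite -[X in hol2 _ _ (T a X I J)](param_coord da).
exact: (hol2_line X (@image_open _ _ _ a) (hol a I J) Uz).
Qed.

Lemma maximum_curvature : 0 <= complex.Re (
  \sum_s hform (curv h a y X X) (sharp a y (x s)) (sharp a y (x s)) /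
    hform (gram h a y) (sharp a y (x s)) (sharp a y (x s))
  - \sum_t hform (curv h a y X X) (w t) (w t) / hform (gram h a y) (w t) (w t)).
Proof.
have Dpos : 0 < \prod_i nu i by rewrite prod_nu; exact: norm_product_gt0.
have := max_ratio_second_derivative value_neq0 nu_neq0 hol_line
  (jets X) (jets ('i%C *: X)) (bound_line X) (bound_line ('i%C *: X)) Dpos.
(* Covectors contribute 4 R at their metric duals by [dual_jet_sum], vectors contribute -4 R by
   [norm_jet_sum]. *)
have -> : \sum_i (second X i + second ('i%C *: X) i) / nu i = 4 * (
  \sum_s hform (curv h a y X X) (sharp a y (x s)) (sharp a y (x s)) /
    hform (gram h a y) (sharp a y (x s)) (sharp a y (x s))
  - \sum_t hform (curv h a y X X) (w t) (w t) / hform (gram h a y) (w t) (w t)).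
  rewrite big_sumType mulrBr !mulr_sumr -sumrN; congr (_ + _); apply: eq_bigr => i _ /=.
    rewrite (dual_jet_sum (@image_open _ _ _ a) (@gram_local_smooth _ _ _ h a)
      (@gram_local_herm _ _ _ h a) (@gram_local_unit _ _ _ h a))//.
    rewrite -(gram_local h da) cform_sharp ?gram_unit ?gram_hermitian//.
    by rewrite mulrA.
  rewrite (norm_jet_sum (@image_open _ _ _ a) (@gram_local_smooth _ _ _ h a))//.
  by rewrite -(gram_local h da) !mulNr mulrA.
by rewrite mulr_natl raddfMn /= pmulrn_lge0.
Qed.

End CurvatureInequality.

(** * Vanishing *)

Section Vanishing.
Context {R : realType} {n : nat} {M : complex_manifold R n}.
Variable h : hermitian_metric M.
Notation C := (Cplx R).
Notation V := (Cspace R n).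
Implicit Types (a b : chart_index M) (y : M).
Hypotheses (n_gt0 : (0 < n)%N) (compactM : compact [set: M]).

Lemma tensor_value_basis p q (T : tensor_components M p q) a y
    (I : {ffun 'I_p -> 'I_n}) (J : {ffun 'I_q -> 'I_n}) :
  tensor_value T a y (fun s => basis_vec (I s)) (fun t => basis_vec (J t)) = T a y I J.
Proof.
have delta m (K L : {ffun 'I_m -> 'I_n}) :
    \prod_s (basis_vec (K s) : V) 0 (L s) = (L == K)%:R.
  have [->|LK] := eqVneq L K.
    by rewrite big1// => s _; rewrite mxE !eqxx.
  have [s Ls] : exists s, L s != K s.
    apply: contrapT => no; case/eqP: LK; apply/ffunP => s; apply/eqP.
    by apply/negPn/negP => Ls; apply: no; exists s.
  by rewrite (bigD1 s)//= mxE eqxx (negbTE Ls) mul0r.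
rewrite /tensor_value (bigD1 I)//= (bigD1 J)//= !delta !eqxx !mulr1.
rewrite big1 => [|J' /negbTE JJ]; last by rewrite delta JJ mulr0.
rewrite addr0 big1 ?addr0// => I' /negbTE II.
by rewrite big1// => J' _; rewrite !delta II mulr0 mul0r.
Qed.

(** The maximum may be found in one chart while the pinching frame lives in another; hence the
    arguments are transported to an arbitrary chart around [y]. *)
Lemma nonzero_tensor_maximum p q (T : tensor_components M p q) :
  Gamma M p q T -> T <> zero_tensor M p q -> exists y, forall a, domain a y ->
  exists (u : 'I_p -> V) (w : 'I_q -> V),
    [/\ forall s, u s != 0, forall t, w t != 0 & forall X, 0 <= complex.Re (
      \sum_s hform (curv h a y X X) (u s) (u s) / hform (gram h a y) (u s) (u s)
      - \sum_t hform (curv h a y X X) (w t) (w t) / hform (gram h a y) (w t) (w t))].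
Proof.
move=> GT T0.
have [a0 [y0 [I [J TIJ]]]] : exists a y I J, T a y I J != 0.
  apply: contrapT => no; apply: T0; apply/funext => a; apply/funext => y.
  apply/funext => I; apply/funext => J; apply/eqP/negPn/negP => TIJ.
  by apply: no; exists a, y, I, J.
have d0 : domain a0 y0.
  apply: contrapT => nd; have [_ _ /(_ a0 y0 nd) e] := GT.
  by move: TIJ; rewrite e eqxx.
have [r [a1 [y [x1 [w1 [d1 x10 w10 rE]]]]] bnd] := global_maximum h n_gt0 compactM GT y0.
(* A maximum equal to 0, tested on basis vectors, would force the nonzero component at [y0] to
   vanish. *)
have r0 : r != 0.
  apply: contra TIJ => /eqP r0; rewrite -mul_conjC_eq0 eq_le mul_conjC_ge0 andbT.
  have := bnd y0 a0 (fun s => basis_vec (I s)) (fun t => basis_vec (J t)) d0.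
  by rewrite tensor_value_basis r0 mul0r.
exists y => a da.
have vE := tensor_value_chart GT x1 w1 da d1.
have nE := norm_product_chart h x1 w1 da d1.
move: vE nE; set x := fun s => _; set w := fun t => _ => vE nE.
have N0 : norm_product h a y x w != 0 by rewrite -nE gt_eqF// norm_product_gt0.
have [x0 w0] := norm_product_neq0 N0.
have rE' : tensor_ratio h T a y x w = r by rewrite -rE /tensor_ratio vE nE.
have v0 : tensor_value T a y x w != 0.
  rewrite -mul_conjC_eq0; have := tensor_ratioE h T da x0 w0.
  rewrite /normsq => ->; rewrite mulf_neq0// rE'.
  by apply: contra r0 => /eqP [->].
exists (fun s => sharp h a y (x s)), w; split=> // [s|X].
  have : 0 < cform (invmx (gram h a y)) (x s)^T by apply: cform_gt0 => //; exact: trmx_neq0.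
  rewrite cform_sharp ?gram_unit ?gram_hermitian// -/(sharp h a y (x s)).
  apply: contraTneq => ->.
  by rewrite hform00 ltxx.
exact: (maximum_curvature GT da x0 w0 rE' bnd v0 X).
Qed.

Definition frame_ratio k a y (E : 'I_k -> V) (Z : V) : R :=
  complex.Re ((\sum_i hform (curv h a y (E i) (E i)) Z Z) / hform (gram h a y) Z Z).

(** [nonzero_tensor_maximum] summed over [X = E i]. The point is fixed before the frame because the
    pinching frame depends on the point. *)
Lemma frame_ratio_inequality p q (T : tensor_components M p q) k :
  Gamma M p q T -> T <> zero_tensor M p q -> exists y, forall a (E : 'I_k -> V), domain a y ->
  exists (u : 'I_p -> V) (w : 'I_q -> V), [/\ forall s, u s != 0, forall t, w t != 0 &
    \sum_t frame_ratio a y E (w t) <= \sum_s frame_ratio a y E (u s)].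
Proof.
move=> GT T0; have [y hy] := nonzero_tensor_maximum GT T0.
exists y => a E da; have [u [w [u0 w0 ineq]]] := hy a da.
exists u, w; split=> //; rewrite -subr_ge0.
have := sumr_ge0 (index_enum 'I_k) (fun i (_ : true) => ineq (E i)).
congr (_ <= _); rewrite -raddf_sum sumrB raddfB /=; congr (_ - _).
  rewrite exchange_big raddf_sum; apply: eq_bigr => s _; congr complex.Re.
  by rewrite mulr_suml.
rewrite exchange_big raddf_sum; apply: eq_bigr => s _; congr complex.Re.
by rewrite mulr_suml.
Qed.

Lemma pinched_frame_ratio k (s : bool) (c : R) y : pinched h k ((-1) ^+ s) c y ->
  0 < c /\ exists a (E : 'I_k -> V), domain a y /\ forall Z, Z != 0 ->
    c^-1 < (-1) ^+ s * frame_ratio a y E Z < c.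
Proof.
move=> [c0 [a [E [da hE]]]]; split=> //; exists a, E; split=> // Z Z0.
have [h1 h2] := hE Z Z0.
have N0 : 0 < hform (gram h a y) Z Z by exact: gram_pos.
have e : (-1) ^+ s * frame_ratio a y E Z =
    complex.Re (frame_trace h ((-1) ^+ s) a y E Z / hform (gram h a y) Z Z).
  rewrite /frame_ratio /frame_trace -mulrA.
  by case: s {h1 h2 hE} => /=; rewrite ?expr1 ?expr0 ?mulN1r ?mul1r// raddfN.
have k1 : frame_trace h ((-1) ^+ s) a y E Z / hform (gram h a y) Z Z < c%:C%C.
  by rewrite ltr_pdivrMr.
have k2 : (c^-1)%:C%C < frame_trace h ((-1) ^+ s) a y E Z / hform (gram h a y) Z Z.
  by rewrite ltr_pdivlMr// fmorphV ltr_pdivrMl// ltcR.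
move: k1 k2; rewrite !ltcE => /andP[_ k1] /andP[_ k2].
by rewrite e; apply/andP; split.
Qed.

Lemma sum_bounds m (f : 'I_m -> R) (lo hi : R) :
  (forall i, lo < f i < hi) -> lo * m%:R <= \sum_i f i <= hi * m%:R.
Proof.
move=> hf; have e (t : R) : t * m%:R = \sum_(i < m) t.
  by rewrite sumr_const card_ord mulr_natr.
rewrite !e; apply/andP; split; apply: ler_sum => i _; by have /andP[/ltW ? /ltW ?] := hf i.
Qed.

(** Each of the [q] quotients exceeds [c^-1] and each of the [p] quotients is below [c], so a
    nonzero field would give [q / c <= c * p]. *)
Lemma Gamma_vanish_pos p q k (c : R) : (forall y, pinched h k 1 c y) ->
  c ^+ 2 * p%:R < q%:R -> forall T, Gamma M p q T -> T = zero_tensor M p q.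
Proof.
move=> hc pq T GT; apply: contrapT => T0.
have [y hy] := frame_ratio_inequality k GT T0.
have [c0 [a [E [da hE]]]] := @pinched_frame_ratio k false c y (hc y).
have [u [w [u0 w0 ineq]]] := hy a E da.
have /andP[_ h1] := @sum_bounds p (fun s => frame_ratio a y E (u s)) c^-1 c
  (fun s => eq_ind _ (fun t => c^-1 < t < c) (hE _ (u0 s)) _ (mul1r _)).
have /andP[h2 _] := @sum_bounds q (fun s => frame_ratio a y E (w s)) c^-1 c
  (fun s => eq_ind _ (fun t => c^-1 < t < c) (hE _ (w0 s)) _ (mul1r _)).
have := le_trans h2 (le_trans ineq h1).
by rewrite mulrC ler_pdivrMr// mulrAC -expr2 leNgt pq.
Qed.

(** Negating the quotients reverses the inequality at the maximum: a nonzero field would give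
    [p / c <= c * q]. *)
Lemma Gamma_vanish_neg p q k (c : R) : (forall y, pinched h k (-1) c y) ->
  c ^+ 2 * q%:R < p%:R -> forall T, Gamma M p q T -> T = zero_tensor M p q.
Proof.
move=> hc pq T GT; apply: contrapT => T0.
have [y hy] := frame_ratio_inequality k GT T0.
have [c0 [a [E [da hE]]]] := @pinched_frame_ratio k true c y (hc y).
have [u [w [u0 w0 ineq]]] := hy a E da.
have /andP[h1 _] := @sum_bounds p (fun s => - frame_ratio a y E (u s)) c^-1 c
  (fun s => eq_ind _ (fun t => c^-1 < t < c) (hE _ (u0 s)) _ (mulN1r _)).
have /andP[_ h2] := @sum_bounds q (fun s => - frame_ratio a y E (w s)) c^-1 c
  (fun s => eq_ind _ (fun t => c^-1 < t < c) (hE _ (w0 s)) _ (mulN1r _)).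
have := le_trans h1 (le_trans _ h2).
rewrite !sumrN lerN2 => /(_ ineq).
by rewrite mulrC ler_pdivrMr// mulrAC -expr2 leNgt pq.
Qed.

End Vanishing.

(** * The zero tensor, Hodge numbers and the conclusion *)

Lemma lin_indep_zero (K : fieldType) (V : lmodType K) d (s : 'I_d -> V) :
  (forall i, s i = 0) -> lin_indep s -> d = 0%N.
Proof.
move=> s0 ind; case: d s s0 ind => [//|d] s s0 ind.
have sum0 : \sum_(i < d.+1) (1 : K) *: s i = 0.
  by rewrite big1// => i _; rewrite s0 scaler0.
by have /eqP := ind (fun=> 1) sum0 ord0; rewrite oner_eq0.
Qed.

Section ZeroTensor.
Context {R : realType} {n : nat}.

Lemma smooth_zero (U : set (Cspace R n)) : smooth_on U (fun=> 0 : Cplx R).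
Proof.
have d0 v : dir_deriv (fun=> 0 : Cplx R) v = (fun=> 0 : Cplx R) :> (Cspace R n -> Cplx R).
  by apply/funext => z; apply: dir_derivE; exact: has_cderiv_cst.
elim=> [|m IH]; split=> //; try by move=> z _; exact: cst_continuous.
move=> v; rewrite d0; split=> // z _.
by split; exact: derivable_cst.
Qed.

Lemma zero_Gamma (M : complex_manifold R n) p q : Gamma M p q (zero_tensor M p q).
Proof.
split=> //.
  move=> a I J; split; first exact: smooth_zero.
  move=> z _ i.
  have d0 v w : dir_deriv (fun=> 0 : Cplx R) v w = 0 :> Cplx R.
    by apply: dir_derivE; exact: has_cderiv_cst.
  by rewrite /dzbar !d0 mulr0 addr0 mulr0.
move=> a b x _ _ I J; rewrite /zero_tensor big1// => K _; rewrite big1// => L _.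
by rewrite mulr0.
Qed.

Lemma hodge_number_eq0 (M : complex_manifold R n) q :
  Gamma M 0 q = [set zero_tensor M 0 q] -> hodge_number M q = 0%E.
Proof.
move=> G0; rewrite /hodge_number /dimension.
rewrite (_ : [set _ | _ in _] = [set 0%E]) ?ereal_sup1//.
apply/seteqP; split => [_ /= [d [s [hs ind]] <-]|_ /= ->].
  have s0 i : s i = 0 by have [] := hs i; rewrite G0.
  by rewrite (lin_indep_zero s0 ind).
(* The empty family puts 0 into the set of sizes; the supremum of an empty set would be -oo. *)
exists 0%N => //; exists (fun=> 0); split; first by case.
by move=> c _ [].
Qed.

End ZeroTensor.

Theorem theorem2p8 (R : realType) (n : nat) (M : complex_manifold R n)
    (h : hermitian_metric M) (compactM : compact [set: M])
    (kahler_like : chern_kahler_like h) :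
  ((exists k : nat, (1 <= k <= n)%N /\ ric_pos h k) ->
    (exists C : R, 0 < C /\
       forall p q : nat, C * p%:R < q%:R -> Gamma M p q = [set zero_tensor M p q])
    /\ (forall q : nat, (1 <= q)%N -> Gamma M 0 q = [set zero_tensor M 0 q])
    /\ (forall q : nat, (1 <= q <= n)%N -> hodge_number M q = 0%E))
  /\
  ((exists k : nat, (1 <= k <= n)%N /\ ric_neg h k) ->
    (exists C : R, 0 < C /\
       forall p q : nat, C * q%:R < p%:R -> Gamma M p q = [set zero_tensor M p q])
    /\ (forall p : nat, (1 <= p)%N -> Gamma M p 0 = [set zero_tensor M p 0])).
Proof.
have GE p q : (forall T, Gamma M p q T -> T = zero_tensor M p q) ->
    Gamma M p q = [set zero_tensor M p q].
  move=> hT; apply/seteqP; split=> T /=; first exact: hT.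
  by move=> ->; exact: zero_Gamma.
split=> -[k [kn ric]].
  have n0 : (0 < n)%N by case/andP: kn; exact: leq_trans.
  have [|||c c0 hc] := @exists_pinching R n M h k 1 kn _ kahler_like.
  - exact: conjC1.
  - move=> a x da Sigma dS E uE X XS X0; rewrite mul1r; exact: ric dS _ uE _ XS X0.
  - exact: compactM.
  have van p q : c ^+ 2 * p%:R < q%:R -> Gamma M p q = [set zero_tensor M p q].
    by move=> pq; apply: GE; exact: Gamma_vanish_pos pq.
  (* At [p = 0] the condition reads [0 < q], whatever the constant. *)
  have van0 q : (1 <= q)%N -> Gamma M 0 q = [set zero_tensor M 0 q].
    by move=> q0; apply: van; rewrite mulr0 ltr0n.
  split; first by exists (c ^+ 2); rewrite exprn_gt0.
  by split=> // q /andP[q0 _]; apply: hodge_number_eq0; exact: van0.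
have n0 : (0 < n)%N by case/andP: kn; exact: leq_trans.
have [|||c c0 hc] := @exists_pinching R n M h k (-1) kn _ kahler_like.
- exact: rmorphN1.
- move=> a x da Sigma dS E uE X XS X0; rewrite mulN1r oppr_gt0; exact: ric dS _ uE _ XS X0.
- exact: compactM.
have van p q : c ^+ 2 * q%:R < p%:R -> Gamma M p q = [set zero_tensor M p q].
  by move=> pq; apply: GE; exact: Gamma_vanish_neg pq.
split; first by exists (c ^+ 2); rewrite exprn_gt0.
by move=> p p0; apply: van; rewrite mulr0 ltr0n.
Qed.
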